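(* Let $D\subset\mathbb R^N$ be a fixed bounded set and let $\Omega_\varepsilon$, $\varepsilon>0$, and $\Omega$ be domains contained in $D$. Assume that $\Omega$ is of class $C^{0,1}$, that $\Omega\subseteq\Omega_\varepsilon$ for all $\varepsilon>0$, and that $\Omega_\varepsilon$ compactly converges to $\Omega$ as $\varepsilon\to0$. Let $\mathcal N_{\Omega_\varepsilon}:H^1(\Omega_\varepsilon)\to(H^1(\Omega_\varepsilon))'$ and $\mathcal N_\Omega:H^1(\Omega)\to(H^1(\Omega))'$ be the Navier-to-Neumann maps of $\Omega_\varepsilon$ and $\Omega$. Then $\mathcal N_{\Omega_\varepsilon}$ $EE^*$-converges to $\mathcal N_\Omega$ as $\varepsilon\to0$.
   Context: A domain is a connected open set. $H(\Delta,\Omega)=\{u\in L^2(\Omega):\Delta u\in L^2(\Omega)\}$, $\Delta u$ being the distributional Laplacian. **Compact convergence.** The domains $\Omega_\varepsilon$ compactly converge to $\Omega$ as $\varepsilon\to0$ if for every compact $K\subset\Omega\cup(\mathbb R^N\setminus\overline\Omega)$ there is $\varepsilon_K>0$ such that $K\subset\Omega_\varepsilon\cup(\mathbb R^N\setminus\overline{\Omega_\varepsilon})$ for all $\varepsilon\in(0,\varepsilon_K)$, in the Keldysh sense (compact subsets of $\Omega$ are eventually contained in $\Omega_\varepsilon$ and compact subsets of $\mathbb R^N\setminus\overline\Omega$ are eventually contained in $\mathbb R^N\setminus\overline{\Omega_\varepsilon}$). **Navier-to-Neumann map.** For $f\in H^1(\Omega)$ let $u\in H(\Delta,\Omega)\cap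 H^1_0(\Omega)$ be the (unique) weak solution of $\Delta^2u=0$ in $\Omega$, $u=0$ and $\Delta u=f$ on $\partial\Omega$, i.e. $\int_\Omega\Delta u\Delta\varphi\,dx=\int_\Omega(f\Delta\varphi+\nabla f\cdot\nabla\varphi)\,dx$ for all $\varphi\in H(\Delta,\Omega)\cap H^1_0(\Omega)$. Then $\mathcal N_\Omega(f)=u_\nu\in(H^1(\Omega))'$, the functional defined by $\langle u_\nu,\varphi\rangle=\int_\Omega(\Delta u\,\varphi+\nabla u\cdot\nabla\varphi)\,dx$ for all $\varphi\in H^1(\Omega)$. $\mathcal N_{\Omega_\varepsilon}$ is defined in the same way with $\Omega_\varepsilon$ in place of $\Omega$. **$EE^*$-convergence.** Let $\mathcal E:H^1(\Omega)\to H^1(\mathbb R^N)$ be a fixed linear continuous extension operator. For $f_\varepsilon\in H^1(\Omega_\varepsilon)$, $f\in H^1(\Omega)$, say $f_\varepsilon$ $E$-converges to $f$ if $\|f_\varepsilon-\mathcal Ef\|_{H^1(\Omega_\varepsilon)}\to0$ as $\varepsilon\to0$. Let $E_\varepsilon^*:(H^1(\Omega))'\to(H^1(\Omega_\varepsilon))'$, $\langle E_\varepsilon^*\Lambda,v\rangle=\langle\Lambda,v_{|\Omega}\rangle$ for $v\in H^1(\Omega_\varepsilon)$. For $\Lambda_\varepsilon\in(H^1(\Omega_\varepsilon))'$, $\Lambda\in(H^1(\Omega))'$, say $\Lambda_\varepsilon$ $E^*$-converges to $\Lambda$ if $\|\Lambda_\varepsilon-E_\varepsilon^*\Lambda\|_{(H^1(\Omega_\varepsilon))'}\to0$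 as $\varepsilon\to0$. Linear continuous operators $B_\varepsilon:H^1(\Omega_\varepsilon)\to(H^1(\Omega_\varepsilon))'$ $EE^*$-converge to $B\in\mathcal L(H^1(\Omega);(H^1(\Omega))')$ if $B_\varepsilon f_\varepsilon$ $E^*$-converges to $Bf$ whenever $f_\varepsilon$ $E$-converges to $f$. *)

(* Defs.v *)
From HB Require Import structures.
From mathcomp Require Import all_boot all_order all_algebra.
From mathcomp Require Import all_classical all_reals all_analysis.

Set Implicit Arguments.
Unset Strict Implicit.
Unset Printing Implicit Defensive.

Import Order.TTheory GRing.Theory Num.Theory.
Import numFieldNormedType.Exports.

Local Open Scope classical_set_scope.
Local Open Scope ring_scope.

(* R^N is 'rV[R]_N; `|x| is the sup norm, which is equivalent to the Euclidean
   one. The sigma-algebra is the product of the Borel sigma-algebras of R. *)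

Definition rV_display : measure_display. Proof. exact: default_measure_display. Qed.

Section measurable_rV.
Context (R : realType) (n : nat).

Let coord (i : 'I_n) (v : 'rV[R]_n) : R := v ord0 i.

Let rV_set0 : g_sigma_preimage coord set0.
Proof. exact: sigma_algebra0. Qed.

Let rV_setC A : g_sigma_preimage coord A -> g_sigma_preimage coord (~` A).
Proof. exact: sigma_algebraC. Qed.

Let rV_bigcup (F : (set 'rV[R]_n)^nat) :
  (forall i, g_sigma_preimage coord (F i)) ->
  g_sigma_preimage coord (\bigcup_i (F i)).
Proof. exact: sigma_algebra_bigcup. Qed.

HB.instance Definition _ := @isMeasurable.Build rV_display
  'rV[R]_n (g_sigma_preimage coord) rV_set0 rV_setC rV_bigcup.

End measurable_rV.

Lemma measurable_coord (R : realType) n (i : 'I_n) :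
  measurable_fun [set: 'rV[R]_n] (fun v : 'rV[R]_n => v ord0 i).
Proof.
move=> _ Y mY; rewrite setTI; apply: sub_sigma_algebra => /=.
rewrite -bigcup_seq/=; exists i => /=; first by rewrite mem_index_enum.
by exists Y => //; rewrite setTI.
Qed.

Lemma measurable_fun_rV d (T : measurableType d) (R : realType) n
    (f : T -> 'rV[R]_n) :
  (forall i, measurable_fun [set: T] (fun x => f x ord0 i)) ->
  measurable_fun [set: T] f.
Proof.
move=> mf.
suff sub : @measurable _ 'rV[R]_n `<=` image_set_system setT f (@measurable _ T).
  by move=> _ A mA; exact: (sub _ mA).
apply: smallest_sub.
  by apply: sigma_algebra_image; exact: sigma_algebra_measurable.
rewrite -bigcup_seq/= => C [i _ [B mB <-]].
rewrite /image_set_system /= setTI.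
exact: (mf i measurableT _ mB).
Qed.

Definition rV_cons (R : realType) n (z : measurableTypeR R * 'rV[R]_n) : 'rV[R]_n.+1 :=
  \row_(i < n.+1) if unlift ord0 i is Some j then z.2 ord0 j else z.1.

Lemma measurable_rV_cons (R : realType) n :
  measurable_fun [set: measurableTypeR R * 'rV[R]_n] (@rV_cons R n).
Proof.
apply: measurable_fun_rV => i.
under eq_fun do rewrite mxE.
case: unliftP => [j _|_]; last exact: measurable_fst.
exact: (measurableT_comp (@measurable_coord R n j) measurable_snd).
Qed.

Definition leb_succ (R : realType) n (m : {measure set 'rV[R]_n -> \bar R}) :
  {measure set 'rV[R]_n.+1 -> \bar R}.
Proof.
refine (pushforward (@lebesgue_measure R \x^ m)%E (@rV_cons R n)).
exact: measurable_rV_cons.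
Defined.

(* Lebesgue measure on R^N, as the N-fold product of lebesgue_measure. *)
Fixpoint leb (R : realType) (N : nat) : {measure set 'rV[R]_N -> \bar R} :=
  match N return {measure set 'rV[R]_N -> \bar R} with
  | 0 => @dirac _ _ (0 : 'rV[R]_0) R
  | n.+1 => leb_succ (leb R n)
  end.

Lemma leb_box (R : realType) (N : nat) (a b : 'rV[R]_N) :
  (forall i, a ord0 i <= b ord0 i) ->
  leb R N [set x | forall i, a ord0 i <= x ord0 i <= b ord0 i]
  = (\prod_(i < N) (b ord0 i - a ord0 i))%:E.
Proof.
elim: N a b => [|n IHn] a b ab.
  rewrite big_ord0 /= diracE mem_set//.
  by case.
pose tail (v : 'rV[R]_n.+1) : 'rV[R]_n := \row_j v ord0 (lift ord0 j).
have mbox : measurable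
    [set x : 'rV[R]_n | forall j, tail a ord0 j <= x ord0 j <= tail b ord0 j].
  rewrite (_ : mkset _ = \big[setI/setT]_(j < n)
      ((fun v : 'rV[R]_n => v ord0 j) @^-1`
        `[tail a ord0 j, tail b ord0 j]%classic)); last first.
    rewrite -bigcap_seq; apply/seteqP; split => x /= H j.
      by move=> _ /=; rewrite in_itv/=; exact: H.
    by have := H j; rewrite /= in_itv/= mem_index_enum; exact.
  apply: bigsetI_measurable => j _.
  rewrite -[X in measurable X]setTI.
  apply: (@measurable_coord R n j measurableT); exact: measurable_itv.
transitivity ((@lebesgue_measure R \x^ leb R n)%E
    (`[a ord0 ord0, b ord0 ord0] `*`
     [set x : 'rV[R]_n | forall j, tail a ord0 j <= x ord0 j <= tail b ord0 j])).
  rewrite /= /pushforward; congr (product_measure2 _ _ _).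
  apply/seteqP; split => -[t v] /=.
    move=> H; split.
      by have := H ord0; rewrite mxE unlift_none in_itv.
    by move=> j; have := H (lift ord0 j); rewrite !mxE liftK.
  move=> [+ H] i; rewrite in_itv/= mxE => H0.
  case: unliftP => [j ->|->//].
  by have := H j; rewrite !mxE.
rewrite product_measure2E//.
rewrite IHn; last by move=> j; rewrite !mxE.
rewrite /= lebesgue_measure_itv/= lte_fin big_ord_recl.
under eq_bigr do rewrite !mxE.
have := ab ord0; rewrite le_eqVlt => /predU1P[->|->].
  by rewrite ltxx mul0e subrr mul0r.
by rewrite -EFinD -EFinM.
Qed.

Section Sobolev.
Context (R : realType) (N : nat).
Implicit Types (Om : set 'rV[R]_N) (u v f g phi : 'rV[R]_N -> R).

Definition partial (i : 'I_N) f : 'rV[R]_N -> R :=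
  fun x => 'D_(delta_mx ord0 i) f x.

Definition laplacian f : 'rV[R]_N -> R :=
  fun x => \sum_(i < N) partial i (partial i f) x.

(* C^oo: all iterated partial derivatives (indexed by words in the
   coordinates) are differentiable everywhere. *)
Definition smooth f : Prop :=
  forall (s : seq 'I_N) x, differentiable (foldr partial f s) x.

Definition test_function Om phi : Prop :=
  let supp := closure [set x | phi x != 0] in
  [/\ smooth phi, compact supp & supp `<=` Om].

Definition L2 Om u : Prop :=
  measurable_fun Om u /\ (\int[leb R N]_(x in Om) (u x ^+ 2)%:E < +oo)%E.

Definition is_wpartial Om (i : 'I_N) u g : Prop :=
  forall phi, test_function Om phi ->
    \int[leb R N]_(x in Om) (u x * partial i phi x)
    = - \int[leb R N]_(x in Om) (g x * phi x).

Definition is_wlap Om u g : Prop :=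
  forall phi, test_function Om phi ->
    \int[leb R N]_(x in Om) (u x * laplacian phi x)
    = \int[leb R N]_(x in Om) (g x * phi x).

(* Elements of function spaces on Om are represented by total functions, of
   which only the values on Om matter, up to a.e. equality. [wpartial] and
   [wlap] pick a representative of the distributional derivative when it lies
   in L^2(Om); they are meaningless otherwise. *)
Definition wpartial Om (i : 'I_N) u : 'rV[R]_N -> R :=
  get [set g | L2 Om g /\ is_wpartial Om i u g].

Definition wlap Om u : 'rV[R]_N -> R :=
  get [set g | L2 Om g /\ is_wlap Om u g].

Definition H1 Om : set ('rV[R]_N -> R) :=
  [set u | L2 Om u /\ forall i, exists g, L2 Om g /\ is_wpartial Om i u g].

Definition HLap Om : set ('rV[R]_N -> R) :=
  [set u | L2 Om u /\ exists g, L2 Om g /\ is_wlap Om u g].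

Definition grad_dot Om u v : 'rV[R]_N -> R :=
  fun x => \sum_(i < N) wpartial Om i u x * wpartial Om i v x.

Definition H1norm Om u : R :=
  Num.sqrt (\int[leb R N]_(x in Om) (u x ^+ 2 + grad_dot Om u u x)).

(* closure of C_c^oo(Om) in H^1(Om) *)
Definition H10 Om : set ('rV[R]_N -> R) :=
  [set u | H1 Om u /\ forall e : R, 0 < e ->
     exists phi, test_function Om phi /\ H1norm Om (u - phi) < e].

(* (H^1(Om))'; functionals only matter on H^1(Om). *)
Definition H1dual Om : set (('rV[R]_N -> R) -> R) :=
  [set L | (forall (a : R) u v, H1 Om u -> H1 Om v ->
              L (a *: u + v) = a * L u + L v) /\
           (exists C : R, forall u, H1 Om u -> `|L u| <= C * H1norm Om u)].

Definition H1dual_norm Om (L : ('rV[R]_N -> R) -> R) : \bar R :=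
  ereal_sup [set `|L v|%:E | v in [set v | H1 Om v /\ H1norm Om v <= 1]].

Definition bounded_operator Om
    (B : ('rV[R]_N -> R) -> ('rV[R]_N -> R) -> R) : Prop :=
  [/\ forall f, H1 Om f -> H1dual Om (B f),
      forall (a : R) f g v, H1 Om f -> H1 Om g -> H1 Om v ->
        B (a *: f + g) v = a * B f v + B g v &
      exists C : R, forall f, H1 Om f ->
        (H1dual_norm Om (B f) <= (C * H1norm Om f)%:E)%E].

(* Delta^2 u = 0 in Om, u = 0 and Delta u = f on the boundary, weakly *)
Definition navier_solution Om f u : Prop :=
  (HLap Om u /\ H10 Om u) /\
  forall phi, HLap Om phi -> H10 Om phi ->
    \int[leb R N]_(x in Om) (wlap Om u x * wlap Om phi x)
    = \int[leb R N]_(x in Om) (f x * wlap Om phi x + grad_dot Om f phi x).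

Definition navier_to_neumann Om f : ('rV[R]_N -> R) -> R :=
  let u := get (navier_solution Om f) in
  fun phi => \int[leb R N]_(x in Om) (wlap Om u x * phi x + grad_dot Om u phi x).

Definition domain Om : Prop := open Om /\ connected Om.

(* Near each boundary point, in suitable orthonormal coordinates, Om is the
   strict hypograph of a Lipschitz function of the other N - 1 coordinates.
   For bounded Om this is the usual definition with a finite atlas. *)
Definition class_C01 Om : Prop :=
  forall p, closure Om p -> ~ interior Om p ->
  exists (Q : 'M[R]_N) (k : 'I_N) (g : 'rV[R]_N.-1 -> R),
    [/\ Q *m Q^T = 1%:M, lipschitz (g : _ -> R^o) &
        \forall x \near p,
          Om x <-> (x *m Q) ord0 k < g (col' k (x *m Q))].

Definition compactly_converges (Om_ : R -> set 'rV[R]_N) Om : Prop :=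
  forall K : set 'rV[R]_N, compact K -> K `<=` Om `|` ~` closure Om ->
  exists2 eK : R, 0 < eK & forall e, 0 < e < eK ->
    [/\ K `<=` Om_ e `|` ~` closure (Om_ e),
        K `<=` Om -> K `<=` Om_ e &
        K `<=` ~` closure Om -> K `<=` ~` closure (Om_ e)].

Definition extension_operator Om (E : ('rV[R]_N -> R) -> 'rV[R]_N -> R) : Prop :=
  [/\ forall u, H1 Om u -> H1 setT (E u),
      forall u, H1 Om u -> {ae leb R N, forall x, Om x -> E u x = u x},
      forall (a : R) u v, H1 Om u -> H1 Om v ->
        {ae leb R N, forall x, E (a *: u + v) x = a * E u x + E v x} &
      exists C : R, forall u, H1 Om u -> H1norm setT (E u) <= C * H1norm Om u].

Definition E_converges (Om_ : R -> set 'rV[R]_N)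
    (E : ('rV[R]_N -> R) -> 'rV[R]_N -> R) (f_ : R -> 'rV[R]_N -> R) f : Prop :=
  H1norm (Om_ e) (f_ e - E f) @[e --> 0^'+] --> (0 : R).

(* E_eps^* does not depend on eps as a map on functionals of total functions. *)
Definition Estar Om (L : ('rV[R]_N -> R) -> R) : ('rV[R]_N -> R) -> R :=
  fun v => L (v \_ Om).

Definition Estar_converges (Om_ : R -> set 'rV[R]_N) Om
    (L_ : R -> ('rV[R]_N -> R) -> R) (L : ('rV[R]_N -> R) -> R) : Prop :=
  H1dual_norm (Om_ e) (fun v => L_ e v - Estar Om L v) @[e --> 0^'+] --> 0%E.

Definition EEstar_converges (Om_ : R -> set 'rV[R]_N) Om
    (E : ('rV[R]_N -> R) -> 'rV[R]_N -> R)
    (B_ : R -> ('rV[R]_N -> R) -> ('rV[R]_N -> R) -> R)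
    (B : ('rV[R]_N -> R) -> ('rV[R]_N -> R) -> R) : Prop :=
  [/\ forall e, 0 < e -> bounded_operator (Om_ e) (B_ e),
      bounded_operator Om B &
      forall (f_ : R -> 'rV[R]_N -> R) f,
        (forall e, 0 < e -> H1 (Om_ e) (f_ e)) -> H1 Om f ->
        E_converges Om_ E f_ f ->
        Estar_converges Om_ Om (fun e => B_ e (f_ e)) (B f)].

End Sobolev.

(* Main.v *)
(* Writing w = Delta u, the Navier problem is a cascade of two Dirichlet problems:
   w is harmonic with boundary values f, and u in H^1_0 solves Delta u = w; then
   <N(f), v> is the H^1 pairing of (w, grad u) with (v, grad v). Both problems are
   orthogonal projections onto H^1_0, so it suffices to show that the projections
   onto H^1_0(Om_ e), extended by zero, converge to the one onto H^1_0(Om).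
   Compact convergence puts Om_ e between Om and a thin neighbourhood of Om, so
   the projection onto H^1_0(Om_ e) is squeezed between the projections for Om and
   for the neighbourhoods. The latter decrease, and their limit is the projection
   onto the intersection of the spaces H^1_0(neighbourhood), which is H^1_0(Om)
   because near a boundary point a Lipschitz domain can be reached from its
   neighbourhoods by a small translation. Finally f_ e - E f is small in
   H^1(Om_ e), and E f is small in L^2(Om_ e \ Om) since the boundary of Om is
   a null set. *)
From HB Require Import structures.
Require Import Defs.
From mathcomp Require Import all_boot all_order all_algebra.
From mathcomp Require Import all_classical all_reals all_analysis measurable_realfun ring lra.

Set Implicit Arguments.
Unset Strict Implicit.
Unset Printing Implicit Defensive.

Import Order.TTheory GRing.Theory Num.Theory.
Import numFieldNormedType.Exports.

Local Open Scope classical_set_scope.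
Local Open Scope ring_scope.

(** Functions are not identified when they agree almost everywhere, derivatives are arbitrary
    choices made by [get], and every domain has its own function space. This is met by working with
    pairs (u, p) of functions on all of R^N: extension by zero is then built in, larger domains have
    larger spaces, and a single positive semidefinite form serves them all, no quotient being taken.
    The squeeze between projections needs one and the same linear functional on all the spaces
    compared, whereas the data of both Dirichlet problems change with e. Each problem is therefore
    split by an auxiliary solution on [Om_ e] with the limit datum: changing the datum costs a
    stability estimate, changing the domain is the squeeze. The constants do not depend on e because
    for small e all the domains lie in the neighbourhood of [Om] of width 1, where one Poincare
    inequality holds. As <N(f), v> pairs v with an object depending on f alone, norm convergence of
    these objects gives convergence in the dual norm by Cauchy-Schwarz. *)

(** * Square-integrable functions and the completeness of L^2 *)

Section square_integrable.
Context d (T : measurableType d) (R : realType) (mu : {measure set T -> \bar R}).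
Implicit Types f g h : T -> R.

Lemma integrable_EFinD f g : mu.-integrable setT (EFin \o f) ->
  mu.-integrable setT (EFin \o g) ->
  mu.-integrable setT (EFin \o (fun x => f x + g x)).
Proof. by move=> fi gi; apply: eq_integrable (integrableD _ fi gi). Qed.

Lemma integrable_EFinZ (a : R) f : mu.-integrable setT (EFin \o f) ->
  mu.-integrable setT (EFin \o (fun x => a * f x)).
Proof. by move=> fi; apply: eq_integrable (integrableZl _ a fi). Qed.

(** Integration is over the whole space; a function on a domain will enter as its extension by
    zero. *)
Definition sqint f := measurable_fun setT f /\
  mu.-integrable setT (EFin \o (fun x => f x ^+ 2)).

Definition ip f g : R := \int[mu]_x (f x * g x).

Lemma integrable_ip f g : sqint f -> sqint g ->
  mu.-integrable setT (EFin \o (fun x => f x * g x)).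
Proof.
move=> [mf if2] [mg ig2]; apply: le_integrable (integrableD _ if2 ig2) => //.
  exact/measurable_EFinP/measurable_funM.
move=> x _ /=; rewrite lee_fin [leRHS]ger0_norm ?addr_ge0 ?sqr_ge0// ler_norml.
by apply/andP; split; nra.
Qed.

Lemma sqintP f : measurable_fun setT f ->
  (exists2 g, mu.-integrable setT (EFin \o g) & forall x, f x ^+ 2 <= g x) ->
  sqint f.
Proof.
move=> mf [g ig fg]; split => //; apply: le_integrable ig => //.
  exact/measurable_EFinP/measurable_funX.
by move=> x _ /=; rewrite lee_fin ger0_norm ?sqr_ge0// (le_trans (fg x))// ler_norm.
Qed.

Lemma sqint_lin (a : R) f g : sqint f -> sqint g -> sqint (a *: f + g).
Proof.
move=> sf sg; have [mf if2] := sf; have [mg ig2] := sg; apply: sqintP.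
  by apply: measurable_funD => //; exact: measurable_funM.
exists (fun x => (2 * a ^+ 2) * f x ^+ 2 + 2 * g x ^+ 2).
  by apply: integrable_EFinD; exact: integrable_EFinZ.
move=> x; rewrite /= -[(a *: f + g) x]/(a * f x + g x).
have := sqr_ge0 (a * f x - g x); nra.
Qed.

Lemma sqint0 : sqint 0.
Proof.
apply: sqintP; first exact: measurable_cst.
exists (fun=> 0) => [|x]; last by rewrite expr0n.
exact: integrable0.
Qed.

Lemma sqintD f g : sqint f -> sqint g -> sqint (f + g).
Proof. by move=> sf sg; rewrite -[f]scale1r; exact: sqint_lin. Qed.

Lemma sqintB f g : sqint f -> sqint g -> sqint (f - g).
Proof. by move=> sf sg; rewrite addrC -scaleN1r; exact: sqint_lin. Qed.

Lemma ipC f g : ip f g = ip g f.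
Proof. by apply: eq_Rintegral => x _; rewrite mulrC. Qed.

Lemma ip_linl (a : R) f g h : sqint f -> sqint g -> sqint h ->
  ip (a *: f + g) h = a * ip f h + ip g h.
Proof.
move=> sf sg sh; rewrite /ip -RintegralZl//; last exact: integrable_ip.
rewrite -RintegralD//; last 2 first.
- by apply: integrable_EFinZ; exact: integrable_ip.
- exact: integrable_ip.
by apply: eq_Rintegral => x _; rewrite -[(_ + _) x]/(a * f x + g x) mulrDl mulrA.
Qed.

Lemma ip_ge0 f : 0 <= ip f f.
Proof. by apply: Rintegral_ge0 => x _; rewrite -expr2 sqr_ge0. Qed.

Lemma ip_ae f f' g g' : sqint f -> sqint f' -> sqint g -> sqint g' ->
  ae_eq mu setT f f' -> ae_eq mu setT g g' -> ip f g = ip f' g'.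
Proof.
move=> [mf _] [mf' _] [mg _] [mg' _] ff' gg'; congr fine.
apply: ae_eq_integral => //.
- by apply/measurable_EFinP/measurable_funM.
- by apply/measurable_EFinP/measurable_funM.
by apply: filterS2 ff' gg' => x /= + + _; move=> -> // ->.
Qed.

Lemma ip_eq0 f : sqint f -> ip f f = 0 -> ae_eq mu setT f (cst 0).
Proof.
move=> [mf if2] f0.
have /ae_eq_integral_abs : measurable_fun setT (EFin \o (fun x => f x ^+ 2)).
  exact/measurable_EFinP/measurable_funX.
move=> /(_ mu measurableT)[+ _]; have -> : (\int[mu]_x `|(EFin \o (fun x => f x ^+ 2)%R) x| = 0)%E.
  rewrite -[RHS]/((0 : R)%:E) -f0 /ip /Rintegral fineK; last first.
    by apply: integrable_fin_num => //; apply: eq_integrable if2.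
  by apply: eq_integral => x _ /=; rewrite ger0_norm ?sqr_ge0 ?expr2.
move=> /(_ erefl); apply: filterS => x /= + _; move=> /(_ I)[/eqP].
by rewrite sqrf_eq0 => /eqP.
Qed.

Lemma ae0_ip f : sqint f -> ae_eq mu setT f (cst 0) -> ip f f = 0.
Proof.
move=> sf f0; rewrite (ip_ae sf sqint0 sf sqint0)//.
by rewrite /ip; under eq_Rintegral do rewrite mulr0; rewrite Rintegral_cst// mul0r.
Qed.

Lemma ipE f : sqint f -> (\int[mu]_x (f x ^+ 2)%:E)%E = (ip f f)%:E.
Proof.
move=> [mf if2]; rewrite /ip /Rintegral fineK.
  by apply: eq_integral => x _; rewrite expr2.
by apply: integrable_fin_num => //; apply: eq_integrable if2.
Qed.

Lemma sqint_ltP f : measurable_fun setT f ->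
  (\int[mu]_x (f x ^+ 2)%:E < +oo)%E -> sqint f.
Proof.
move=> mf fy; split => //; apply/integrableP; split.
  exact/measurable_EFinP/measurable_funX.
rewrite (_ : integral _ _ _ = \int[mu]_x (f x ^+ 2)%:E)%E//.
by apply: eq_integral => x _ /=; rewrite ger0_norm ?sqr_ge0.
Qed.

(** Fatou's lemma for the squares. The completeness proof uses it to turn pointwise convergence of a
    subsequence into an L^2 bound. *)
Lemma fatou_sqint (s : nat -> T -> R) f (e : R) :
  (forall n, sqint (s n)) -> (forall n, ip (s n) (s n) <= e) ->
  (forall x, s n x @[n --> \oo] --> f x) -> sqint f /\ ip f f <= e.
Proof.
move=> ss se sf.
have mf : measurable_fun setT f.
  by apply: (measurable_fun_cvg (h := s)) => // m; case: (ss m).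
suff fe : (\int[mu]_x (f x ^+ 2)%:E <= e%:E)%E.
  have sqf : sqint f by apply: sqint_ltP => //; rewrite (le_lt_trans fe)// ltry.
  by split => //; rewrite -lee_fin -ipE.
have := @fatou _ _ _ mu setT measurableT (fun n x => (s n x ^+ 2)%:E).
rewrite (_ : (fun x => limn_einf _) = (fun x => (f x ^+ 2)%:E)); last first.
  apply/funext => x; have : (s n x ^+ 2)%:E @[n --> \oo] --> (f x ^+ 2)%:E.
    apply: cvg_EFin; first by apply: nearW.
    by have h := cvgM (sf x) (sf x); exact: h.
  move=> h; rewrite is_cvg_limn_einfE; first exact: cvg_lim h.
  by apply/cvg_ex; eexists; exact: h.
move=> /(_ _ _)/le_trans; apply.
- by move=> n; apply/measurable_EFinP/measurable_funX; case: (ss n).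
- by move=> n x _; rewrite lee_fin sqr_ge0.
rewrite limn_einf_lim; apply: lime_le; first exact: is_cvg_einfs.
apply: nearW => n; apply: (@le_trans _ _ (ip (s n) (s n))%:E); last by rewrite lee_fin.
by rewrite -ipE//; apply: ereal_inf_lbound; exists n => /=.
Qed.

(** The Riesz-Fischer argument: a subsequence with summable increments converges almost everywhere,
    and Fatou carries the Cauchy bounds over to its limit. *)
Lemma ip_complete (s : nat -> T -> R) : (forall n, sqint (s n)) ->
  (forall e, 0 < e -> exists n0, forall n m, (n0 <= n)%N -> (n0 <= m)%N ->
    ip (s n - s m) (s n - s m) <= e) ->
  exists2 f, sqint f & forall e, 0 < e -> exists n0, forall n, (n0 <= n)%N ->
    ip (s n - f) (s n - f) <= e.
Proof.
move=> ss sC.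
(* With this bound on the squared increments, the weight 4^k used in [h] leaves integrals of at most
   2^-(k+1), whose sum is 1; and where the weighted sum [G] is finite, the increments are
   O(2^-k). *)
have c0 k : 0 < (4 ^- k * 2 ^- k.+1 : R) by rewrite mulr_gt0 ?invr_gt0 ?exprn_gt0.
have [K HK] := choice (fun k => sC _ (c0 k)).
(* Summing the [K i] makes [N j] at least [K k] for all j >= k; the extra summand k makes [N]
   unbounded. *)
pose N k := (k + \sum_(i < k.+1) K i)%N.
have KN k j : (k <= j)%N -> (K k <= N j)%N.
  move=> kj; rewrite (leq_trans _ (leq_addl _ _))//.
  by rewrite (bigD1 (Ordinal (kj : (k < j.+1)%N)))//= leq_addr.
pose g k := s (N k).
pose D k := g k.+1 - g k.
have sD i : sqint (D i) by apply: sqintB; apply: ss.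
have DE i : ip (D i) (D i) <= 4 ^- i * 2 ^- i.+1 by apply: HK; apply: KN.
pose h k x := (4 ^+ k * D k x ^+ 2)%:E.
have h0 k x : (0 <= h k x)%E by rewrite lee_fin mulr_ge0 ?sqr_ge0 ?exprn_ge0.
have mh k : measurable_fun setT (h k).
  apply/measurable_EFinP/measurable_funM => //; apply: measurable_funX.
  by case: (sD k).
pose G x := (\sum_(0 <= k <oo) h k x)%E.
have iG : (\int[mu]_x G x <= 1)%E.
  rewrite /G integral_nneseries//.
  apply: le_trans (epsilon_trick0 xpredT (@ler01 R)).
  apply: lee_nneseries => k _; first by move=> _; exact: integral_ge0.
  rewrite /h; under eq_integral do rewrite EFinM.
  rewrite ge0_integralZl_EFin//=.
  - rewrite ipE// -EFinM lee_fin -ler_pdivlMl ?exprn_gt0// natrX mul1r.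
    exact: DE.
  - by move=> x _; rewrite lee_fin sqr_ge0.
  - by apply/measurable_EFinP/measurable_funX; case: (sD k).
have mG : measurable_fun setT G.
  by apply: ge0_emeasurable_sum.
have G0 x : (0 <= G x)%E by apply: nneseries_ge0.
have aeG : {ae mu, forall x, G x \is a fin_num}.
  have /integrable_ae : mu.-integrable setT G.
    apply/integrableP; split => //; apply: le_lt_trans (ltry 1).
    by under eq_integral do rewrite gee0_abs//.
  by move=> /(_ measurableT); apply: filterS => x /(_ I).
pose A := [set x | G x \is a fin_num].
have mA : measurable A.
  rewrite /A (_ : [set x | _] = setT `&` G @^-1` [set x | (x < +oo)%E]).
    by apply: emeasurable_fun_infty_o.
  by apply/seteqP; split => [x|x []] /=; rewrite ge0_fin_numE.
(* The indicator of [A] forces convergence at every point, as [fatou_sqint] requires, and changes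
   each [g k] on a null set only. *)
pose f x := limn (fun k => g k x * \1_A x).
have gf x : g k x * \1_A x @[k --> \oo] --> f x.
  suff : cvgn (fun k => g k x * \1_A x) by [].
  rewrite indicE; case: (boolP (x \in A)) => [|_].
    rewrite inE => Ax; have Gx : G x = (fine (G x))%:E by rewrite fineK.
    rewrite [X in cvgn X](_ : _ = fun k => g k x); last first.
      by apply/funext => k; rewrite mulr1.
    suff : cvgn (fun k => g k x - g 0%N x).
      move=> cg; rewrite (_ : (fun k => g k x) = (fun k => g k x - g 0%N x + g 0%N x)).
        by apply: is_cvgD => //; exact: is_cvg_cst.
      by apply/funext => k; rewrite subrK.
    have -> : (fun k => g k x - g 0%N x) = series (fun k => D k x).
      rewrite -[RHS]/(series (telescope (g^~ x))) telescopeK //.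
    apply: normed_cvg; apply: (@series_le_cvg _ _ (geometric (1 + fine (G x)) 2^-1)).
    - by move=> n; exact: normr_ge0.
    - move=> n /=; rewrite mulr_ge0 ?exprn_ge0 ?invr_ge0 ?addr_ge0//.
      by rewrite fine_ge0.
    - move=> n /=; rewrite exprVn ler_pdivlMr ?exprn_gt0//.
      have : (h n x <= G x)%E.
        apply: le_trans (nneseries_lim_ge n.+1 _) => //.
        by rewrite big_nat_recr//= leeDr// sume_ge0.
      rewrite Gx lee_fin (_ : 4 = 2 ^+ 2); last by rewrite -natrX.
      rewrite -exprM mulnC exprM -exprMn -real_normK ?num_real//.
      rewrite normrM [`|2 ^+ n|]ger0_norm ?exprn_ge0// [2 ^+ n * _]mulrC.
      by move: (`|D n x| * 2 ^+ n) => y; nra.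
    - by apply: is_cvg_geometric_series; rewrite gtr0_norm ?invf_lt1// ltr1n.
  rewrite [X in cvgn X](_ : _ = fun=> 0); last first.
    by apply/funext => k; rewrite mulr0.
  exact: is_cvg_cst.
have sgA k : sqint (fun x => g k x * \1_A x).
  have [mgk igk] : sqint (g k) by exact: ss.
  apply: sqintP; first by apply: measurable_funM => //; exact: measurable_indic.
  exists (fun x => g k x ^+ 2) => // x; rewrite indicE.
  by case: (x \in A) => /=; rewrite ?mulr1// mulr0 expr0n sqr_ge0.
have gA k : ae_eq mu setT (g k) (fun x => g k x * \1_A x).
  by apply: filterS aeG => x Ax _; rewrite indicE mem_set// mulr1.
(* Fatou with n fixed and the subsequence running from k0 on. *)
have key n k0 e : (forall k, (k0 <= k)%N -> ip (s n - s k) (s n - s k) <= e) ->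
    sqint (s n - f) /\ ip (s n - f) (s n - f) <= e.
  move=> ke; apply: (@fatou_sqint (fun k => s n - (fun x => g (k0 + k)%N x * \1_A x))).
  - by move=> k; exact: sqintB.
  - move=> k; have sk := sqintB (ss n) (sgA (k0 + k)%N).
    have sk' := sqintB (ss n) (ss (N (k0 + k)%N)).
    have ae1 : ae_eq mu setT (s n - (fun x => g (k0 + k)%N x * \1_A x))
        (s n - s (N (k0 + k)%N)).
      apply: filterS (gA (k0 + k)%N) => x /(_ I) gx _.
      by rewrite -[LHS]/(s n x - _) -gx.
    rewrite (ip_ae sk sk' sk sk' ae1 ae1) ke//.
    rewrite /N -addnA leq_addr //.
  - move=> x; apply: cvgB; first exact: cvg_cst.
    by have := gf x; rewrite -(cvg_shiftn k0); under eq_fun do rewrite addnC.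
have [e1 _] : 0 < (1 : R) /\ True by split.
have [n1 H1] := sC _ e1.
exists f.
  have [sf _] := @key n1 n1 1 (fun k k1 => H1 n1 k (leqnn _) k1).
  by rewrite (_ : f = s n1 - (s n1 - f)); [exact: sqintB | rewrite opprB addrC subrK].
move=> e e0; have [n0 H0] := sC _ e0; exists n0 => n nn0.
by have [_] := @key n n0 e (fun k k1 => H0 n k nn0 k1).
Qed.

End square_integrable.

(** * Hilbert space geometry of a semidefinite form: Riesz representation and nested projections *)

Section semi_hilbert.
Context (R : realType) (X : lmodType R) (B : X -> X -> R) (S : set X).
Context (SL : forall (a : R) u v, S u -> S v -> S (a *: u + v)).
Context (BC : forall u v, B u v = B v u).
Context (BL : forall (a : R) u v w, S u -> S v -> S w ->
  B (a *: u + v) w = a * B u w + B v w).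
Context (B0 : forall u, 0 <= B u u).

Definition subspace (V : set X) :=
  [/\ V `<=` S, V 0 & forall (a : R) u v, V u -> V v -> V (a *: u + v)].

(** As [B] is only semidefinite, the limit u is determined only up to [B]-null vectors. *)
Definition bcomplete (V : set X) := forall s : nat -> X,
  (forall n, V (s n)) ->
  (forall e, 0 < e -> exists n0, forall n m, (n0 <= n)%N -> (n0 <= m)%N ->
    B (s n - s m) (s n - s m) <= e) ->
  exists2 u, V u & forall e, 0 < e -> exists n0, forall n, (n0 <= n)%N ->
    B (s n - u) (s n - u) <= e.

(** For linear [l], such a v is a minimiser of B u u - 2 l u over the subspace [V]; for [l] = [B g]
    it is a projection of g onto [V]. *)
Definition represents (V : set X) (l : X -> R) v :=
  V v /\ forall w, V w -> B v w = l w.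

Lemma subspaceB V u v : subspace V -> V u -> V v -> V (u - v).
Proof. by move=> [_ _ VL] Vu Vv; rewrite addrC -scaleN1r; exact: VL. Qed.

Lemma subspaceD V u v : subspace V -> V u -> V v -> V (u + v).
Proof. by move=> [_ _ VL] Vu Vv; rewrite -[u]scale1r; exact: VL. Qed.

Lemma subspaceZ V a u : subspace V -> V u -> V (a *: u).
Proof. by move=> [_ V0 VL] Vu; rewrite -[_ *: _]addr0; exact: VL. Qed.

Lemma SB u v : S u -> S v -> S (u - v).
Proof. by move=> Su Sv; rewrite addrC -scaleN1r; exact: SL. Qed.

Lemma formDl u v w : S u -> S v -> S w -> B (u + v) w = B u w + B v w.
Proof. by move=> *; rewrite -[u]scale1r BL// scale1r mul1r. Qed.

Lemma formBl u v w : S u -> S v -> S w -> B (u - v) w = B u w - B v w.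
Proof. by move=> *; rewrite addrC -scaleN1r BL// mulN1r addrC. Qed.

Lemma formZl (a : R) u v : S u -> S v -> B (a *: u) v = a * B u v.
Proof.
move=> Su Sv; rewrite -[a in LHS](subrK 1) scalerDl scale1r BL//.
by rewrite mulrBl mul1r subrK.
Qed.

Lemma formBB u v : S u -> S v ->
  B (u - v) (u - v) = B u u - 2 * B u v + B v v.
Proof.
move=> Su Sv; have Suv := SB Su Sv.
rewrite formBl// [B u _]BC [B v _]BC !formBl// [B v u]BC; lra.
Qed.

Lemma formLL a u v : S u -> S v ->
  B (a *: u + v) (a *: u + v) = a ^+ 2 * B u u + 2 * a * B u v + B v v.
Proof.
move=> Su Sv; have Suv := SL a Su Sv.
rewrite BL// [B u _]BC [B v _]BC !BL// [B v u]BC; lra.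
Qed.

Lemma form_cs u v : S u -> S v -> B u v ^+ 2 <= B u u * B v v.
Proof.
move=> Su Sv.
have H a : 0 <= a ^+ 2 * B u u + 2 * a * B u v + B v v by rewrite -formLL.
have := B0 u; have := B0 v; move: (B u u) (B v v) (B u v) H => a b c H b0 a0.
(* The form may vanish on nonzero vectors. If B u u = 0, the nonnegative quadratic is affine in its
   parameter, so its slope 2 B u v must vanish. *)
have [a00|an0] := eqVneq a 0.
  suff : c = 0 by move=> ->; rewrite a00 mul0r expr0n.
  apply/eqP/negP => /negP c0.
  have := H (- (b + 1) / (2 * c)).
  rewrite a00 mulr0 add0r (_ : 2 * _ * c = - (b + 1)); first lra.
  by field.
have a1 : 0 < a by rewrite lt_neqAle eq_sym an0.
have := H (- c / a).
rewrite (_ : _ + b = (a * b - c ^+ 2) / a); last by field.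
by rewrite pmulr_lge0 ?invr_gt0// subr_ge0.
Qed.

Lemma form_le2 u v : S u -> S v ->
  B (u + v) (u + v) <= 2 * B u u + 2 * B v v.
Proof.
move=> Su Sv; rewrite -[u]scale1r formLL// scale1r.
by have := B0 (u - v); rewrite formBB//; lra.
Qed.

Lemma form_le2B u v : S u -> S v ->
  B (u - v) (u - v) <= 2 * B u u + 2 * B v v.
Proof.
move=> Su Sv; rewrite formBB//.
by have := B0 (1 *: u + v); rewrite formLL//; lra.
Qed.

(** The first-order condition: a quadratic that is minimal at t = 0 has no linear term. The test
    value is t = - c / (b + 1), with the 1 because b may vanish. *)
Lemma quadratic_min (c b : R) : 0 <= b ->
  (forall t, 0 <= 2 * t * c + t ^+ 2 * b) -> c = 0.
Proof.
move=> b0 /(_ (- c / (b + 1))) H; have b1 : 0 < b + 1 by lra.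
have : 2 * (- c / (b + 1)) * c + (- c / (b + 1)) ^+ 2 * b =
  - (c ^+ 2 * (b + 2) / (b + 1) ^+ 2) by field; lra.
move=> E; move: H; rewrite {}E oppr_ge0 pmulr_lle0 ?invr_gt0 ?exprn_gt0//.
rewrite pmulr_lle0; last lra.
by move=> H; apply/eqP; rewrite -sqrf_eq0 eq_le H sqr_ge0.
Qed.

Lemma le_sqr_small (x y : R) : 0 <= y -> x ^+ 2 <= y ^+ 2 -> - y <= x.
Proof.
move=> y0 xy; have : `|x| <= y by rewrite -ler_sqr ?nnegrE// real_normK ?num_real.
by rewrite ler_norml => /andP[].
Qed.

(** The direct method: [J] is bounded below by - C, the parallelogram identity makes a minimising
    sequence Cauchy, and its limit satisfies the Euler equation. *)
Lemma riesz V (l : X -> R) (C : R) : subspace V -> bcomplete V ->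
  (forall (a : R) u v, V u -> V v -> l (a *: u + v) = a * l u + l v) ->
  0 <= C -> (forall u, V u -> l u ^+ 2 <= C * B u u) ->
  exists v, represents V l v.
Proof.
move=> sV cV lL C0 lC; have [VS V0 VL] := sV.
pose J u := B u u - 2 * l u.
have Jlb u : V u -> - C <= J u.
  move=> Vu; rewrite /J; have := lC _ Vu; have := B0 u.
  move: (B u u) (l u) => b c b0 cb.
  have : - (b + C) <= - (2 * c); last lra.
  by apply: le_sqr_small; [lra|have := sqr_ge0 (b - C); nra].
pose E := [set J u | u in V].
have infE : has_inf E.
  by split; [exists (J 0), 0|exists (- C) => _ [u Vu <-]; exact: Jlb].
pose m := inf E.
have mJ u : V u -> m <= J u.
  by move=> Vu; apply: ge_inf; [case: infE|exists u].
have Jn (n : nat) : exists u, V u /\ J u <= m + n.+1%:R^-1.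
  have [|_ [u Vu <-] Ju] := @inf_adherent _ _ (n.+1%:R^-1) _ infE.
    by rewrite invr_gt0.
  by exists u; split => //; exact: ltW.
have [v Hv] := choice Jn.
(* Parallelogram identity: B (u - w) (u - w) is 2 J u + 2 J w minus four times the value of J at the
   midpoint, which is at least m. *)
have Jpar u w : V u -> V w ->
    B (u - w) (u - w) <= 2 * (J u - m) + 2 * (J w - m).
  move=> Vu Vw; have Vuw : V (2^-1 *: (u + w)).
    by apply: subspaceZ => //; exact: subspaceD.
  have := mJ _ Vuw; rewrite /J.
  have l0 : l 0 = 0.
    have := lL 1 0 0 V0 V0; rewrite scaler0 addr0 mul1r => /eqP.
    by rewrite -subr_eq0 opprD addNKr oppr_eq0 => /eqP.
  have -> : l (2^-1 *: (u + w)) = 2^-1 * (l u + l w).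
    rewrite -[2^-1 *: _]addr0 lL//; last exact: subspaceD.
    by rewrite l0 addr0 -[u]scale1r lL// scale1r mul1r.
  have -> : B (2^-1 *: (u + w)) (2^-1 *: (u + w)) =
      (B u u + 2 * B u w + B w w) / 4.
    have [Su Sw] : S u /\ S w by split; exact: VS.
    have Suw : S (u + w) := VS _ (subspaceD sV Vu Vw).
    rewrite formZl//; last exact: VS.
    rewrite [B (u + w) _]BC formZl//.
    rewrite formDl// [B u _]BC [B w (_ + _)]BC !formDl// [B w u]BC. by field.
  rewrite formBB; [lra|exact: VS|exact: VS].
have e0 (n0 n : nat) : (n0 <= n)%N -> n.+1%:R^-1 <= n0.+1%:R^-1 :> R.
  by move=> h; rewrite lef_pV2 ?posrE// ler_nat.
have small (e : R) : 0 < e -> exists n0 : nat, n0.+1%:R^-1 <= e.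
  move=> eP; exists (Num.truncn e^-1).
  rewrite -[leRHS]invrK lef_pV2 ?posrE ?invr_gt0//.
  by rewrite ltW// truncnS_gt.
have [e eP|u Vu ulim] := cV v (fun n => (Hv n).1).
  have [n0 Hn0] := small (e / 4) (divr_gt0 eP (ltr0n _ 4)).
  exists n0 => n k n0n n0k; apply: le_trans (Jpar _ _ (Hv n).1 (Hv k).1) _.
  have := (Hv n).2; have := (Hv k).2; have := e0 _ _ n0n; have := e0 _ _ n0k.
  move: Hn0 (J (v n)) (J (v k)) => + j1 j2.
  move: (n0.+1%:R^-1) (n.+1%:R^-1) (k.+1%:R^-1) => x y z; lra.
exists u; split => // w Vw; apply/eqP; rewrite -subr_eq0; apply/eqP.
apply: (quadratic_min (B0 w)) => t.
(* Minimality is exploited at [v n] rather than at u. If the quadratic took a value - h < 0, adding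
   t w to [v n] would lower J by at least h / 2: replacing u by [v n] costs 2 t B (v n - u) w, at
   most h / 2 by Cauchy-Schwarz and the choice made in [dP]. But J (v n) exceeds m by at most h /
   4. *)
rewrite leNgt; apply/negP => neg.
set q := (X in X < 0) in neg; pose h := - q; have h0 : 0 < h by rewrite /h; lra.
have dP : 0 < h ^+ 2 / (16 * (t ^+ 2 * B w w + 1)).
  by rewrite divr_gt0 ?exprn_gt0// mulr_gt0// ltr_wpDl// mulr_ge0 ?sqr_ge0.
have [n1 Hn1] := ulim _ dP.
have [n2 Hn2] := small (h / 4) (divr_gt0 h0 (ltr0n _ 4)).
pose n := maxn n1 n2.
have Vn := (Hv n).1; have Jvn := (Hv n).2.
have := mJ _ (VL t _ _ Vw Vn); rewrite {1}/J lL// formLL; [|exact: VS|exact: VS].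
have := e0 _ _ (leq_maxr n1 n2 : (n2 <= n)%N).
have := Hn1 n (leq_maxl _ _).
have cs := form_cs (VS _ (subspaceB sV Vn Vu)) (VS _ Vw).
move=> dn e2 mle.
have : B w (v n) = B (v n - u) w + B u w.
  by rewrite formBl; [rewrite BC; lra|exact: VS|exact: VS|exact: VS].
move: cs dn; set y := B (v n - u) w; set dd := B (v n - u) (v n - u) => cs dn Bwv.
have yh : (2 * t * y) ^+ 2 <= (h / 2) ^+ 2.
  have k0 : 0 < t ^+ 2 * B w w + 1 by rewrite ltr_wpDl// mulr_ge0 ?sqr_ge0.
  move: dn; rewrite ler_pdivlMr ?mulr_gt0// => dn.
  have dd0 : 0 <= dd by exact: B0.
  have : t ^+ 2 * y ^+ 2 <= t ^+ 2 * (dd * B w w).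
    by rewrite ler_wpM2l ?sqr_ge0.
  rewrite !exprMn; move: dn dd0; nra.
have : 2 * t * y <= h / 2.
  have := @le_sqr_small (- (2 * t * y)) (h / 2).
  by rewrite sqrrN => /(_ _ yh) H; have := H ltac:(lra); lra.
move: Jvn mle; rewrite /J Bwv => Jvn mle ty.
have : q = - h by rewrite /h opprK.
rewrite {1}/q; move: e2 Hn2 Jvn mle ty.
move: (n.+1%:R^-1) (n2.+1%:R^-1) (B (v n) (v n)) (B w w) (l (v n)) => x z b bw lv.
move=> *; lra.
Qed.
Lemma represents_lin V l1 l2 v1 v2 (a : R) : subspace V ->
  represents V l1 v1 -> represents V l2 v2 ->
  represents V (fun w => a * l1 w + l2 w) (a *: v1 + v2).
Proof.
move=> [VS _ VL] [V1 r1] [V2 r2]; split => [|w Vw]; first exact: VL.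
by rewrite BL ?r1 ?r2//; exact: VS.
Qed.

Lemma le_of_sqr_le (x C : R) : 0 <= x -> 0 <= C -> x ^+ 2 <= C * x -> x <= C.
Proof.
move=> x0 C0; rewrite expr2; have [->//|xn0] := eqVneq x 0.
by rewrite ler_pM2r// lt_neqAle eq_sym xn0.
Qed.

(* w - v and v' - w are orthogonal, being differences of successive
   B-projections of v'. *)
Lemma represents_nested V W V' l v w v' :
  subspace V -> subspace W -> subspace V' -> V `<=` W -> W `<=` V' ->
  represents V l v -> represents W l w -> represents V' l v' ->
  B (w - v) (w - v) <= B (v' - v) (v' - v).
Proof.
move=> sV sW sV' VW WV' [Vv rv] [Ww rw] [V'v' rv'].
have Wwv : W (w - v) by apply: subspaceB => //; exact: VW.
have [[WS _ _] [V'S _ _]] := (sW, sV').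
have [Sv [Sw Sv']] : S v /\ S w /\ S v'.
  by split; [exact/WS/VW|split; [exact: WS|exact: V'S]].
have E : B (w - v) (w - v) = B (v' - v) (w - v).
  rewrite formBl//; last exact: WS.
  rewrite formBl//; last exact: WS.
  by rewrite rw// rv'//; exact: WV'.
apply: le_of_sqr_le; rewrite ?B0// {1}E; apply: form_cs; exact: SB.
Qed.

(** Test the difference of the two equations with v1 - v2. The constant does not involve [V], so the
    estimate is uniform over domains. *)
Lemma represents_stable V l1 l2 v1 v2 (C : R) : subspace V -> 0 <= C ->
  represents V l1 v1 -> represents V l2 v2 ->
  (forall w, V w -> (l1 w - l2 w) ^+ 2 <= C * B w w) ->
  B (v1 - v2) (v1 - v2) <= C.
Proof.
move=> sV C0 [V1 r1] [V2 r2] H.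
have V12 := subspaceB sV V1 V2; have [VS _ _] := sV.
apply: le_of_sqr_le => //; rewrite {1}formBl ?r1 ?r2//; try exact: VS.
exact: H.
Qed.

(** Squared distances between the v n are differences of their energies, which decrease; hence v n
    is Cauchy. Its limits taken in the various [V k] agree up to null vectors only, and the
    separation hypothesis then puts one limit into every [V k], hence into [V']. *)
Lemma represents_decreasing (V : nat -> set X) (V' : set X) l (v : nat -> X) v' :
  (forall n, subspace (V n)) -> subspace V' ->
  (forall n m, (n <= m)%N -> V m `<=` V n) ->
  (forall n, V' `<=` V n) ->
  (forall u, (forall n, V n u) -> V' u) ->
  (forall n, bcomplete (V n)) ->
  (forall n u w, V 0%N u -> V n w -> B (u - w) (u - w) = 0 -> V n u) ->
  (forall n, represents (V n) l (v n)) -> represents V' l v' ->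
  forall e, 0 < e -> exists n0, forall n, (n0 <= n)%N ->
    B (v n - v') (v n - v') <= e.
Proof.
move=> sV sV' dV V'V capV cV sepV rV [V'v' rv'].
have VS n u : V n u -> S u by case: (sV n) => + _ _; exact.
have V0n n u : V n u -> V 0%N u by exact: dV.
pose a n := B (v n) (v n).
have Vv n : V n (v n) := (rV n).1.
have avv n m : (n <= m)%N -> B (v n - v m) (v n - v m) = a n - a m.
  move=> nm; rewrite formBB; [|exact: VS|exact: VS].
  rewrite ((rV n).2 (v m)); last exact: (dV _ _ nm _ (Vv m)).
  by rewrite -((rV m).2 (v m))// /a; lra.
have ad n m : (n <= m)%N -> a m <= a n.
  by move=> nm; rewrite -subr_ge0 -avv.
have infa : has_inf (range a).
  by split; [exists (a 0%N), 0%N|exists 0 => _ [n _ <-]; exact: B0].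
have aC e : 0 < e -> exists n0, forall n m, (n0 <= n)%N -> (n0 <= m)%N ->
    B (v n - v m) (v n - v m) <= e.
  move=> e0; have [_ [n0 _ <-] an0] := inf_adherent e0 infa.
  have lb n : inf (range a) <= a n by apply: ge_inf; [case: infa|exists n].
  have sym x y : B (x - y) (x - y) <= e -> S x -> S y -> B (y - x) (y - x) <= e.
    by move=> h Sx Sy; rewrite formBB// in h; rewrite formBB// [B y x]BC; lra.
  have H n m : (n0 <= n)%N -> (n <= m)%N -> B (v n - v m) (v n - v m) <= e.
    by move=> h h'; rewrite avv//; have := ad _ _ h; have := lb m; lra.
  exists n0 => n m hn hm; have [nm|mn] := leqP n m; first exact: H.
  apply: sym; [|exact: VS|exact: VS]; apply: H => //; exact: ltnW.
have lim k : exists2 u, V k u & forall e, 0 < e -> exists n0, forall n, (n0 <= n)%N ->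
    B (v n - u) (v n - u) <= e.
  have [||u Vu Hu] := cV k (fun n => v (k + n)%N).
  - by move=> n; apply: (dV k (k + n)%N _ _ (Vv _)); exact: leq_addr.
  - move=> e /aC[n0 H]; exists n0 => n m hn hm.
    by apply: H; [apply: (leq_trans hn)|apply: (leq_trans hm)]; exact: leq_addl.
  exists u => // e /Hu[n0 H]; exists (k + n0)%N => n hn.
  have kn : (k <= n)%N by apply: leq_trans hn; exact: leq_addr.
  by rewrite -(subnKC kn); apply: H; rewrite leq_subRL.
have [u Vu Hu] := lim 0%N.
have uniq w w' k : S w -> S w' -> S k ->
    B (w - w') (w - w') <= 2 * B (k - w) (k - w) + 2 * B (k - w') (k - w').
  move=> Sw Sw' Sk; rewrite (_ : w - w' = (k - w') - (k - w)); last first.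
    by rewrite opprB [RHS]addrC addrA subrK.
  by rewrite [leRHS]addrC; apply: form_le2B; exact: SB.
have capu k : V k u.
  have [w Vw Hw] := lim k; apply: (sepV k u w) => //.
  apply/eqP; rewrite eq_le B0 andbT; apply/ler_addgt0Pr => e e0; rewrite add0r.
  have e4 : 0 < e / 4 by rewrite divr_gt0.
  have [n1 H1] := Hu _ e4; have [n2 H2] := Hw _ e4.
  have := H1 _ (leq_maxl n1 n2); have := H2 _ (leq_maxr n1 n2).
  have := uniq u w (v (maxn n1 n2)) (VS _ _ Vu) (VS _ _ Vw) (VS _ _ (Vv _)); lra.
have V'u := capV _ capu.
have [V'S _ _] := sV'.
(* On u - v', an element of [V'], both v' and v n represent [l]. So B (u - v') (u - v') = B (u - v
   n) (u - v'), which tends to 0. *)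
have Buv' : B (u - v') (u - v') = 0.
  have V'uv : V' (u - v') by exact: subspaceB.
  have Suv := V'S _ V'uv.
  apply/eqP; rewrite -sqrf_eq0 eq_le sqr_ge0 andbT.
  apply/ler_addgt0Pr => e e0; rewrite add0r.
  have dP : 0 < e / (B (u - v') (u - v') + 1) by rewrite divr_gt0// ltr_wpDl.
  have [n1 H1] := Hu _ dP; have := H1 _ (leqnn _).
  rewrite ler_pdivlMr ?ltr_wpDl//.
  have [Sn Su Sv'] : [/\ S (v n1), S u & S v'].
    by split; [exact: VS (Vv n1)|exact: VS Vu|exact: V'S].
  have EB : B (u - v') (u - v') = B (u - v n1) (u - v').
    by rewrite formBl// formBl// rv'// ((rV n1).2 (u - v'))//; exact: V'V.
  have := form_cs (SB Su Sn) Suv; rewrite -EB.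
  have -> : B (u - v n1) (u - v n1) = B (v n1 - u) (v n1 - u).
    by rewrite formBB// formBB// [B u (v n1)]BC; lra.
  have := B0 (v n1 - u); move: (B (v n1 - u) _) (B (u - v') _) => p q; nra.
move=> e e0; have e2 : 0 < e / 2 by rewrite divr_gt0.
have [n0 H0] := Hu _ e2; exists n0 => n hn; have Hn := H0 _ hn.
rewrite (_ : v n - v' = (v n - u) + (u - v')); last by rewrite addrA subrK.
apply: le_trans (form_le2 _ _) _.
- exact: SB (VS _ _ (Vv n)) (VS _ _ Vu).
- exact: SB (VS _ _ Vu) (V'S _ V'v').
by rewrite Buv'; lra.
Qed.

End semi_hilbert.

(** * Lebesgue measure on R^N: boxes, translation invariance, open sets *)

Section lebesgue_rV.
Context (R : realType) (N : nat).
Local Notation T := 'rV[R]_N.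
Implicit Types (a b x t : T) (A O : set T).

Definition cbox a b : set T := [set x | forall i, a ord0 i <= x ord0 i <= b ord0 i].

Definition cboxes : set (set T) := [set A | exists a b, A = cbox a b].

Lemma measurable_cbox a b : measurable (cbox a b).
Proof.
rewrite (_ : cbox a b = \big[setI/setT]_(j < N)
    ((fun v : T => v ord0 j) @^-1` `[a ord0 j, b ord0 j]%classic)).
  apply: bigsetI_measurable => j _; rewrite -[X in measurable X]setTI.
  apply: (@measurable_coord R N j measurableT); exact: measurable_itv.
rewrite -bigcap_seq; apply/seteqP; split => x /= H j.
  by move=> _ /=; rewrite in_itv/=; exact: H.
by have := H j; rewrite /= in_itv/= mem_index_enum; exact.
Qed.

Lemma setI_closed_cboxes : setI_closed cboxes.
Proof.
move=> _ _ [a [b ->]] [c [d ->]].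
exists (\row_i Num.max (a ord0 i) (c ord0 i)), (\row_i Num.min (b ord0 i) (d ord0 i)).
apply/seteqP; split => [x [/= H1 H2] i|x /= H]; rewrite ?mxE.
  rewrite ge_max le_min; move/andP: (H1 i) => [-> ->].
  by move/andP: (H2 i) => [-> ->].
split=> i /=; have := H i; rewrite !mxE ge_max le_min => /andP[/andP[? ?] /andP[? ?]];
  exact/andP.
Qed.

Lemma cbox_cover : \bigcup_k cbox (const_mx (- k%:R)) (const_mx k%:R) = [set: T].
Proof.
apply/seteqP; split => // x _; pose M := \big[Num.max/0]_(i < N) `|x ord0 i|.
exists (Num.truncn M).+1 => // i; rewrite !mxE -ler_norml.
apply: (@le_trans _ _ M); first exact: le_bigmax.
by rewrite ltW// truncnS_gt.
Qed.

(** A half-space bounding one coordinate from below is a countable union of boxes. The boxes thus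
    form a generating pi-system, on which measures can be compared and Dynkin induction started. *)
Lemma measurable_cboxes : @measurable _ T = <<s cboxes >>.
Proof.
apply/seteqP; split; last first.
  apply: smallest_sub; first exact: sigma_algebra_measurable.
  by move=> _ [a [b ->]]; exact: measurable_cbox.
apply: smallest_sub; first exact: smallest_sigma_algebra.
move=> A; rewrite -bigcup_seq/= => -[i _ [B mB <-]]; rewrite setTI => {A}.
suff : @measurable _ R `<=`
    image_set_system setT (fun v : T => v ord0 i : R) <<s cboxes >>.
  by move=> /(_ _ mB); rewrite /image_set_system/= setTI.
rewrite (_ : @measurable _ R = <<s @RGenCInfty.G R >>); last exact: RGenCInfty.measurableE.
apply: smallest_sub.
  by apply: sigma_algebra_image; exact: smallest_sigma_algebra.
move=> _ [x ->]; rewrite /image_set_system/= setTI.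
rewrite (_ : _ @^-1` _ = \bigcup_k cbox
   (\row_j if j == i then x else - k%:R) (const_mx k%:R)); last first.
  apply/seteqP; split => v /=.
    rewrite in_itv/= andbT => xv.
    have : [set: T] v by [].
    rewrite -cbox_cover => -[k _ Hk]; exists k => // j.
    have := Hk j; rewrite !mxE; case: eqP => // -> /andP[_ ->].
    by rewrite xv.
  move=> [k _] /(_ i); rewrite !mxE eqxx in_itv/= => /andP[-> _] //.
apply: sigma_algebra_bigcup => k; apply: sub_sigma_algebra; do 2 eexists; reflexivity.
Qed.

Lemma leb_cbox_lty a b : (leb R N (cbox a b) < +oo)%E.
Proof.
apply: (@le_lt_trans _ _ (leb R N (cbox a (\row_i Num.max (a ord0 i) (b ord0 i))))).
  apply: le_measure; rewrite ?inE; try exact: measurable_cbox.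
  by move=> x /= H i; rewrite mxE le_max; move/andP: (H i) => [-> ->]; rewrite orbT.
by rewrite leb_box ?ltry// => i; rewrite mxE le_max lexx.
Qed.

Lemma leb_cbox_shift a b t : leb R N (cbox (a + t) (b + t)) = leb R N (cbox a b).
Proof.
have [ab|/existsNP[i /negP]] := pselect (forall i, a ord0 i <= b ord0 i).
  rewrite !leb_box//; last by move=> i; rewrite !mxE lerD2r.
  by congr EFin; apply: eq_bigr => i _; rewrite !mxE; ring.
rewrite -ltNge => ba.
suff E (u v : T) : v ord0 i < u ord0 i -> cbox u v = set0.
  by rewrite !E// !mxE ltrD2r.
move=> vu; rewrite -subset0 => x /= /(_ i) /andP[ux xv].
by have := lt_le_trans vu ux; rewrite ltNge xv.
Qed.

Lemma measurable_shift t : measurable_fun [set: T] (fun x : T => x + t).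
Proof.
apply: measurable_fun_rV => i; under eq_fun do rewrite mxE.
by apply: measurable_funD; [exact: measurable_coord|exact: measurable_cst].
Qed.

Definition leb_shift t : {measure set T -> \bar R}.
Proof.
refine (pushforward (leb R N) (fun x : T => x + t)).
exact: measurable_shift.
Defined.

Lemma preimage_shift_cbox a b t :
  (fun x : T => x + t) @^-1` (cbox a b) = cbox (a - t) (b - t).
Proof.
apply/seteqP; split => x /= H i; have := H i; rewrite !mxE.
  by move=> /andP[? ?]; rewrite lerBlDr lerBrDr; apply/andP.
by rewrite lerBlDr lerBrDr.
Qed.

(** Uniqueness of measures: the two agree on boxes, whose volume depends only on their side
    lengths. *)
Lemma leb_shiftE t A : measurable A -> leb_shift t A = leb R N A.
Proof.
move=> mA; apply: (measure_unique cboxes (fun k => cbox (const_mx (- k%:R)) (const_mx k%:R))) => //.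
- exact: measurable_cboxes.
- exact: setI_closed_cboxes.
- by move=> k; do 2 eexists; reflexivity.
- exact: cbox_cover.
- move=> _ [a [b ->]]; rewrite /= /pushforward preimage_shift_cbox.
  by rewrite -(leb_cbox_shift (a - t) (b - t) t) !subrK.
- by move=> k; rewrite /= /pushforward preimage_shift_cbox leb_cbox_lty.
Qed.

Lemma ge0_integral_shift (f : T -> \bar R) t : measurable_fun setT f ->
  (forall x, 0 <= f x)%E ->
  (\int[leb R N]_x f (x + t)%R = \int[leb R N]_x f x)%E.
Proof.
move=> mf f0; rewrite -[RHS](@eq_measure_integral _ _ _ setT (leb R N) (leb_shift t)).
  by rewrite (ge0_integral_pushforward (measurable_shift t))// preimage_setT.
by move=> A mA _; exact: leb_shiftE.
Qed.

Lemma integrable_shift (f : T -> R) t : (leb R N).-integrable setT (EFin \o f) ->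
  (leb R N).-integrable setT (EFin \o (fun x => f (x + t))).
Proof.
move=> /integrableP[mf fy]; apply/integrableP; split.
  apply/measurable_EFinP; apply: (measurableT_comp (f := f)).
    exact/measurable_EFinP.
  exact: measurable_shift.
rewrite (ge0_integral_shift (f := fun x => `|(f x)%:E|%E))//.
exact: measurableT_comp.
Qed.

Lemma Rintegral_shift (f : T -> R) t : (leb R N).-integrable setT (EFin \o f) ->
  \int[leb R N]_x f (x + t) = \int[leb R N]_x f x.
Proof.
move=> fi; have [mf _] := integrableP _ _ _ fi; congr fine.
rewrite -[RHS](@eq_measure_integral _ _ _ setT (leb R N) (leb_shift t)).
  by rewrite (integral_pushforward (measurable_shift t))//; exact: integrable_shift.
by move=> A mA _; exact: leb_shiftE.
Qed.

(** A countable base. It makes open sets measurable and lets almost-everywhere statements proved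
    around each point be assembled into a single one. *)
Lemma rational_cbox O x : open O -> O x -> exists q : 'rV[rat]_N * 'rV[rat]_N,
  (forall i, ratr (q.1 ord0 i) < x ord0 i < ratr (q.2 ord0 i)) /\
  cbox (map_mx ratr q.1) (map_mx ratr q.2) `<=` O.
Proof.
move=> oO Ox; have /nbhs_ballP[e e0 He] : nbhs x O by exact: open_nbhs_nbhs.
have H1 i : exists p, x ord0 i - e < ratr p < x ord0 i.
  have [|p] := @rat_in_itvoo _ (x ord0 i - e) (x ord0 i); first by rewrite gtrBl.
  by rewrite in_itv/=; exists p.
have H2 i : exists p, x ord0 i < ratr p < x ord0 i + e.
  have [|p] := @rat_in_itvoo _ (x ord0 i) (x ord0 i + e); first by rewrite ltrDl.
  by rewrite in_itv/=; exists p.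
have [p Hp] := choice H1; have [q Hq] := choice H2.
exists (\row_i p i, \row_i q i); split => [i|y yb] /=.
  by rewrite !mxE; move/andP: (Hp i) => [_ ->]; move/andP: (Hq i) => [->].
apply: He; split => // j i; rewrite ord1 /ball/= ltr_distlC.
have := yb i; rewrite !mxE => /andP[py yq].
move/andP: (Hp i) => [xp _]; move/andP: (Hq i) => [_ qx].
by rewrite ltrBlDr in xp; lra.
Qed.

Lemma open_measurable_rV O : open O -> measurable O.
Proof.
move=> oO.
rewrite (_ : O = \bigcup_(q : 'rV[rat]_N * 'rV[rat]_N)
  (if `[< cbox (map_mx ratr q.1) (map_mx ratr q.2) `<=` O >] then
     cbox (map_mx ratr q.1) (map_mx ratr q.2) else set0)).
  apply: countable_bigcupT_measurable => [|q]; first exact: countableP.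
  by case: asboolP => _; [exact: measurable_cbox|exact: measurable0].
apply/seteqP; split => x.
  move=> Ox; have [q [xq qO]] := rational_cbox oO Ox; exists q => //.
  rewrite asboolT// => i; rewrite !mxE.
  by move/andP: (xq i) => [? ?]; apply/andP; split; exact: ltW.
by move=> [q _]; case: asboolP => [qO /qO|].
Qed.

Lemma continuous_measurable_rV (f : T -> R) : continuous f -> measurable_fun setT f.
Proof.
move=> cf; apply: (measurability _ (RGenOpens.measurableE R)).
move=> _ [_ [x [y ->]] <-]; rewrite setTI; apply: open_measurable_rV.
by apply: open_comp => [z _|]; [exact: cf|exact: interval_open].
Qed.

Lemma coord_le_norm (x : T) i : `|x ord0 i| <= `|x|.
Proof.
rewrite [leRHS]/Num.norm/= mx_normrE.
exact: (le_bigmax _ (fun ij : 'I_1 * 'I_N => `|x ij.1 ij.2|) (ord0, i)).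
Qed.

Lemma norm_le_coord (x : T) (e : R) : 0 <= e -> (forall i, `|x ord0 i| <= e) -> `|x| <= e.
Proof.
move=> e0 H; rewrite [leLHS]/Num.norm/= mx_normrE; apply: bigmax_le => //= -[j i] _ /=.
by rewrite ord1.
Qed.

Lemma bounded_cbox A : bounded_set A -> exists M : R, 0 < M /\
  A `<=` cbox (const_mx (- M)) (const_mx M).
Proof.
move=> [M [_ HM]]; exists (`|M| + 1); split; first by rewrite ltr_pwDr.
move=> x Ax i; have Mx : `|x| <= `|M| + 1.
  by apply: HM => //; rewrite (le_lt_trans (ler_norm _))// ltrDl.
by rewrite !mxE -ler_norml (le_trans _ Mx)// coord_le_norm.
Qed.

Lemma leb_bounded A : bounded_set A -> measurable A -> (leb R N A < +oo)%E.
Proof.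
move=> /bounded_cbox[M [_ AM]] mA.
apply: le_lt_trans (leb_cbox_lty (const_mx (- M)) (const_mx M)).
by apply: le_measure; rewrite ?inE//; exact: measurable_cbox.
Qed.

End lebesgue_rV.

(** * Flat functions of one variable *)

Section flat_function.
Context (R : realType).
Implicit Types (p q : {poly R}) (x y z : R).

Lemma horner_le_expR q : exists C : R, 0 <= C /\
  forall z, 0 <= z -> `|q.[z]| <= C * expR z.
Proof.
exists (\sum_(i < size q) `|q`_i| * i`!%:R); split.
  by apply: sumr_ge0 => i _; rewrite mulr_ge0.
move=> z z0; rewrite horner_coef mulr_suml; apply: le_trans (ler_norm_sum _ _ _) _.
apply: ler_sum => i _; rewrite normrM -mulrA ler_wpM2l// ger0_norm ?exprn_ge0//.
case: (nat_of_ord i) => [|n]; first by rewrite expr0 fact0 mul1r; have := expR_ge1Dx z; lra.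
have := expR_ge1Dxn n z0; rewrite -ler_pdivrMl ?ltr0n ?fact_gt0// mulrC; lra.
Qed.

(* Extended by 0, the functions y |-> p(1/y) e^(-1/y) form a family closed
   under differentiation; this makes flat 1 smooth. *)
Definition flat p y : R := if 0 < y then p.[y^-1] * expR (- y^-1) else 0.

(** With z = 1/h the bound says that z^2 p(z) is at most C e^z in absolute value. *)
Lemma flat_le p : exists C : R, forall h, `|flat p h| <= C * h ^+ 2.
Proof.
have [C [C0 HC]] := horner_le_expR ('X^2 * p); exists C => h; rewrite /flat.
case: ifPn => [h0|_]; last by rewrite normr0 mulr_ge0 ?sqr_ge0.
have := HC h^-1; rewrite invr_ge0 ltW// => /(_ isT).
rewrite hornerM hornerXn normrM ger0_norm; last by rewrite exprn_ge0// invr_ge0 ltW.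
rewrite exprVn mulrC -ler_pdivlMr ?invr_gt0 ?exprn_gt0// invrK => H.
rewrite normrM [`|expR _|]ger0_norm ?expR_ge0// expRN ler_pdivrMr ?expR_gt0//.
by rewrite (le_trans H)// mulrAC.
Qed.

Lemma is_derive0_sqr (f : R -> R) (C : R) : (forall h, `|f h| <= C * h ^+ 2) ->
  is_derive (0 : R) 1 f 0.
Proof.
move=> fC; have f0 : f 0 = 0.
  by have := fC 0; rewrite expr0n mulr0 normr_le0 => /eqP.
have C0 : 0 <= C by have := fC 1; rewrite expr1n mulr1; apply: le_trans.
have lim0 : h^-1 *: ((f \o shift 0) (h *: 1) - f 0) @[h --> 0^'] --> (0 : R).
  apply/cvgrPdist_le => e e0; near=> h.
  have h0 : h != 0 by near: h; exact: nbhs_dnbhs_neq.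
  rewrite sub0r normrN f0 subr0 /shift /= addr0 normrZ normfV /GRing.scale /= mulr1.
  rewrite ler_pdivrMl ?normr_gt0//; apply: le_trans (fC h) _.
  rewrite -real_normK ?num_real// expr2 mulrCA ler_wpM2l//.
  have : `|h| <= e / (C + 1).
    by near: h; apply: dnbhs0_le; rewrite divr_gt0// ltr_wpDl.
  by rewrite ler_pdivlMr ?ltr_wpDl// mulrDr mulr1; have := normr_ge0 h; lra.
split; first by apply/cvg_ex; exists 0.
by apply/cvg_lim.
Unshelve. all: by end_near. Qed.

(** For y > 0 this is the product rule, ['X^2] being the factor y^-2 produced by 1/y; at 0 the
    quadratic bound of [flat_le] gives derivative 0. *)
Lemma is_derive_flat p y : is_derive y 1 (flat p) (flat ('X^2 * (p - p^`())) y).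
Proof.
have [y0|y0|->] := ltgtP y 0.
- rewrite [X in is_derive _ _ _ X](_ : _ = 0); last first.
    by rewrite /flat ifN// -leNgt ltW.
  apply: (@near_eq_is_derive _ _ _ (cst 0) (flat p)).
  near=> z; rewrite /flat ifN// -leNgt ltW//; near: z; exact: lt_nbhsl.
- pose g (z : R) := p.[z^-1] * expR (- z^-1).
  apply: (@near_eq_is_derive _ _ _ g).
    near=> z; rewrite /flat ifT//; near: z; exact: lt_nbhsr.
  have yn0 : y != 0 by rewrite gt_eqF.
  have dV : is_derive y 1 (fun z : R => z^-1) (- y ^- 2).
    have := @realfun.is_deriveV _ id y 1 1 yn0 (is_derive_id y 1).
    by rewrite /GRing.scale /= mulr1.
  have d1 := is_derive1_comp (is_derive_poly p y^-1) dV.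
  have d2 := @is_derive1_comp R expR (fun z => - z^-1) y _ _ (is_derive_expR _) (is_deriveN dV).
  apply: (is_derive_eq (is_deriveM d1 d2)).
  rewrite /flat y0 !hornerE /GRing.scale /=.
  by field.
- rewrite [X in is_derive _ _ _ X](_ : _ = 0); last by rewrite /flat ltxx.
  have [C HC] := flat_le p; exact: is_derive0_sqr HC.
Unshelve. all: by end_near. Qed.

End flat_function.

(** * Calculus of smooth functions on R^N *)

Section smooth_functions.
Context (R : realType) (N : nat).
Local Notation T := 'rV[R]_N.
Implicit Types (f g : T -> R) (x t : T) (i j : 'I_N).

Let diffb f := forall x, differentiable f x.

Lemma partial_shift i f t :
  partial i (fun x => f (x + t)) = fun x => partial i f (x + t).
Proof.
apply/funext => x; rewrite /partial /derive.
rewrite (_ : (fun h => h^-1 *: (((fun y => f (y + t)) \o _) _ - _)) =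
  (fun h : R => h^-1 *: ((f \o shift (x + t)) (h *: delta_mx ord0 i) - f (x + t))))//.
by apply/funext => h /=; rewrite addrA.
Qed.

Lemma partial_cst i (c : R) : partial i (cst c : T -> R) = 0.
Proof. by apply/funext => x; rewrite /partial derive_cst. Qed.

Let derb i f : diffb f -> forall x, derivable f x (delta_mx ord0 i).
Proof. by move=> df x; apply/diff_derivable/df. Qed.

Lemma partialD i f g : diffb f -> diffb g ->
  partial i (f + g) = partial i f + partial i g.
Proof.
by move=> df dg; apply/funext => x; rewrite /partial deriveD//; exact: derb.
Qed.

Lemma partialZ i (a : R) f : diffb f -> partial i (a *: f) = a *: partial i f.
Proof.
by move=> df; apply/funext => x; rewrite /partial deriveZ//; exact: derb.
Qed.

Lemma partialM i f g : diffb f -> diffb g ->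
  partial i (f * g) = partial i f * g + f * partial i g.
Proof.
move=> df dg; apply/funext => x; rewrite /partial deriveM; try exact: derb.
by rewrite /GRing.scale/= addrC mulrC.
Qed.

Lemma partialV i f : diffb f -> (forall x, f x != 0) ->
  partial i (fun x => (f x)^-1) =
  (cst (-1) * partial i f) * ((fun x => (f x)^-1) * (fun x => (f x)^-1)).
Proof.
move=> df f0; apply/funext => x; rewrite /partial deriveV//; last exact: derb.
rewrite /GRing.scale/= -[RHS]/(-1 * 'D_(delta_mx ord0 i) f x * ((f x)^-1 * (f x)^-1)).
by rewrite expr2 invfM; ring.
Qed.

Lemma partial_coord i j : partial j (fun x => x ord0 i) = cst ((i == j)%:R : R).
Proof.
apply/funext => x; rewrite /partial /derive.
apply: cvg_lim => //; apply: (@cvg_trans _ (cst ((i == j)%:R : R) h @[h --> 0^'])).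
  apply: near_eq_cvg; near=> h.
  have h0 : h != 0 by near: h; exact: nbhs_dnbhs_neq.
  by rewrite /= !mxE addrK eqxx /= /GRing.scale /= mulrA mulVf// mul1r.
exact: cvg_cst.
Unshelve. all: by end_near. Qed.

(** The same notion as [smooth], graded by the order of differentiation: products and inverses are
    handled by induction on n, which words of partial derivatives do not allow directly. *)
Fixpoint dsmooth n f : Prop :=
  diffb f /\ if n is m.+1 then forall i, dsmooth m (partial i f) else True.

Lemma dsmooth_diff n f : dsmooth n f -> diffb f.
Proof. by case: n => [|n] []. Qed.

Lemma dsmoothW n f : dsmooth n.+1 f -> dsmooth n f.
Proof.
elim: n f => [|n IH] f [df H]; split => // i; apply: IH; exact: H.
Qed.

Lemma smoothP f : smooth f <-> forall n, dsmooth n f.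
Proof.
split=> [sf n|sf s].
  elim: n f sf => [|n IH] f sf; split => //; try exact: (sf [::]).
  by move=> i; apply: IH => s x; have := sf (rcons s i) x; rewrite foldr_rcons.
elim/last_ind: s f sf => [|s i IH] f sf x; first exact: (dsmooth_diff (sf 0%N)).
by rewrite foldr_rcons; apply: IH => n; have [_] := sf n.+1; apply.
Qed.

Lemma dsmooth_cst n (c : R) : dsmooth n (cst c).
Proof.
have dc c' : diffb (cst c') by move=> x; exact: differentiable_cst.
by elim: n c => [|n IH] c; split => // i; rewrite partial_cst; exact: IH.
Qed.

Lemma dsmoothD n f g : dsmooth n f -> dsmooth n g -> dsmooth n (f + g).
Proof.
elim: n f g => [|n IH] f g [df Hf] [dg Hg]; split => //;
  try by move=> x; exact: differentiableD.
by move=> i; rewrite partialD//; exact: (IH _ _ (Hf i) (Hg i)).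
Qed.

Lemma dsmoothM n f g : dsmooth n f -> dsmooth n g -> dsmooth n (f * g).
Proof.
elim: n f g => [|n IH] f g [df Hf] [dg Hg]; split => //;
  try by move=> x; exact: differentiableM.
move=> i; rewrite partialM//.
have [sf sg] : dsmooth n f /\ dsmooth n g by split; apply: dsmoothW; split.
by apply: dsmoothD; [exact: IH (Hf i) sg|exact: IH sf (Hg i)].
Qed.

Lemma dsmoothV n f : (forall x, f x != 0) -> dsmooth n f ->
  dsmooth n (fun x => (f x)^-1).
Proof.
move=> f0; elim: n => [|n IH] [df Hf]; split => //;
  try by move=> x; exact: differentiableV.
have IHf : dsmooth n (fun x => (f x)^-1) by apply: IH; apply: dsmoothW; split.
move=> i; rewrite partialV//; apply: dsmoothM; last exact: dsmoothM.
exact: dsmoothM (dsmooth_cst _ _) (Hf i).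
Qed.

Lemma smooth_diff f x : smooth f -> differentiable f x.
Proof. by move=> /(_ [::]); exact. Qed.

Lemma smooth_continuous f : smooth f -> continuous f.
Proof. by move=> sf x; apply: differentiable_continuous; exact: smooth_diff. Qed.

Lemma smooth_partial i f : smooth f -> smooth (partial i f).
Proof. by move=> sf s x; have := sf (rcons s i) x; rewrite foldr_rcons. Qed.

Lemma smooth_cst (c : R) : smooth (cst c : T -> R).
Proof. by apply/smoothP => n; exact: dsmooth_cst. Qed.

Lemma smoothD f g : smooth f -> smooth g -> smooth (f + g).
Proof. by move=> /smoothP sf /smoothP sg; apply/smoothP => n; exact: dsmoothD. Qed.

Lemma smoothM f g : smooth f -> smooth g -> smooth (f * g).
Proof. by move=> /smoothP sf /smoothP sg; apply/smoothP => n; exact: dsmoothM. Qed.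

Lemma smoothZ (a : R) f : smooth f -> smooth (a *: f).
Proof. by move=> sf; have := smoothM (smooth_cst a) sf. Qed.

Lemma smoothV f : (forall x, f x != 0) -> smooth f -> smooth (fun x => (f x)^-1).
Proof. by move=> f0 /smoothP sf; apply/smoothP => n; exact: dsmoothV. Qed.

Lemma smooth_shift t f : smooth f -> smooth (fun x => f (x + t)).
Proof.
move=> sf s x; have -> : foldr (@partial R N) (fun y => f (y + t)) s =
    fun y => foldr (@partial R N) f s (y + t).
  by elim: s => [//|i s /= ->]; rewrite partial_shift.
apply: (@differentiable_comp _ _ _ _ (fun y => y + t)); last exact: sf.
by apply: differentiableD => //; exact: differentiable_cst.
Qed.

Lemma smooth_prod (I : Type) (s : seq I) (F : I -> T -> R) :
  (forall k, smooth (F k)) -> smooth (fun x => \prod_(k <- s) F k x).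
Proof.
move=> sF; elim: s => [|k s IH].
  rewrite (_ : (fun _ => _) = cst 1); first exact: smooth_cst.
  by apply/funext => x; rewrite big_nil.
rewrite (_ : (fun _ => _) = F k * (fun x => \prod_(k <- s) F k x)).
  exact: smoothM.
by apply/funext => x; rewrite big_cons.
Qed.

Lemma smooth_coord i : smooth (fun x => x ord0 i : R).
Proof.
move=> s x; elim/last_ind: s => [|s j _]; first exact: differentiable_coord.
by rewrite foldr_rcons partial_coord; exact: smooth_cst.
Qed.

Definition flat_coord p (k c : R) i x := flat p (k * x ord0 i + c).

Lemma diff_aff (k c : R) i x : differentiable (fun x => k * x ord0 i + c) x.
Proof.
apply: smooth_diff.
exact: (smoothD (smoothZ k (smooth_coord i)) (smooth_cst c)).
Qed.

Lemma partial_aff (k c : R) i j :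
  partial j (fun x => k * x ord0 i + c) = cst (k * (i == j)%:R).
Proof.
rewrite (_ : (fun _ => _) = (k *: (fun x => x ord0 i)) + cst c); last by [].
rewrite partialD ?partialZ ?partial_cst ?partial_coord ?addr0//.
- by move=> x; exact: differentiable_coord.
- by move=> x; apply: differentiableZ; exact: differentiable_coord.
Qed.

Lemma diff_flat (p : {poly R}) (y : R) : differentiable (flat p) y.
Proof. by apply/derivable1_diffP; have [] := is_derive_flat p y. Qed.

Lemma diff_flat_coord p k c i x : differentiable (flat_coord p k c i) x.
Proof.
apply: (@differentiable_comp _ _ _ _ (fun x => k * x ord0 i + c) (flat p)).
  exact: diff_aff.
exact: diff_flat.
Qed.

Lemma partial_flat_coord p k c i j : partial j (flat_coord p k c i) =
  (k * (i == j)%:R) *: flat_coord ('X^2 * (p - p^`())) k c i.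
Proof.
apply/funext => x; rewrite /partial deriveE; last exact: diff_flat_coord.
pose l := fun x : T => k * x ord0 i + c.
rewrite (_ : flat_coord p k c i = flat p \o l)//.
rewrite diff_comp; [|exact: diff_aff|exact: diff_flat].
rewrite /= -(deriveE _ (diff_aff k c i x)).
have := partial_aff k c i j => /(congr1 (fun f => f x)); rewrite /partial => ->.
rewrite /cst -[k * _ in LHS]mulr1 -[_ * 1]/(_ *: (1 : R)) linearZ/=.
rewrite -(deriveE _ (diff_flat p (l x))); congr (_ *: _).
by have [_ ->] := is_derive_flat p (l x).
Qed.

Lemma smooth_flat_coord p k c i : smooth (flat_coord p k c i).
Proof.
apply/smoothP => n; have df q : diffb (flat_coord q k c i) by move=> x; exact: diff_flat_coord.
elim: n p => [|n IH] p; split => // j.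
by rewrite partial_flat_coord; exact: (dsmoothM (dsmooth_cst n _) (IH _)).
Qed.

End smooth_functions.

Lemma dominated_cvg_Rintegral d (T : measurableType d) (R : realType)
    (mu : {measure set T -> \bar R}) (f_ : nat -> T -> R) (f g : T -> R) :
  (forall n, measurable_fun setT (f_ n)) ->
  (forall x, f_ n x @[n --> \oo] --> f x) ->
  mu.-integrable setT (EFin \o g) -> (forall n x, `|f_ n x| <= g x) ->
  \int[mu]_x f_ n x @[n --> \oo] --> \int[mu]_x f x.
Proof.
move=> mf fc ig fg.
have mg n : measurable_fun setT (EFin \o f_ n) by exact/measurable_EFinP.
have fe x : [set: T] x -> EFin (f_ n x) @[n --> \oo] --> EFin (f x).
  by move=> _; apply: cvg_EFin; [exact: nearW|exact: fc].
have gf x : [set: T] x -> EFin (g x) \is a fin_num by [].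
have fge n x : [set: T] x -> (`|EFin (f_ n x)| <= EFin (g x))%E by rewrite /= lee_fin.
have H := dominated_cvg measurableT mg fe gf ig fge.
apply: fine_cvg; rewrite fineK; first exact: H.
have mfl : measurable_fun setT (EFin \o f).
  apply/measurable_EFinP; apply: (measurable_fun_cvg (h := f_)) => // x _; exact: fc.
have [ifl _ _] := dominated_convergence measurableT mg mfl (aeW _ fe) ig
  (aeW _ (fun x n Dx => fge n x Dx)).
exact: integrable_fin_num ifl.
Qed.

(** * Test functions: integrability, translations, integrals of derivatives *)

Section test_functions.
Context (R : realType) (N : nat).
Local Notation T := 'rV[R]_N.
Local Notation mu := (leb R N).
Implicit Types (f g phi psi : T -> R) (x t a : T) (i j : 'I_N) (O : set T).

Definition supp f : set T := closure [set x | f x != 0].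

Lemma supp_subset f g : (forall x, f x != 0 -> g x != 0) -> supp f `<=` supp g.
Proof. by move=> fg; apply: closureS => x; exact: fg. Qed.

Lemma notin_supp f x : ~ supp f x -> f x = 0.
Proof.
move=> nx; apply/eqP/negPn/negP => fx; apply: nx; exact: subset_closure.
Qed.

Lemma near_supp f x : ~ supp f x -> \forall y \near x, f y = 0.
Proof.
move=> nx; have oC : open (~` supp f) by apply: closed_openC; exact: closed_closure.
have : nbhs x (~` supp f) by exact: open_nbhs_nbhs.
by apply: filterS => y /notin_supp.
Qed.

Lemma supp_partial i f : supp (partial i f) `<=` supp f.
Proof.
rewrite [X in _ `<=` X](iffLR (closure_id (supp f))); last exact: closed_closure.
apply: closureS => x /= dx; apply: contrapT => /near_supp nf.
move/eqP: dx; apply; rewrite /partial (near_eq_derive (g := cst 0)) ?derive_cst//.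
Qed.

Lemma test_functionW O O' phi : O `<=` O' -> test_function O phi -> test_function O' phi.
Proof. by move=> OO [? ? s]; split => // x /s /OO. Qed.

Lemma sub_supp_test O phi psi : smooth psi -> (forall x, psi x != 0 -> phi x != 0) ->
  test_function O phi -> test_function O psi.
Proof.
move=> spsi pp [_ cp pO]; split => //.
  apply: (subclosed_compact _ cp (supp_subset pp)); exact: closed_closure.
exact: subset_trans (supp_subset pp) pO.
Qed.

Lemma test_smooth O phi : test_function O phi -> smooth phi.
Proof. by case. Qed.

Lemma test_mull O chi phi : smooth chi -> test_function O phi ->
  test_function O (chi * phi).
Proof.
move=> sc tp; apply: (sub_supp_test _ _ tp).
  by apply: smoothM => //; exact: test_smooth tp.
by move=> x; rewrite -[(_ * _) x]/(chi x * phi x) mulf_eq0 => /norP[].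
Qed.

Lemma test_partial O i phi : test_function O phi -> test_function O (partial i phi).
Proof.
move=> [sp cp pO]; split; first exact: smooth_partial.
  apply: (subclosed_compact _ cp); [exact: closed_closure|exact: supp_partial].
apply: subset_trans pO; exact: supp_partial.
Qed.

Lemma test0 O : test_function O (0 : T -> R).
Proof.
have s0 : closure [set x | (0 : T -> R) x != 0] = set0.
  rewrite (_ : [set x | _] = set0) ?closure0//.
  by apply/seteqP; split => // x /=; rewrite eqxx.
split; rewrite /= ?s0//; [exact: smooth_cst|exact: compact0].
Qed.

Lemma test_lin O (k : R) phi psi : test_function O phi -> test_function O psi ->
  test_function O (k *: phi + psi).
Proof.
move=> [s1 c1 o1] [s2 c2 o2].
have sub : supp (k *: phi + psi) `<=` supp phi `|` supp psi.
  rewrite /supp -closureU; apply: closureS => x /=.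
  apply: contraNP => /not_orP[/negP/negPn/eqP p0 /negP/negPn/eqP q0].
  by rewrite -[(_ + _) x]/(k * phi x + psi x) p0 q0 mulr0 addr0.
split; first by apply: smoothD => //; exact: smoothZ.
  apply: (subclosed_compact _ (compactU c1 c2) sub); exact: closed_closure.
by apply: subset_trans sub _ => x [/o1|/o2].
Qed.

Lemma shift_continuous t : continuous (fun x : T => x + t).
Proof.
by move=> x; apply: differentiable_continuous; apply: differentiableD.
Qed.

Lemma test_shift O O' t phi : test_function O phi ->
  (forall x, supp phi (x + t) -> O' x) ->
  test_function O' (fun x => phi (x + t)).
Proof.
move=> [sp cp _] H.
have cs : continuous (fun x : T => x + t) by exact: shift_continuous.
have sub x : supp (fun x => phi (x + t)) x -> supp phi (x + t).
  move=> sx B nB; have nB' : nbhs x ((fun y => y + t) @^-1` B) by exact: cs.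
  by have [y [Hy By]] := sx _ nB'; exists (y + t).
split; first exact: smooth_shift.
  apply: (@subclosed_compact _ _ ((fun x => x - t) @` supp phi)).
  - exact: closed_closure.
  - apply: continuous_compact => //; apply: continuous_subspaceT.
    exact: shift_continuous.
  - by move=> x /sub sx; exists (x + t) => //; rewrite addrK.
by move=> x /sub /H.
Qed.

(** What remains of a test function without smoothness; it suffices for boundedness, integrability
    and continuity of translations in L^2. *)
Definition ccont f := continuous f /\ exists2 L, 0 < L &
  forall x, f x != 0 -> `|x| <= L.

Lemma test_ccont O phi : test_function O phi -> ccont phi.
Proof.
move=> [sp cp _]; split; first exact: smooth_continuous.
have [M [_ HM]] := compact_bounded cp.
exists (`|M| + 1); first by rewrite ltr_pwDr.
move=> x px; apply: HM; first by rewrite (le_lt_trans (ler_norm _))// ltrDl.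
exact: subset_closure.
Qed.

Lemma ccont_bounded f : ccont f -> exists2 M, 0 < M & forall x, `|f x| <= M.
Proof.
move=> [cf [L L0 HL]].
have cK : compact (cbox (const_mx (- L) : T) (const_mx L)).
  rewrite (_ : cbox _ _ = [set v : T | forall i, `[- L, L]%classic (v ord0 i)]).
    apply: (@rV_compact R N (fun=> `[- L, L]%classic)) => _; exact: segment_compact.
  by apply/seteqP; split => x /= H i; have := H i; rewrite /= in_itv/= !mxE.
have [M [_ HM]] := compact_bounded (continuous_compact (continuous_subspaceT cf) cK).
exists (`|M| + 1); first by rewrite ltr_pwDr.
move=> x; have [->|fx] := eqVneq (f x) 0; first by rewrite normr0 addr_ge0.
apply: HM; first by rewrite (le_lt_trans (ler_norm _))// ltrDl.
exists x => // i; rewrite !mxE -ler_norml (le_trans (coord_le_norm _ _))//.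
exact: HL.
Qed.

Lemma integrable_ball (L M : R) :
  mu.-integrable setT (EFin \o (fun x : T => M * \1_(cbox (const_mx (- L)) (const_mx L)) x)).
Proof.
apply: integrable_EFinZ; apply/integrableP; split.
  by apply/measurable_EFinP; apply: measurable_indic; exact: measurable_cbox.
under eq_integral do rewrite /= ger0_norm//.
by rewrite integral_indic ?setIT ?leb_cbox_lty//; exact: measurable_cbox.
Qed.

Lemma indic_ball (L : R) x : `|x| <= L -> \1_(cbox (const_mx (- L)) (const_mx L)) x = 1 :> R.
Proof.
move=> xL; rewrite indicE mem_set// => i; rewrite !mxE -ler_norml.
exact: le_trans (coord_le_norm _ _) xL.
Qed.

Lemma ccont_measurable f : ccont f -> measurable_fun setT f.
Proof. by move=> [cf _]; exact: continuous_measurable_rV. Qed.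

Lemma ccont_integrable f : ccont f -> mu.-integrable setT (EFin \o f).
Proof.
move=> cf; have [M M0 HM] := ccont_bounded cf; have [_ [L L0 HL]] := cf.
apply: le_integrable (integrable_ball L M) => //.
  by apply/measurable_EFinP; apply: ccont_measurable.
move=> x _; rewrite /= lee_fin [leRHS]ger0_norm ?mulr_ge0 ?(ltW M0)//.
have [->|fx] := eqVneq (f x) 0; first by rewrite normr0 mulr_ge0// ltW.
by rewrite indic_ball ?mulr1//; exact: HL.
Qed.

Lemma ccont_sqint f : ccont f -> sqint mu f.
Proof.
move=> cf; have [M M0 HM] := ccont_bounded cf; have [_ [L L0 HL]] := cf.
apply: sqintP; first exact: ccont_measurable.
exists (fun x => M ^+ 2 * \1_(cbox (const_mx (- L)) (const_mx L)) x).
  exact: integrable_ball.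
move=> x; have [->|fx] := eqVneq (f x) 0.
  by rewrite expr0n /= mulr_ge0// sqr_ge0.
rewrite indic_ball ?mulr1; last exact: HL.
by rewrite -real_normK ?num_real// ler_sqr ?nnegrE// ltW.
Qed.

Lemma line_MVT f x i (h : R) : smooth f -> 0 < h ->
  exists c, f (x + h *: delta_mx ord0 i) - f x = h * partial i f (x + c *: delta_mx ord0 i).
Proof.
move=> sf h0; pose d : T := delta_mx ord0 i.
have Hd (s : R) : is_derive s 1 (fun s : R => f (x + s *: d)) (partial i f (x + s *: d)).
  have E : (fun k : R => k^-1 *: (((fun s : R => f (x + s *: d)) \o shift s) (k *: 1) -
      f (x + s *: d))) =
      (fun k => k^-1 *: ((f \o shift (x + s *: d)) (k *: d) - f (x + s *: d))).
    apply/funext => k /=; rewrite /shift /= (_ : k *: 1 = k :> R); last exact: mulr1.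
    by rewrite scalerDl addrCA.
  split; first by rewrite /derivable E; apply/diff_derivable/smooth_diff.
  by rewrite /derive E.
have [|c _] := @MVT R (fun s : R => f (x + s *: d)) (fun s => partial i f (x + s *: d)) 0 h h0.
- apply: continuous_subspaceT => s.
  apply: differentiable_continuous; apply/derivable1_diffP; by have [] := Hd s.
- by rewrite scale0r addr0 subr0 mulrC => ->; exists c.
Qed.

Lemma shift_seq_cvg f a x : continuous f -> f (x + n.+1%:R^-1 *: a) @[n --> \oo] --> f x.
Proof.
move=> cf; apply: (@continuous_cvg _ _ _ _ _ _ f); first exact: cf.
rewrite -[X in _ --> X]addr0; apply: cvgD; first exact: cvg_cst.
rewrite -(scale0r a); apply: cvgZr_tmp; exact: cvg_harmonic.
Qed.

Lemma norm_shift_le a x (L : R) n : `|x + n.+1%:R^-1 *: a| <= L -> `|x| <= L + `|a|.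
Proof.
move=> H; rewrite -[x](addrK (n.+1%:R^-1 *: a)); apply: le_trans (ler_normB _ _) _.
rewrite lerD// normrZ ger0_norm ?invr_ge0//.
by rewrite ler_piMl// invf_le1 ?ler1n.
Qed.

(** Dominated convergence: for every n the integrand is at most 4 M^2 and lives in the box of
    half-side L + |a|. *)
Lemma shift_cvg f a : ccont f ->
  ip mu ((fun x => f (x + n.+1%:R^-1 *: a)) - f) ((fun x => f (x + n.+1%:R^-1 *: a)) - f)
    @[n --> \oo] --> (0 : R).
Proof.
move=> cf; have [M M0 HM] := ccont_bounded cf; have [f_c [L L0 HL]] := cf.
rewrite (_ : 0 = \int[mu]_x (fun=> 0 : R) x); last first.
  by rewrite Rintegral_cst// mul0r.
apply: (dominated_cvg_Rintegral _ _ (integrable_ball (L + `|a|) (4 * M ^+ 2))).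
- move=> n; apply: measurable_funM; apply: measurable_funB;
    (try exact: ccont_measurable);
    apply: (measurableT_comp (f := f)); (try exact: ccont_measurable);
    exact: measurable_shift.
- move=> x; rewrite -[X in _ --> X](mulr0 0); apply: cvgM;
    by rewrite -[X in _ --> X](subrr (f x)); apply: cvgB;
      [exact: shift_seq_cvg|exact: cvg_cst].
- move=> n x; rewrite -[(_ - _) x]/(f (x + n.+1%:R^-1 *: a) - f x).
  set y := f _; rewrite -expr2 ger0_norm ?sqr_ge0//.
  have [/andP[/eqP y0 /eqP fx0]|] := boolP ((y == 0) && (f x == 0)).
    by rewrite y0 fx0 subrr expr0n mulr_ge0// mulr_ge0// sqr_ge0.
  rewrite negb_and => yf; rewrite indic_ball ?mulr1; last first.
    case/orP: yf => [/HL/norm_shift_le//|/HL xL].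
    by rewrite (le_trans xL)// lerDl.
  have := HM (x + n.+1%:R^-1 *: a); have := HM x; rewrite -/y !ler_norml.
  move=> /andP[? ?] /andP[? ?]; nra.
Qed.

(** Difference quotients have integral 0 by translation invariance, and they converge to the
    derivative; the mean value theorem dominates them by a bound on the derivative. *)
Lemma Rintegral_partial O i phi : test_function O phi ->
  \int[mu]_x partial i phi x = 0.
Proof.
move=> tp; have cp := test_ccont tp; have cdp := test_ccont (test_partial i tp).
have [M M0 HM] := ccont_bounded cdp; have [_ [L L0 HL]] := cp.
have sp := test_smooth tp.
pose d : T := delta_mx ord0 i.
pose g n x := n.+1%:R * (phi (x + n.+1%:R^-1 *: d) - phi x).
have gE n x : exists c, g n x = partial i phi (x + c *: d).
  have h0 : 0 < n.+1%:R^-1 :> R by rewrite invr_gt0.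
  have [c Hc] := line_MVT x i sp h0; exists c.
  by rewrite /g Hc mulrA mulfV ?mul1r// pnatr_eq0.
have gi n : \int[mu]_x g n x = 0.
  have ip1 := integrable_shift (n.+1%:R^-1 *: d) (ccont_integrable cp).
  rewrite RintegralZl//; last first.
    apply: (integrable_EFinD ip1); have := integrable_EFinZ (-1) (ccont_integrable cp).
    by under eq_fun do rewrite /= mulN1r.
  rewrite RintegralB// ?Rintegral_shift ?subrr ?mulr0//; exact: ccont_integrable.
suff : \int[mu]_x g n x @[n --> \oo] --> \int[mu]_x partial i phi x.
  rewrite (_ : (fun n => \int[mu]_x g n x) = cst 0); last exact/funext.
  have H0 : cst 0 n @[n --> \oo] --> (0 : R) by exact: cvg_cst.
  by move=> H; rewrite -(cvg_lim (@Rhausdorff R) H) (cvg_lim (@Rhausdorff R) H0).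
apply: (dominated_cvg_Rintegral _ _ (integrable_ball (L + `|d|) M)).
- move=> n; apply: measurable_funM => //; apply: measurable_funB.
    apply: (measurableT_comp (f := phi)); first exact: ccont_measurable.
    exact: measurable_shift.
  exact: ccont_measurable.
- move=> x; have dx : derivable phi x d by apply/diff_derivable/smooth_diff.
  have hn : n.+1%:R^-1 @[n --> \oo] --> (0 : R)^'.
    move=> A; rewrite /dnbhs /within /= => A0.
    have : \forall n \near \oo, n.+1%:R^-1 != 0 :> R -> A n.+1%:R^-1.
      exact: (@cvg_harmonic R _ A0).
    by apply: filterS => n; apply; rewrite invr_eq0 pnatr_eq0.
  have := cvg_comp _ _ hn dx; apply: cvg_trans; apply: near_eq_cvg; apply: nearW => n /=.
  by rewrite /g /shift /= invrK [_ *: d + x]addrC.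
- move=> n x; have [/andP[/eqP y0 /eqP fx0]|] :=
      boolP ((phi (x + n.+1%:R^-1 *: d) == 0) && (phi x == 0)).
    by rewrite /g y0 fx0 subrr mulr0 normr0 mulr_ge0// ltW.
  rewrite negb_and => yf; rewrite indic_ball ?mulr1; last first.
    case/orP: yf => [/HL/norm_shift_le//|/HL xL].
    by rewrite (le_trans xL)// lerDl.
  by have [c ->] := gE n x.
Qed.

End test_functions.

(** * Bump functions and plateau functions *)

Section bumps.
Context (R : realType) (N : nat).
Local Notation T := 'rV[R]_N.
Local Notation mu := (leb R N).
Implicit Types (f g h phi : T -> R) (x a b p : T) (i j : 'I_N) (O : set T) (y s : R).

Lemma flat1_ge0 y : 0 <= flat 1 y.
Proof. by rewrite /flat; case: ifP => // _; rewrite hornerC mul1r expR_ge0. Qed.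

Lemma flat1_gt0 y : (0 < flat 1 y) = (0 < y).
Proof.
by rewrite /flat; case: ifP => // _; rewrite ?ltxx// hornerC mul1r expR_gt0.
Qed.

Lemma flat1_le1 y : flat 1 y <= 1.
Proof.
rewrite /flat; case: ifP => // y0; rewrite hornerC mul1r -expR0 ler_expR.
by rewrite oppr_le0 invr_ge0 ltW.
Qed.

(** n^2 s + n tends to +oo for s >= 0 and to -oo for s < 0. The term n settles s = 0, so that the
    limit is the indicator of a closed half-line. *)
Lemma flat1_cvg s : flat 1 (n%:R ^+ 2 * s + n%:R) @[n --> \oo] --> ((0 <= s)%R%:R : R).
Proof.
have [s0|s0] := leP 0 s.
  apply: (@squeeze_cvgr _ _ _ _ (fun n => 1 - n%:R^-1) (cst 1)).
  - exists 1%N => // n /= n0; rewrite flat1_le1 andbT.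
    have n0' : 0 < n%:R :> R by rewrite ltr0n.
    have : n%:R <= n%:R ^+ 2 * s + n%:R by rewrite lerDr mulr_ge0// sqr_ge0.
    move: (_ + _) => y ny.
    have y0 := lt_le_trans n0' ny; rewrite /flat y0 hornerC mul1r.
    apply: le_trans (expR_ge1Dx _); rewrite lerD2l lerN2.
    by rewrite lef_pV2.
  - rewrite -[X in _ --> X]subr0; apply: cvgB; first exact: cvg_cst.
    by rewrite -(cvg_shiftS (fun n => n%:R^-1 : R)); exact: cvg_harmonic.
  - exact: cvg_cst.
apply: cvg_near_cst; exists (Num.truncn (- s)^-1).+1 => // n /= hn.
apply/eqP; rewrite eq_le flat1_ge0 andbT leNgt flat1_gt0 -leNgt.
have ns : 0 < - s by rewrite oppr_gt0.
have : (- s)^-1 <= n%:R.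
  apply: (@le_trans _ _ (Num.truncn (- s)^-1).+1%:R); last by rewrite ler_nat.
  by rewrite ltW// truncnS_gt.
rewrite -[_^-1]mul1r ler_pdivrMr//.
have : 0 <= n%:R :> R by []. move: (n%:R) => z; nra.
Qed.

Lemma cvg_prodr (I : Type) (r : seq I) (u : I -> nat -> R) (l : I -> R) :
  (forall k, u k n @[n --> \oo] --> l k) ->
  \prod_(k <- r) u k n @[n --> \oo] --> \prod_(k <- r) l k.
Proof.
move=> ul; elim: r => [|k r IH].
  rewrite big_nil (_ : (fun _ => _) = cst 1); first exact: cvg_cst.
  by apply/funext => n; rewrite big_nil.
rewrite big_cons (_ : (fun _ => _) = (fun n => u k n * \prod_(j <- r) u j n)).
  exact: cvgM.
by apply/funext => n; rewrite big_cons.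
Qed.

(** Two uses of the parameters: k = 1, c = 0 gives a smooth function positive inside the box and
    zero outside; k = n^2, c = n gives a sequence tending to the indicator of the closed box. *)
Definition bump a b (k c : R) x := \prod_(i < N)
  (flat_coord 1 k (c - k * a ord0 i) i x * flat_coord 1 (- k) (c + k * b ord0 i) i x).

Lemma bumpE a b k c x : bump a b k c x = \prod_(i < N)
  (flat 1 (k * (x ord0 i - a ord0 i) + c) * flat 1 (k * (b ord0 i - x ord0 i) + c)).
Proof.
by apply: eq_bigr => i _; rewrite /flat_coord; congr (flat _ _ * flat _ _); ring.
Qed.

Lemma smooth_bump a b k c : smooth (bump a b k c).
Proof. by apply: smooth_prod => i; apply: smoothM; exact: smooth_flat_coord. Qed.

Lemma bump_ge0 a b k c x : 0 <= bump a b k c x.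
Proof. by rewrite bumpE; apply: prodr_ge0 => i _; rewrite mulr_ge0// flat1_ge0. Qed.

Lemma bump_le1 a b k c x : bump a b k c x <= 1.
Proof.
rewrite bumpE -[leRHS](big1_eq (op := *%R : R -> R -> R) (index_enum 'I_N) xpredT).
apply: ler_prod => i _; rewrite mulr_ge0 ?flat1_ge0//=.
by rewrite mulr_ile1 ?flat1_ge0// flat1_le1.
Qed.

Lemma bump_cvg a b x :
  bump a b (n%:R ^+ 2) n%:R x @[n --> \oo] --> (\1_(cbox a b) x : R).
Proof.
rewrite (_ : \1__ x = \prod_(i < N) ((0 <= x ord0 i - a ord0 i)%R%:R *
    (0 <= b ord0 i - x ord0 i)%R%:R)).
  under eq_fun do rewrite bumpE.
  by apply: cvg_prodr => i; apply: cvgM; exact: flat1_cvg.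
rewrite indicE; case: (boolP (x \in cbox a b)) => [/set_mem H|/negP].
  rewrite big1// => i _; have /andP[ax xb] := H i.
  by rewrite !subr_ge0 ax xb mulr1.
rewrite in_setE => H; have [i Hi] : exists i, ~~ (a ord0 i <= x ord0 i <= b ord0 i).
  apply: contrapT => /forallNP H'; apply: H => i; apply/negPn/negP; exact: H'.
rewrite (bigD1 i)//= !subr_ge0 -natrM mulnb (negbTE Hi) mul0r //.
Qed.

Lemma bump_cbox a b x : bump a b 1 0 x != 0 -> cbox a b x.
Proof.
move=> bx i; move: bx; rewrite bumpE (bigD1 i)//= !mul1r !addr0 mulf_eq0 => /norP[+ _].
rewrite mulf_eq0 => /norP[].
have gt0 y : flat 1 y != 0 -> 0 < y by rewrite -flat1_gt0 lt_neqAle eq_sym flat1_ge0 andbT.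
by move=> /gt0 + /gt0; rewrite !subr_gt0 => /ltW -> /ltW ->.
Qed.

Lemma bump_gt0 a b x : (forall i, a ord0 i < x ord0 i < b ord0 i) -> 0 < bump a b 1 0 x.
Proof.
move=> H; rewrite bumpE; apply: prodr_gt0 => i _; rewrite !mul1r !addr0.
by have /andP[ax xb] := H i; rewrite mulr_gt0// flat1_gt0 subr_gt0.
Qed.

Lemma compact_cbox a b : compact (cbox a b).
Proof.
rewrite (_ : cbox _ _ = [set v : T | forall i, `[a ord0 i, b ord0 i]%classic (v ord0 i)]).
  apply: (@rV_compact R N (fun i => `[a ord0 i, b ord0 i]%classic)) => i.
  exact: segment_compact.
by apply/seteqP; split => x /= H i; have := H i; rewrite /= in_itv.
Qed.

Lemma closed_cbox a b : closed (cbox a b).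
Proof. by apply: compact_closed; [exact: norm_hausdorff|exact: compact_cbox]. Qed.

Lemma sub_cbox_test O a b f : smooth f -> cbox a b `<=` O ->
  (forall x, f x != 0 -> cbox a b x) -> test_function O f.
Proof.
move=> sf abO fab.
have sub : supp f `<=` cbox a b.
  rewrite [X in _ `<=` X](iffLR (closure_id _) (closed_cbox (a := a) (b := b))).
  by apply: closureS => x; exact: fab.
split => //; last exact: subset_trans abO.
by apply: (subclosed_compact _ (compact_cbox (a := a) (b := b)) sub); exact: closed_closure.
Qed.

(** In each coordinate take A / (A + B) with y = x i - p i: A is positive for |y| < 2 r and B for
    |y| > r, so A + B never vanishes, and the quotient is 1 where B = 0. *)
Lemma plateau p (r : R) : 0 < r -> exists chi : T -> R,
  [/\ test_function setT chi, forall x, `|x - p| <= r -> chi x = 1 &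
      forall x, chi x != 0 -> `|x - p| <= 2 * r].
Proof.
move=> r0.
pose A i := (flat_coord 1 1 (2 * r - p ord0 i) i : T -> R) * flat_coord 1 (-1) (2 * r + p ord0 i) i.
pose B i := (flat_coord 1 1 (- r - p ord0 i) i : T -> R) + flat_coord 1 (-1) (p ord0 i - r) i.
have AE i x : A i x = flat 1 (2 * r + (x ord0 i - p ord0 i)) * flat 1 (2 * r - (x ord0 i - p ord0 i)).
  rewrite -[A i x]/(flat _ _ * flat _ _); congr (flat _ _ * flat _ _); ring.
have BE i x : B i x = flat 1 ((x ord0 i - p ord0 i) - r) + flat 1 (- (x ord0 i - p ord0 i) - r).
  rewrite -[B i x]/(flat _ _ + flat _ _); congr (flat _ _ + flat _ _); ring.
have f0 y : y <= 0 -> flat 1 y = 0 by rewrite /flat leNgt => /negbTE ->.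
have AB0 i x : (A + B) i x != 0.
  rewrite -[(A + B) i x]/(A i x + B i x) AE BE; move: (x ord0 i - p ord0 i) => y.
  have := flat1_ge0 (y - r); have := flat1_ge0 (- y - r).
  have := mulr_ge0 (flat1_ge0 (2 * r + y)) (flat1_ge0 (2 * r - y)) => a1 b1 b2.
  rewrite gt_eqF//; have [yr|yr] := ltP `|y| (2 * r).
    have /andP[y1 y2] : (- (2 * r) < y < 2 * r) by rewrite -ltr_norml.
    have : 0 < flat 1 (2 * r + y) * flat 1 (2 * r - y).
      by rewrite mulr_gt0// flat1_gt0; lra.
    lra.
  have [y0|y0] := leP 0 y.
    rewrite ger0_norm// in yr; have : 0 < flat 1 (y - r) by rewrite flat1_gt0; lra.
    lra.
  rewrite ltr0_norm// in yr; have : 0 < flat 1 (- y - r) by rewrite flat1_gt0; lra.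
  lra.
pose chi x := \prod_(i < N) (A i x * ((A + B) i x)^-1).
have schi : smooth chi.
  apply: smooth_prod => i; apply: smoothM.
    by apply: smoothM; exact: smooth_flat_coord.
  apply: smoothV; first exact: AB0.
  by apply: smoothD; [apply: smoothM|apply: smoothD]; exact: smooth_flat_coord.
have chi_supp x : chi x != 0 -> `|x - p| <= 2 * r.
  move=> cx; apply: norm_le_coord => [|i]; first by rewrite mulr_ge0// ltW.
  move: cx; rewrite /chi (bigD1 i)//= mulf_eq0 => /norP[+ _].
  rewrite mulf_eq0 => /norP[+ _]; rewrite AE !mxE ler_norml => Ai.
  apply/andP; split; rewrite leNgt; apply: contra Ai => H.
    by rewrite f0 ?mul0r//; lra.
  by rewrite [X in _ * X]f0 ?mulr0//; lra.
exists chi; split => //.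
- apply: (@sub_cbox_test _ (const_mx (- (2 * r)) + p) (const_mx (2 * r) + p)) => // x.
  move=> /chi_supp xp i; rewrite !mxE.
  have := le_trans (coord_le_norm (x - p) i) xp.
  by rewrite !mxE ler_norml lerBlDr lerBrDr.
- move=> x xr; rewrite /chi big1// => i _.
  have := le_trans (coord_le_norm (x - p) i) xr; rewrite !mxE ler_norml => /andP[y1 y2].
  have -> : (A + B) i x = A i x.
    by rewrite -[LHS]/(A i x + B i x) BE !f0 ?addr0//; lra.
  rewrite mulfV//; have := AB0 i x.
  by rewrite -[(A + B) i x]/(A i x + B i x) BE !f0 ?addr0//; lra.
Qed.

End bumps.

(** * The fundamental lemma of the calculus of variations *)

Section fundamental_lemma.
Context (R : realType) (N : nat).
Local Notation T := 'rV[R]_N.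
Local Notation mu := (leb R N).
Implicit Types (h phi : T -> R) (x a b : T) (A O : set T).

(** A bump times phi is again a test function. Letting the bumps tend to indicators gives integral 0
    of h phi over every box, and Dynkin induction extends this to every measurable set. *)
Lemma test_Rintegral0_ae O h phi :
  (forall psi, test_function O psi -> mu.-integrable setT (EFin \o (fun x => h x * psi x))) ->
  (forall psi, test_function O psi -> \int[mu]_x (h x * psi x) = 0) ->
  test_function O phi -> ae_eq mu setT (fun x => h x * phi x) (cst 0).
Proof.
move=> hi h0 tphi; have ihp := hi _ tphi.
have mhp : measurable_fun setT (fun x => h x * phi x).
  by apply/measurable_EFinP; exact: (measurable_int mu).
have int0 psi : test_function O psi -> (\int[mu]_x (h x * psi x)%:E = 0)%E.
  move=> tp; rewrite -[LHS]fineK; last exact: integrable_fin_num (hi _ tp).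
  by have := h0 _ tp; rewrite /Rintegral => ->.
have P0 A : measurable A -> (\int[mu]_(x in A) (h x * phi x)%:E = 0)%E.
  move=> mA; have : <<s @cboxes R N >> A by rewrite -measurable_cboxes.
  apply: (dynkin_induction (@measurable_cboxes R N) (@setI_closed_cboxes R N)
    (P := fun A => (\int[mu]_(x in A) (h x * phi x)%:E = 0)%E)).
  - exact: int0.
  - move=> _ [a [b ->]]; have mab := measurable_cbox a b.
    have lim : \int[mu]_x (h x * phi x * bump a b (n%:R ^+ 2) n%:R x) @[n --> \oo] -->
        \int[mu]_x (h x * phi x * \1_(cbox a b) x).
      apply: (@dominated_cvg_Rintegral _ _ _ _ _ _ (fun x => `|h x * phi x|)).
      + move=> n; apply: measurable_funM => //; apply: continuous_measurable_rV.
        by apply: smooth_continuous; exact: smooth_bump.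
      + by move=> x; apply: cvgM; [exact: cvg_cst|exact: bump_cvg].
      + exact: integrable_norm.
      + move=> n x; rewrite normrM ler_piMr// ger0_norm ?bump_ge0//; exact: bump_le1.
    have H0 : \int[mu]_x (h x * phi x * \1_(cbox a b) x) = 0.
      have C0 : cst 0 n @[n --> \oo] --> (0 : R) by exact: cvg_cst.
      move: lim; rewrite (_ : (fun n => _) = cst 0).
        by move=> lim; rewrite -(cvg_lim (@Rhausdorff R) lim) (cvg_lim (@Rhausdorff R) C0).
      apply/funext => n /=; rewrite -(h0 (bump a b (n%:R ^+ 2) n%:R * phi)); last first.
        apply: test_mull => //; exact: smooth_bump.
      by apply: eq_Rintegral => x _; rewrite -mulrA [phi x * _]mulrC.
    rewrite integral_mkcond; rewrite -[RHS]/((0 : R)%:E) -H0 /Rintegral.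
    have eqf : (fun x => (h x * phi x)%:E) \_ (cbox a b) =
        (fun x => (h x * phi x * \1_(cbox a b) x)%:E).
      apply/funext => x; rewrite patchE indicE.
      by case: (x \in cbox a b); rewrite ?mulr1 ?mulr0.
    rewrite eqf fineK// -eqf; apply: integrable_fin_num => //.
    apply/(integrable_mkcond _ mab); exact: (integrableS measurableT mab (@subsetT _ _) ihp).
  - move=> S mS PS; have mCS := measurableC mS.
    have := int0 _ tphi; rewrite -(setUv S) integral_setU_EFin//.
    + by rewrite PS add0e.
    + by rewrite setUv.
    + by apply/disj_setPS; rewrite setICr.
  - move=> F mF tF PF; rewrite integral_bigcup//.
    + by rewrite eseries0//= => i _ _; exact: PF.
    + by apply: integrableS ihp => //; exact: bigcup_measurable.
have := @integral_ae_eq _ _ _ mu setT measurableT (cst 0) _ ihp (measurable_cst _).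
move=> H; have {}H : ae_eq mu setT (EFin \o (fun x => h x * phi x)) (cst 0).
  by apply: H => E _ mE; rewrite P0// integral0.
by apply: filterS H => x /= H /H [].
Qed.

(** Each point of [O] is interior to a rational box contained in [O], where the bump of that box is
    positive; there are countably many such boxes. *)
Lemma fundamental_lemma O h : open O ->
  (forall psi, test_function O psi -> mu.-integrable setT (EFin \o (fun x => h x * psi x))) ->
  (forall psi, test_function O psi -> \int[mu]_x (h x * psi x) = 0) ->
  {ae mu, forall x, O x -> h x = 0}.
Proof.
move=> oO hi h0.
pose bmp (q : 'rV[rat]_N * 'rV[rat]_N) : T -> R :=
  bump (map_mx ratr q.1) (map_mx ratr q.2) 1 0.
pose P n x := if @unpickle ('rV[rat]_N * 'rV[rat]_N)%type n is Some q then
  cbox (map_mx ratr q.1) (map_mx ratr q.2) `<=` O -> h x * bmp q x = 0 else True.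
have aeP n : {ae mu, forall x, P n x}.
  rewrite /P; case: unpickle => [q|]; last exact: aeW.
  have [qO|nqO] := pselect (cbox (map_mx (ratr : rat -> R) q.1) (map_mx ratr q.2) `<=` O).
    have tb : test_function O (bmp q).
      apply: (sub_cbox_test _ qO); [exact: smooth_bump|exact: bump_cbox].
    by have := test_Rintegral0_ae hi h0 tb; apply: filterS => x /(_ I).
  by apply: aeW => x /nqO.
have := ae_foralln aeP; apply: filterS => x Px Ox.
have [q [xq qO]] := rational_cbox oO Ox.
have := Px (pickle q); rewrite /P pickleK => /(_ qO)/eqP; rewrite mulf_eq0.
have : 0 < bmp q x by apply: bump_gt0 => i; rewrite !mxE.
by move=> /gt_eqF ->; rewrite orbF => /eqP.
Qed.

End fundamental_lemma.

Lemma ip_cs d (T : measurableType d) (R : realType) (mu : {measure set T -> \bar R})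
  (f g : T -> R) : sqint mu f -> sqint mu g ->
  ip mu f g ^+ 2 <= ip mu f f * ip mu g g.
Proof.
exact: (form_cs (@sqint_lin _ _ _ mu) (@ipC _ _ _ mu) (@ip_linl _ _ _ mu) (@ip_ge0 _ _ _ mu)).
Qed.

Lemma ip_le2 d (T : measurableType d) (R : realType) (mu : {measure set T -> \bar R})
  (f g : T -> R) : sqint mu f -> sqint mu g ->
  ip mu (f + g) (f + g) <= 2 * ip mu f f + 2 * ip mu g g.
Proof.
exact: (form_le2 (@sqint_lin _ _ _ mu) (@ipC _ _ _ mu) (@ip_linl _ _ _ mu) (@ip_ge0 _ _ _ mu)).
Qed.

(** * Pairs of zero trace: H^1_0 spaces inside one space of pairs *)

Section zero_trace_pairs.
Context (R : realType) (N : nat).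
Local Notation T := 'rV[R]_N.
Local Notation mu := (leb R N).
Local Notation X := ((T -> R) * ('I_N -> T -> R))%type.
Implicit Types (P Q : X) (phi psi chi : T -> R) (O : set T) (i : 'I_N).

(* A pair (u, p) : X stands for a function u on the whole space together with a
   candidate p for its gradient. V0 O is the closure of the pairs
   (phi, grad phi), phi a test function of O: it is H^1_0(O), extended by zero. *)
Definition ipG P Q : R := \sum_(i < N) ip mu (P.2 i) (Q.2 i).

Definition ipH P Q : R := ip mu P.1 Q.1 + ipG P Q.

Definition sqintX P := sqint mu P.1 /\ forall i, sqint mu (P.2 i).

Definition jet phi : X := (phi, fun i => partial i phi).

Definition V0 O : set X := [set P | sqintX P /\ forall e : R, 0 < e ->
  exists2 phi, test_function O phi & ipH (P - jet phi) (P - jet phi) <= e].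

Lemma sqintX_lin (a : R) P Q : sqintX P -> sqintX Q -> sqintX (a *: P + Q).
Proof.
move=> [P1 P2] [Q1 Q2]; split=> [|i]; first exact: sqint_lin.
exact: (sqint_lin a (P2 i) (Q2 i)).
Qed.

Lemma sqintX0 : sqintX 0.
Proof. by split => [|i]; exact: sqint0. Qed.

Lemma ipGC P Q : ipG P Q = ipG Q P.
Proof. by apply: eq_bigr => i _; rewrite ipC. Qed.

Lemma ipHC P Q : ipH P Q = ipH Q P.
Proof. by rewrite /ipH ipC ipGC. Qed.

Lemma ipGL (a : R) P Q U : sqintX P -> sqintX Q -> sqintX U ->
  ipG (a *: P + Q) U = a * ipG P U + ipG Q U.
Proof.
move=> [_ P2] [_ Q2] [_ U2]; rewrite /ipG mulr_sumr -big_split/=.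
by apply: eq_bigr => i _; rewrite -ip_linl.
Qed.

Lemma ipHL (a : R) P Q U : sqintX P -> sqintX Q -> sqintX U ->
  ipH (a *: P + Q) U = a * ipH P U + ipH Q U.
Proof.
move=> sP sQ sU; rewrite /ipH ipGL// (ip_linl a _ _ _ : ip mu (_ + _) _ = _).
- by ring.
- by case: sP.
- by case: sQ.
- by case: sU.
Qed.

Lemma ipG_ge0 P : 0 <= ipG P P.
Proof. by apply: sumr_ge0 => i _; exact: ip_ge0. Qed.

Lemma ipH_ge0 P : 0 <= ipH P P.
Proof. by rewrite addr_ge0 ?ip_ge0 ?ipG_ge0. Qed.

Lemma ipG_le P : ipG P P <= ipH P P.
Proof. by rewrite lerDr ip_ge0. Qed.

Lemma ip1_le P : ip mu P.1 P.1 <= ipH P P.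
Proof. by rewrite lerDl ipG_ge0. Qed.

Lemma ip2_le P i : ip mu (P.2 i) (P.2 i) <= ipG P P.
Proof.
rewrite /ipG (bigD1 i)//= lerDl; apply: sumr_ge0 => j _; exact: ip_ge0.
Qed.

Definition ipH_le2 := form_le2 sqintX_lin ipHC ipHL ipH_ge0.
Definition ipH_le2B := form_le2B sqintX_lin ipHC ipHL ipH_ge0.
Definition ipG_le2 := form_le2 sqintX_lin ipGC ipGL ipG_ge0.
Definition ipG_le2B := form_le2B sqintX_lin ipGC ipGL ipG_ge0.
Definition ipG_cs := form_cs sqintX_lin ipGC ipGL ipG_ge0.
Definition ipH_cs := form_cs sqintX_lin ipHC ipHL ipH_ge0.

Lemma sqintXB P Q : sqintX P -> sqintX Q -> sqintX (P - Q).
Proof. exact: SB sqintX_lin _ _. Qed.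

Lemma ipH_symB P Q : sqintX P -> sqintX Q -> ipH (P - Q) (P - Q) = ipH (Q - P) (Q - P).
Proof.
move=> sP sQ; rewrite !(formBB sqintX_lin ipHC ipHL)// [ipH Q P]ipHC; ring.
Qed.

Lemma test_sqint O phi : test_function O phi -> sqint mu phi.
Proof. by move=> /test_ccont /ccont_sqint. Qed.

Lemma sqintX_jet O phi : test_function O phi -> sqintX (jet phi).
Proof.
move=> tp; split => [|i]; first exact: test_sqint tp.
exact: test_sqint (test_partial i tp).
Qed.

Lemma jet_lin (a : R) phi psi : smooth phi -> smooth psi ->
  jet (a *: phi + psi) = a *: jet phi + jet psi.
Proof.
move=> sp sq; congr pair; apply/funext => i.
rewrite partialD ?partialZ//; try by move=> x; exact: smooth_diff.
by move=> x; apply: differentiableZ; exact: smooth_diff.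
Qed.

Lemma jetB phi psi : smooth phi -> smooth psi -> jet (phi - psi) = jet phi - jet psi.
Proof. by move=> sp sq; rewrite addrC -scaleN1r jet_lin// scaleN1r addrC. Qed.

Lemma V0_jet O phi : test_function O phi -> V0 O (jet phi).
Proof.
move=> tp; split; first exact: sqintX_jet tp.
move=> e e0; exists phi => //; rewrite subrr.
suff -> : ipH 0 0 = 0 by exact: ltW.
have := ipHL 0 sqintX0 sqintX0 sqintX0.
by rewrite scale0r addr0 mul0r add0r; have := ipHL 1 sqintX0 sqintX0 sqintX0;
  rewrite scaler0 addr0 mul1r => /eqP; rewrite -subr_eq0 opprD addNKr oppr_eq0 => /eqP.
Qed.

Lemma V0_closed O P : sqintX P ->
  (forall e : R, 0 < e -> exists2 Q, V0 O Q & ipH (P - Q) (P - Q) <= e) -> V0 O P.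
Proof.
move=> sP H; split => // e e0; have e4 : 0 < e / 4 by rewrite divr_gt0.
have [Q [sQ HQ] PQ] := H _ e4; have [phi tp Qp] := HQ _ e4.
exists phi => //; have sj := sqintX_jet tp.
rewrite (_ : P - jet phi = (P - Q) + (Q - jet phi)); last by rewrite addrA subrK.
by apply: le_trans (ipH_le2 (sqintXB sP sQ) (sqintXB sQ sj)) _; lra.
Qed.

Lemma V0_subspace O : subspace sqintX (V0 O).
Proof.
split; first by move=> P [].
  have := V0_jet (test0 O); rewrite (_ : jet 0 = 0)//.
  congr pair; apply/funext => i; exact: (partial_cst i 0).
move=> a P Q [sP HP] [sQ HQ]; split; first exact: sqintX_lin.
move=> e e0; have dP : 0 < e / (4 * (a ^+ 2 + 1)).
  by rewrite divr_gt0// mulr_gt0// ltr_wpDl// sqr_ge0.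
have [phi tphi Pphi] := HP _ dP.
have [psi tpsi Qpsi] := HQ _ (divr_gt0 e0 (ltr0n _ 4)).
exists (a *: phi + psi); first exact: test_lin.
have [s1 s2] := (sqintX_jet tphi, sqintX_jet tpsi).
rewrite jet_lin; [|exact: test_smooth tphi|exact: test_smooth tpsi].
rewrite (_ : a *: P + Q - _ = a *: (P - jet phi) + (Q - jet psi)); last first.
  by rewrite scalerBr opprD addrACA.
have sP1 := sqintXB sP s1; have sQ1 := sqintXB sQ s2.
have sa : sqintX (a *: (P - jet phi)).
  by rewrite -[_ *: _]addr0; apply: sqintX_lin => //; exact: sqintX0.
apply: le_trans (ipH_le2 sa sQ1) _.
have -> : ipH (a *: (P - jet phi)) (a *: (P - jet phi)) =
    a ^+ 2 * ipH (P - jet phi) (P - jet phi).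
  by rewrite (formZl ipHL a sP1 sa) ipHC (formZl ipHL a sP1 sP1) mulrA.
move: Pphi; rewrite ler_pdivlMr; last by rewrite mulr_gt0// ltr_wpDl// sqr_ge0.
have := ipH_ge0 (P - jet phi); move: Qpsi (sqr_ge0 a).
move: (ipH (P - _) _) (ipH (Q - _) _) (a ^+ 2) => p q b; clear; nra.
Qed.

Lemma V0_mono O O' : O `<=` O' -> V0 O `<=` V0 O'.
Proof.
move=> OO P [sP HP]; split => // e /HP[phi tp Pp]; exists phi => //.
exact: test_functionW tp.
Qed.

Lemma ae_ipH P Q : sqintX P -> sqintX Q -> ae_eq mu setT P.1 Q.1 ->
  (forall i, ae_eq mu setT (P.2 i) (Q.2 i)) -> ipH (P - Q) (P - Q) = 0.
Proof.
move=> [P1 P2] [Q1 Q2] e1 e2; rewrite /ipH ae0_ip; last 2 first.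
- exact: sqintB.
- by apply: filterS e1 => x /= H xT; rewrite -[LHS]/(P.1 x - Q.1 x) H// subrr.
rewrite add0r /ipG big1// => i _; apply: ae0_ip; first exact: (sqintB (P2 i) (Q2 i)).
by apply: filterS (e2 i) => x /= H xT; rewrite -[LHS]/(P.2 i x - Q.2 i x) H// subrr.
Qed.

(** The k-th derivative of x_k phi^2 has integral 0, which expresses the integral of phi^2 as - 2
    times that of x_k phi times the k-th derivative of phi. Cauchy-Schwarz and |x_k| <= M on the
    support conclude. *)
Lemma test_poincare (M : R) phi (k : 'I_N) : 0 <= M ->
  test_function (cbox (const_mx (- M)) (const_mx M)) phi ->
  ip mu phi phi <= 4 * M ^+ 2 * ip mu (partial k phi) (partial k phi).
Proof.
move=> M0 tp; pose c : T -> R := fun x => x ord0 k.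
have sp := test_smooth tp; have sc : smooth c by exact: smooth_coord.
have tcp := test_mull sc tp; have sdp := test_sqint (test_partial k tp).
have [scp sqp] := (test_sqint tcp, test_sqint tp).
have dp x : differentiable phi x by exact: smooth_diff.
have dcp x : differentiable (c * phi) x by apply: smooth_diff; exact: test_smooth tcp.
have dc x : differentiable c x by exact: smooth_diff.
have := Rintegral_partial k (test_mull (test_smooth tcp) tp).
rewrite partialM// partialM// partial_coord eqxx => H.
have {}H : ip mu phi phi + 2 * ip mu (c * phi) (partial k phi) = 0.
  rewrite -[RHS]H /ip -RintegralZl//; last exact: integrable_ip.
  rewrite -RintegralD//; last 2 first.
  - exact: integrable_ip.
  - by apply: integrable_EFinZ; exact: integrable_ip.
  apply: eq_Rintegral => x _.
  rewrite -[RHS]/((1 * phi x + c x * partial k phi x) * phi x +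
    (c x * phi x) * partial k phi x) -[(c * phi) x]/(c x * phi x); ring.
have cM : ip mu (c * phi) (c * phi) <= M ^+ 2 * ip mu phi phi.
  rewrite /ip -RintegralZl//; last exact: integrable_ip.
  apply: le_Rintegral => //.
  - exact: integrable_ip.
  - by apply: integrable_EFinZ; exact: integrable_ip.
  move=> x _; rewrite -[(c * phi) x]/(c x * phi x).
  have [->|px] := eqVneq (phi x) 0; first by rewrite !mulr0.
  have sx : supp phi x by exact: subset_closure.
  have [_ _ /(_ x sx) /(_ k)] := tp.
  rewrite !mxE -/(c x) => /andP[c1 c2].
  rewrite mulrACA; apply: ler_wpM2r; first by rewrite -expr2 sqr_ge0.
  by nra.
have cs : ip mu (c * phi) (partial k phi) ^+ 2 <=
    ip mu (c * phi) (c * phi) * ip mu (partial k phi) (partial k phi).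
  exact: ip_cs.
apply: le_of_sqr_le; rewrite ?ip_ge0// ?mulr_ge0 ?ip_ge0 ?sqr_ge0//.
have -> : ip mu phi phi ^+ 2 = 4 * ip mu (c * phi) (partial k phi) ^+ 2.
  have -> : ip mu phi phi = - (2 * ip mu (c * phi) (partial k phi)) by lra.
  by ring.
have := ip_ge0 mu (partial k phi); move: cs cM; set d := ip mu (partial k phi) _.
nra.
Qed.

Lemma limit_le (x y : R) (k : R) : 0 <= k -> (forall e, 0 < e -> x <= y + k * e) -> x <= y.
Proof.
move=> k0 H; apply/ler_addgt0Pr => e e0.
have := H (e / (k + 1)) (divr_gt0 e0 (ltr_wpDl k0 ltr01)).
rewrite mulrA => /le_trans; apply; rewrite lerD2l ler_pdivrMr ?ltr_wpDl//.
by rewrite mulrDr mulr1 mulrC lerDl ltW.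
Qed.

(** Passage to the limit from test functions. On [V0 O] the gradient form [ipG] therefore controls
    [ipH], so that projections may be taken with [ipG]. *)
Lemma V0_poincare O : (0 < N)%N -> bounded_set O -> exists C : R, 0 <= C /\
  forall P, V0 O P -> ip mu P.1 P.1 <= C * ipG P P.
Proof.
move=> N0 /bounded_cbox[M [M0 OM]]; pose C := 4 * M ^+ 2.
have C0 : 0 <= C by rewrite mulr_ge0// sqr_ge0.
exists (4 * C); split; first by rewrite mulr_ge0.
move=> P [sP HP].
apply: (@limit_le _ _ (2 + 4 * C)); first by rewrite addr_ge0// mulr_ge0.
move=> e e0; have [phi tp Pp] := HP _ e0; have sj := sqintX_jet tp.
have sB := sqintXB sP sj.
have h1 : ip mu P.1 P.1 <= 2 * ip mu (P.1 - phi) (P.1 - phi) + 2 * ip mu phi phi.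
  by rewrite -[X in ip _ X X <= _](subrK phi); apply: ip_le2; [case: sB|case: sj].
have h2 := test_poincare (Ordinal N0) (ltW M0) (test_functionW OM tp).
have h3 := ip2_le (jet phi) (Ordinal N0).
have h4 : ipG (jet phi) (jet phi) <= 2 * ipG P P + 2 * ipG (P - jet phi) (P - jet phi).
  rewrite [X in ipG X X](_ : _ = P - (P - jet phi)); first exact: ipG_le2B.
  by rewrite opprB addrC subrK.
have h5 := le_trans (ipG_le (P - jet phi)) Pp; have h6 := le_trans (ip1_le (P - jet phi)) Pp.
have h7 : C * ip mu (partial (Ordinal N0) phi) (partial (Ordinal N0) phi) <=
    C * (2 * ipG P P + 2 * e).
  apply: ler_wpM2l => //; apply: le_trans h3 _; apply: le_trans h4 _.
  by rewrite lerD2l ler_wpM2l.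
rewrite -[(P - jet phi).1]/(P.1 - phi) in h6.
move: h1 h2 h6 h7; rewrite -/C.
move: (ip mu P.1 P.1) (ip mu phi phi) (ip mu (P.1 - phi) _) (ipG P P) => p1 p2 p3 p4.
move: (C * ip _ _ _) => p5 *; lra.
Qed.

(** A sequence with Cauchy gradients has Cauchy values by the Poincare inequality, so both
    components converge in L^2, and [V0 O] is closed for [ipH]. *)
Lemma V0_complete O : (0 < N)%N -> bounded_set O ->
  bcomplete ipG (V0 O).
Proof.
move=> N0 bO s Vs Cs; have [C [C0 HC]] := V0_poincare N0 bO.
have ss n : sqintX (s n) by case: (Vs n).
have [|f1 sf1 lim1] := @ip_complete _ _ _ mu (fun n => (s n).1) (fun n => (ss n).1).
  move=> e e0; have [n0 H] := Cs (e / (C + 1)) (divr_gt0 e0 (ltr_wpDl C0 ltr01)).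
  exists n0 => n m hn hm.
  apply: le_trans (HC _ (subspaceB (V0_subspace O) (Vs n) (Vs m))) _.
  have := H n m hn hm; rewrite ler_pdivlMr ?ltr_wpDl//.
  have := ipG_ge0 (s n - s m); move: (ipG _ _) => z; clear -C0; nra.
have Hi i : exists f, sqint mu f /\ forall e, 0 < e -> exists n0, forall n, (n0 <= n)%N ->
    ip mu ((s n).2 i - f) ((s n).2 i - f) <= e.
  have [|f sf lim] := @ip_complete _ _ _ mu (fun n => (s n).2 i) (fun n => (ss n).2 i).
    move=> e /Cs[n0 H]; exists n0 => n m hn hm; apply: le_trans (H n m hn hm).
    exact: (ip2_le (s n - s m)).
  by exists f.
have [f2 Hf2] := choice Hi.
pose P : X := (f1, f2).
have sP : sqintX P by split => // i; case: (Hf2 i).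
have limG e : 0 < e -> exists n0, forall n, (n0 <= n)%N -> ipG (s n - P) (s n - P) <= e.
  move=> e0; have eN : 0 < e / N%:R by rewrite divr_gt0// ltr0n.
  have [n0 Hn0] := choice (fun i => (Hf2 i).2 _ eN).
  exists (\max_i n0 i)%N => n hn.
  apply: (@le_trans _ _ (\sum_(i < N) e / N%:R)).
    apply: ler_sum => i _; apply: Hn0; apply: leq_trans hn.
    exact: leq_bigmax.
  rewrite sumr_const card_ord -[_ *+ N]mulr_natr divfK//.
  by rewrite pnatr_eq0 -lt0n.
exists P => //; apply: V0_closed => // e e0.
have e2 : 0 < e / 2 by rewrite divr_gt0.
have [n1 H1] := lim1 _ e2; have [n2 H2] := limG _ e2.
exists (s (maxn n1 n2)) => //; rewrite ipH_symB// /ipH.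
have := H1 _ (leq_maxl n1 n2); have := H2 _ (leq_maxr n1 n2).
rewrite -[(s _ - P).1]/((s _).1 - f1).
move: (ipG _ _) (ip _ _ _) => p q; lra.
Qed.

(** By Poincare, a difference with null gradient is null for [ipH]. This provides the separation
    hypothesis of [represents_decreasing]. *)
Lemma V0_separated O O' P Q : (0 < N)%N -> bounded_set O' -> O `<=` O' ->
  V0 O' P -> V0 O Q -> ipG (P - Q) (P - Q) = 0 -> V0 O P.
Proof.
move=> N0 bO' OO VP VQ PQ0; have [C [C0 HC]] := V0_poincare N0 bO'.
have VPQ := subspaceB (V0_subspace O') VP (V0_mono OO VQ).
apply: V0_closed; first by case: VP.
move=> e e0; exists Q => //; rewrite /ipH PQ0 addr0.
by apply: le_trans (HC _ VPQ) _; rewrite PQ0 mulr0 ltW.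
Qed.

(** The L^2 distance from P to a pair vanishing outside [O], such as a jet of a test function of
    [O], is at least the norm of P outside [O]. *)
Lemma V0_vanish O P : open O -> V0 O P ->
  {ae mu, forall x, ~ O x -> P.1 x = 0 /\ forall i, P.2 i x = 0}.
Proof.
move=> oO [sP HP]; have mO := measurableC (open_measurable_rV oO).
have key (f : T -> R) : sqint mu f ->
    (forall e, 0 < e -> exists2 g, sqint mu g /\ (forall x, ~ O x -> g x = 0) &
      ip mu (f - g) (f - g) <= e) ->
    {ae mu, forall x, ~ O x -> f x = 0}.
  move=> sf Hf; pose h x := f x * \1_(~` O) x.
  have mh : measurable_fun setT h.
    by apply: measurable_funM; [case: sf|exact: measurable_indic].
  have sh : sqint mu h.
    apply: sqintP => //; exists (fun x => f x ^+ 2) => [|x]; first by case: sf.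
    by rewrite /h indicE; case: (x \in _); rewrite ?mulr1// mulr0 expr0n sqr_ge0.
  have h0 : ip mu h h = 0.
    apply/eqP; rewrite eq_le ip_ge0 andbT; apply/ler_addgt0Pr => e /Hf[g [sg g0] fg].
    rewrite add0r; apply: le_trans fg; apply: le_Rintegral => //.
    - exact: integrable_ip.
    - by apply: integrable_ip; exact: sqintB.
    move=> x _; rewrite /h indicE; case: (boolP (x \in _)) => [/set_mem Ox|_].
      by rewrite mulr1 -[(f - g) x]/(f x - g x) g0// subr0.
    by rewrite mulr0 mul0r -expr2 sqr_ge0.
  have := ip_eq0 sh h0; apply: filterS => x /(_ I) + Ox.
  by rewrite /h indicE mem_set// mulr1.
have k1 : {ae mu, forall x, ~ O x -> P.1 x = 0}.
  apply: key => [|e /HP[phi tp Pp]]; first by case: sP.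
  exists phi; last by apply: le_trans Pp; exact: (ip1_le (P - jet phi)).
  split; first exact: test_sqint tp.
  by move=> x nO; apply: notin_supp => sx; apply: nO; case: tp => _ _; exact.
have k2 i : {ae mu, forall x, ~ O x -> P.2 i x = 0}.
  apply: key => [|e /HP[phi tp Pp]]; first by case: sP.
  exists (partial i phi).
    split; first exact: test_sqint (test_partial i tp).
    move=> x nO; apply: notin_supp => sx; apply: nO.
    by case: (test_partial i tp) => _ _; exact.
  apply: le_trans Pp; apply: le_trans (ipG_le _).
  exact: (ip2_le (P - jet phi) i).
have k2' : {ae mu, forall x, forall n : nat, forall nN : (n < N)%N,
    ~ O x -> P.2 (Ordinal nN) x = 0}.
  apply: ae_foralln => n; have [nN|nN] := pselect (n < N)%N; last first.
    by apply: aeW => x nN'; case: nN.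
  by apply: filterS (k2 (Ordinal nN)) => x H nN'; rewrite (bool_irrelevance nN' nN).
apply: filterS2 k1 k2' => x H1 H2 nO; split; first exact: H1.
by move=> [n nN]; exact: H2.
Qed.

(** Here psi need not be supported in [O]: extension by zero creates no boundary term, and [P.2] is
    the gradient of [P.1] across the boundary of [O]. The identity holds for jets and passes to the
    limit. *)
Lemma V0_by_parts O P psi i : V0 O P -> test_function setT psi ->
  ip mu P.1 (partial i psi) = - ip mu (P.2 i) psi.
Proof.
move=> [sP HP] tpsi; have [sP1 sP2] := sP.
have sps := test_sqint tpsi; have sdps := test_sqint (test_partial i tpsi).
apply/eqP; rewrite -addr_eq0; apply/eqP.
pose K := ip mu (partial i psi) (partial i psi) + ip mu psi psi.
have K0 : 0 <= K by rewrite addr_ge0 ?ip_ge0.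
suff H : (ip mu P.1 (partial i psi) + ip mu (P.2 i) psi) ^+ 2 <= 0.
  by apply/eqP; rewrite -sqrf_eq0 eq_le H sqr_ge0.
apply: (@limit_le _ _ (2 * K)); first by rewrite mulr_ge0.
move=> e /HP[phi tp Pp].
have sphi := test_sqint tp; have sdphi := test_sqint (test_partial i tp).
have byp : ip mu phi (partial i psi) + ip mu (partial i phi) psi = 0.
  rewrite -(Rintegral_partial i (test_mull (test_smooth tp) tpsi)).
  rewrite partialM; try by move=> x; apply: smooth_diff; exact: test_smooth tp.
    rewrite /ip -RintegralD//; try exact: integrable_ip.
    by apply: eq_Rintegral => x _; rewrite addrC.
  by move=> x; apply: smooth_diff; exact: test_smooth tpsi.
have B1 (f g h : T -> R) : sqint mu f -> sqint mu g -> sqint mu h ->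
    ip mu (f - g) h = ip mu f h - ip mu g h.
  exact: (formBl (@ip_linl _ _ _ mu)).
have c1 := ip_cs (sqintB sP1 sphi) sdps; have c2 := ip_cs (sqintB (sP2 i) sdphi) sps.
have d1 : ip mu (P.1 - phi) (P.1 - phi) <= e.
  by apply: le_trans Pp; exact: (ip1_le (P - jet phi)).
have d2 : ip mu (P.2 i - partial i phi) (P.2 i - partial i phi) <= e.
  by apply: le_trans Pp; apply: le_trans (ipG_le _); exact: (ip2_le (P - jet phi) i).
have -> : ip mu P.1 (partial i psi) + ip mu (P.2 i) psi =
    ip mu (P.1 - phi) (partial i psi) + ip mu (P.2 i - partial i phi) psi.
  by rewrite !B1// addrACA -opprD byp subr0.
move: c1 c2 d1 d2 (ip_ge0 mu (P.1 - phi)) (ip_ge0 mu (P.2 i - partial i phi)).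
move: (ip_ge0 mu psi) (ip_ge0 mu (partial i psi)); rewrite /K.
move: (ip mu psi psi) (ip mu (partial i psi) (partial i psi)) => a b.
move: (ip mu (P.1 - phi) (P.1 - phi)) (ip mu (P.2 i - partial i phi) (P.2 i - _)) => p q.
move: (ip mu (P.1 - phi) _) (ip mu (P.2 i - _) _) => y z a0 b0 c1 c2 d1 d2 p0 q0.
have yb : y ^+ 2 <= e * b by apply: le_trans c1 _; rewrite ler_wpM2r.
have za : z ^+ 2 <= e * a by apply: le_trans c2 _; rewrite ler_wpM2r.
have := sqr_ge0 (y - z); rewrite add0r; move: yb za; clear; nra.
Qed.

End zero_trace_pairs.

(** * Translation between Sobolev functions on a domain and pairs *)

Section sobolev_pairs.
Context (R : realType) (N : nat).
Local Notation T := 'rV[R]_N.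
Local Notation mu := (leb R N).
Local Notation X := ((T -> R) * ('I_N -> T -> R))%type.
Implicit Types (P Q : X) (f g u v phi psi chi : T -> R) (O : set T) (i : 'I_N).

Lemma restrict_in O f x : O x -> (f \_ O) x = f x.
Proof. by move=> Ox; rewrite patchE mem_set. Qed.

Lemma restrict_out O f x : ~ O x -> (f \_ O) x = 0.
Proof. by move=> Ox; rewrite patchE memNset. Qed.

Lemma restrict_lin O (a : R) f g : (a *: f + g) \_ O = a *: (f \_ O) + g \_ O.
Proof.
apply/funext => x; rewrite -[RHS]/(a * (f \_ O) x + (g \_ O) x) !patchE.
by case: ifP => // _; rewrite mulr0 addr0.
Qed.

Lemma restrict_test O phi : test_function O phi -> phi \_ O = phi.
Proof.
move=> [_ _ sO]; apply/funext => x; rewrite patchE; case: ifPn => // nO.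
by rewrite notin_supp// => /sO Ox; rewrite mem_set in nO.
Qed.

Lemma L2_sqint O u : open O -> L2 O u <-> sqint mu (u \_ O).
Proof.
move=> /open_measurable_rV mO.
have E : (\int[mu]_(x in O) (u x ^+ 2)%:E = \int[mu]_x ((u \_ O) x ^+ 2)%:E)%E.
  rewrite integral_mkcond; apply: eq_integral => x _; rewrite !patchE.
  by case: ifP => // _; rewrite expr0n.
split=> [[mu_ uy]|[mu_ iu]].
  apply: sqint_ltP; last by rewrite -E.
  exact/(measurable_restrictT _ mO).
split; first exact/(measurable_restrictT _ mO).
by rewrite E (ipE (conj mu_ iu)) ltry.
Qed.

Lemma Rintegral_ip O f g :
  \int[mu]_(x in O) (f x * g x) = ip mu (f \_ O) (g \_ O).
Proof.
rewrite Rintegral_mkcond; apply: eq_Rintegral => x _; rewrite !patchE.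
by case: ifP => // _; rewrite mulr0.
Qed.

Lemma sqint_restrict O f : open O -> sqint mu f -> sqint mu (f \_ O).
Proof.
move=> /open_measurable_rV mO [mf if2]; apply: sqintP.
  by apply/(measurable_restrictT _ mO); exact: measurable_funTS.
exists (fun x => f x ^+ 2) => // x.
by rewrite patchE; case: ifP => // _; rewrite expr0n sqr_ge0.
Qed.

Lemma is_wpartialP O i u g : is_wpartial O i u g <->
  forall phi, test_function O phi -> ip mu (u \_ O) (partial i phi) = - ip mu (g \_ O) phi.
Proof.
by split => H phi tp; have := H phi tp; rewrite !Rintegral_ip;
  rewrite (restrict_test tp) (restrict_test (test_partial i tp)).
Qed.

Lemma test_laplacian O phi : test_function O phi -> test_function O (laplacian phi).
Proof.
move=> tp.
rewrite (_ : laplacian phi = \sum_(i < N) partial i (partial i phi)); last first.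
  by apply/funext => x; rewrite fct_sumE.
apply: (big_ind (test_function O)); first exact: test0.
  by move=> f g tf tg; rewrite -[f]scale1r; exact: test_lin.
by move=> i _; exact/test_partial/test_partial.
Qed.

Lemma is_wlapP O u g : is_wlap O u g <->
  forall phi, test_function O phi -> ip mu (u \_ O) (laplacian phi) = ip mu (g \_ O) phi.
Proof.
by split => H phi tp; have := H phi tp; rewrite !Rintegral_ip;
  rewrite (restrict_test tp) (restrict_test (test_laplacian tp)).
Qed.

Lemma ipBl f g h : sqint mu f -> sqint mu g -> sqint mu h ->
  ip mu (f - g) h = ip mu f h - ip mu g h.
Proof. exact: (formBl (@ip_linl _ _ _ mu)). Qed.

Lemma ip_test_ae O g g' : open O -> sqint mu g -> sqint mu g' ->
  (forall phi, test_function O phi -> ip mu g phi = ip mu g' phi) ->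
  {ae mu, forall x, O x -> g x = g' x}.
Proof.
move=> oO sg sg' H.
have := @fundamental_lemma R N O (g - g') oO.
have sB := sqintB sg sg'.
move=> /(_ (fun phi tp => integrable_ip sB (test_sqint tp))).
have H' phi : test_function O phi -> \int[mu]_x ((g - g') x * phi x) = 0.
  move=> tp; rewrite -[LHS]/(ip mu (g - g') phi) ipBl ?H ?subrr//.
  exact: test_sqint tp.
move=> /(_ H'); apply: filterS => x Hx /Hx.
by rewrite -[(g - g') x]/(g x - g' x) => /eqP; rewrite subr_eq0 => /eqP.
Qed.

(* u and its weak gradient in O, extended by zero; this pair is in general not
   made of a function and its weak gradient across the boundary. *)
Definition pr O u : X := (u \_ O, fun i => (wpartial O i u) \_ O).

Lemma wpartialP O i u : H1 O u ->
  L2 O (wpartial O i u) /\ is_wpartial O i u (wpartial O i u).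
Proof.
by move=> [_ /(_ i) [g Hg]]; apply: (@getPex _ [set g | L2 O g /\ is_wpartial O i u g]); exists g.
Qed.

Lemma wlapP O u : HLap O u -> L2 O (wlap O u) /\ is_wlap O u (wlap O u).
Proof.
by move=> [_ [g Hg]]; apply: (@getPex _ [set g | L2 O g /\ is_wlap O u g]); exists g.
Qed.

Lemma sqintX_pr O u : open O -> H1 O u -> sqintX (pr O u).
Proof.
move=> oO Hu; split=> [|i]; first by apply/L2_sqint => //; case: Hu.
by apply/(L2_sqint _ oO); have [] := wpartialP i Hu.
Qed.

Lemma ip_restrict_test O f phi : test_function O phi ->
  ip mu (f \_ O) phi = ip mu f phi.
Proof.
move=> tp; rewrite -{1}(restrict_test tp) -Rintegral_ip Rintegral_mkcond.
apply: eq_Rintegral => x _; rewrite patchE; case: ifPn => // nO.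
rewrite (@notin_supp _ _ phi) ?mulr0//; case: tp => _ _ sO /sO Ox.
by rewrite mem_set in nO.
Qed.

(** [wpartial] is an arbitrary choice, so it can be identified with a known candidate almost
    everywhere only, through the fundamental lemma. *)
Lemma H1_intro O f (G : 'I_N -> T -> R) : open O -> L2 O f ->
  (forall i, sqint mu (G i)) ->
  (forall i phi, test_function O phi ->
    ip mu (f \_ O) (partial i phi) = - ip mu (G i) phi) ->
  H1 O f /\ forall i, {ae mu, forall x, O x -> wpartial O i f x = G i x}.
Proof.
move=> oO Lf sG HG.
have sGO i : sqint mu (G i \_ O) by exact: sqint_restrict.
have LG i : L2 O (G i) by apply/L2_sqint.
have GO i phi (tp : test_function O phi) := ip_restrict_test (G i) tp.
have wG i : is_wpartial O i f (G i).
  by apply/is_wpartialP => phi tp; rewrite HG// GO.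
have Hf : H1 O f by split => // i; exists (G i).
split => // i; have [Lw /is_wpartialP Hw] := wpartialP i Hf.
have sw : sqint mu (wpartial O i f \_ O) by apply/L2_sqint.
have := ip_test_ae oO sw (sG i).
move=> H; have {}H := H (fun phi tp => oppr_inj (etrans (esym (Hw phi tp)) (HG i phi tp))).
by apply: filterS H => x Hx Ox; rewrite -Hx// restrict_in.
Qed.

Definition aeX P Q := ae_eq mu setT P.1 Q.1 /\ forall i, ae_eq mu setT (P.2 i) (Q.2 i).

Lemma aeX_sym P Q : aeX P Q -> aeX Q P.
Proof.
by move=> [h1 h2]; split=> [|i]; [apply: filterS h1|apply: filterS (h2 i)] => x /= H xT;
  rewrite H.
Qed.

Lemma aeX_ipG P Q U : sqintX P -> sqintX Q -> sqintX U -> aeX P Q -> ipG P U = ipG Q U.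
Proof.
move=> [_ P2] [_ Q2] [_ U2] [_ H]; apply: eq_bigr => i _; apply: ip_ae => //.
exact: aeW.
Qed.

Lemma aeX_ipH P Q U : sqintX P -> sqintX Q -> sqintX U -> aeX P Q -> ipH P U = ipH Q U.
Proof.
move=> sP sQ sU PQ; rewrite /ipH (aeX_ipG sP sQ sU PQ); congr (_ + _).
by apply: ip_ae; [case: sP|case: sQ|case: sU|case: sU|case: PQ|exact: aeW].
Qed.

Lemma aeX_lin (a : R) P P' Q Q' : aeX P P' -> aeX Q Q' -> aeX (a *: P + Q) (a *: P' + Q').
Proof.
move=> [p1 p2] [q1 q2]; split=> [|i].
  apply: filterS2 p1 q1 => x /= H1 H2 xT.
  by rewrite -[LHS]/(a * P.1 x + Q.1 x) H1// H2.
apply: filterS2 (p2 i) (q2 i) => x /= H1 H2 xT.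
by rewrite -[LHS]/(a * P.2 i x + Q.2 i x) H1// H2.
Qed.

(** Recognises a pair on the whole space as [pr O f] up to null sets; linearity, restriction and
    test functions are all treated by exhibiting the expected pair. *)
Lemma H1_pr O (P : X) f : open O -> sqintX P -> (forall x, ~ O x -> P.1 x = 0) ->
  {in O, f =1 P.1} ->
  (forall i, {ae mu, forall x, ~ O x -> P.2 i x = 0}) ->
  (forall i phi, test_function O phi -> ip mu P.1 (partial i phi) = - ip mu (P.2 i) phi) ->
  H1 O f /\ aeX (pr O f) P.
Proof.
move=> oO [sP1 sP2] P10 fP P20 HP.
have fE : f \_ O = P.1.
  apply/funext => x; rewrite patchE; case: ifPn => [/fP//|nO].
  by rewrite P10// => Ox; rewrite mem_set in nO.
have Lf : L2 O f by apply/L2_sqint => //; rewrite fE.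
have [|Hf wf] := H1_intro oO Lf sP2; first by move=> i phi tp; rewrite fE; exact: HP.
split => //; split=> [|i]; first by rewrite /= fE; exact: aeW.
apply: filterS2 (wf i) (P20 i) => x w p _ /=.
have [Ox|nO] := pselect (O x); first by rewrite restrict_in// w.
by rewrite restrict_out// p.
Qed.

Lemma pr_by_parts O u i phi : open O -> H1 O u -> test_function O phi ->
  ip mu (pr O u).1 (partial i phi) = - ip mu ((pr O u).2 i) phi.
Proof. by move=> oO /(wpartialP i)[_ /is_wpartialP]; apply. Qed.

Lemma H1_lin O (a : R) u v : open O -> H1 O u -> H1 O v ->
  H1 O (a *: u + v) /\ aeX (pr O (a *: u + v)) (a *: pr O u + pr O v).
Proof.
move=> oO Hu Hv; have [su sv] := (sqintX_pr oO Hu, sqintX_pr oO Hv).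
have E x : ~ O x -> (a *: pr O u + pr O v).1 x = 0.
  move=> nO; rewrite -[LHS]/(a * (u \_ O) x + (v \_ O) x).
  by rewrite !restrict_out// mulr0 addr0.
apply: (H1_pr oO (sqintX_lin a su sv) E).
- move=> x /set_mem Ox; rewrite -[RHS]/(a * (u \_ O) x + (v \_ O) x).
  by rewrite !restrict_in.
- move=> i; apply: aeW => x nO.
  rewrite -[LHS]/(a * (pr O u).2 i x + (pr O v).2 i x) /=.
  by rewrite !restrict_out// mulr0 addr0.
- move=> i phi tp; have sphi := test_sqint tp; have sd := test_sqint (test_partial i tp).
  rewrite [LHS](ip_linl a (proj1 su) (proj1 sv) sd).
  rewrite [X in - X](ip_linl a (proj2 su i) (proj2 sv i) sphi).
  by rewrite !pr_by_parts// opprD mulrN.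
Qed.

Lemma H1_restrict O O' u : open O -> open O' -> O `<=` O' -> H1 O' u ->
  H1 O u /\ aeX (pr O u) ((pr O' u).1 \_ O, fun i => (pr O' u).2 i \_ O).
Proof.
move=> oO oO' OO Hu; have su := sqintX_pr oO' Hu.
have ipres f phi (tp : test_function O phi) := ip_restrict_test f tp.
apply: H1_pr => //.
- by split=> [|i]; apply: sqint_restrict => //; [case: su|case: su].
- by move=> x nO; exact: restrict_out.
- by move=> x /set_mem Ox /=; rewrite !restrict_in//; exact: OO.
- by move=> i; apply: aeW => x nO; exact: restrict_out.
- move=> i phi tp; rewrite /= !ipres//; last exact: test_partial.
  by apply: pr_by_parts => //; exact: test_functionW tp.
Qed.

Lemma H1_test O phi : open O -> test_function O phi ->
  H1 O phi /\ aeX (pr O phi) (jet phi).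
Proof.
move=> oO tp; have sO x : supp phi x -> O x by case: tp => _ _; exact.
have sj := sqintX_jet tp.
apply: H1_pr => //.
- by move=> x nO; apply: notin_supp => /sO.
- move=> i; apply: aeW => x nO; apply: notin_supp.
  by case: (test_partial i tp) => _ _ h /h.
- by move=> i psi tpsi; apply: (V0_by_parts i (V0_jet tp)); apply: test_functionW tpsi.
Qed.

Lemma aeX_refl P : aeX P P.
Proof. by split=> [|i]; exact: aeW. Qed.

Lemma aeX_trans Q P U : aeX P Q -> aeX Q U -> aeX P U.
Proof.
move=> [p1 p2] [q1 q2]; split=> [|i].
  by apply: filterS2 p1 q1 => x /= H1 H2 xT; rewrite H1// H2.
by apply: filterS2 (p2 i) (q2 i) => x /= H1 H2 xT; rewrite H1// H2.
Qed.

Lemma aeX_ipHH P Q : sqintX P -> sqintX Q -> aeX P Q -> ipH P P = ipH Q Q.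
Proof.
by move=> sP sQ PQ; rewrite (aeX_ipH sP sQ sP PQ) ipHC (aeX_ipH sP sQ sQ PQ).
Qed.

Lemma Rintegral_sum (F : 'I_N -> T -> R) (s : seq 'I_N) :
  (forall i, mu.-integrable setT (EFin \o F i)) ->
  mu.-integrable setT (EFin \o (fun x => \sum_(i <- s) F i x)) /\
  \int[mu]_x (\sum_(i <- s) F i x) = \sum_(i <- s) \int[mu]_x F i x.
Proof.
move=> iF; elim: s => [|i s [IH1 IH2]].
  rewrite big_nil; split.
    by under eq_fun do rewrite big_nil; exact: integrable0.
  by under eq_Rintegral do rewrite big_nil; rewrite Rintegral_cst// mul0r.
rewrite big_cons -IH2 -RintegralD//; split.
  by under eq_fun do rewrite big_cons; exact: integrable_EFinD.
by under eq_Rintegral do rewrite big_cons.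
Qed.

Lemma integral_ipH O f g u v : open O -> L2 O f -> L2 O g -> H1 O u -> H1 O v ->
  \int[mu]_(x in O) (f x * g x + grad_dot O u v x) =
  ip mu (f \_ O) (g \_ O) + ipG (pr O u) (pr O v).
Proof.
move=> oO /(L2_sqint _ oO) sf /(L2_sqint _ oO) sg Hu Hv.
have [_ su] := sqintX_pr oO Hu; have [_ sv] := sqintX_pr oO Hv.
have [i1 i2] := Rintegral_sum (index_enum 'I_N)
  (fun i => integrable_ip (su i) (sv i)).
rewrite /ipG /ip -i2 -RintegralD//; last exact: integrable_ip.
rewrite Rintegral_mkcond; apply: eq_Rintegral => x _.
rewrite patchE /=; have [xO|xO] := boolP (x \in O).
  rewrite !patchE xO; congr (_ + _); apply: eq_bigr => i _.
  by rewrite !patchE xO.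
rewrite !patchE (negbTE xO) mul0r add0r big1// => i _.
by rewrite !patchE (negbTE xO) mul0r.
Qed.

Lemma H1normE O u : open O -> H1 O u -> H1norm O u = Num.sqrt (ipH (pr O u) (pr O u)).
Proof.
move=> oO Hu; rewrite /H1norm; congr Num.sqrt.
by rewrite /ipH -integral_ipH//; case: Hu.
Qed.

Lemma H1B O u v : open O -> H1 O u -> H1 O v ->
  H1 O (u - v) /\ aeX (pr O (u - v)) (pr O u - pr O v).
Proof.
move=> oO Hu Hv; have := H1_lin (-1) oO Hv Hu.
by rewrite !scaleN1r ![- _ + _]addrC.
Qed.

Lemma aeXB P P' Q Q' : aeX P P' -> aeX Q Q' -> aeX (P - Q) (P' - Q').
Proof.
move=> PP QQ; have := aeX_lin (-1) QQ PP.
by rewrite !scaleN1r ![- _ + _]addrC.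
Qed.

Lemma ipH_pr_test O u phi : open O -> H1 O u -> test_function O phi ->
  H1 O (u - phi) /\ ipH (pr O (u - phi)) (pr O (u - phi)) =
  ipH (pr O u - jet phi) (pr O u - jet phi).
Proof.
move=> oO Hu tp; have [Hphi aphi] := H1_test oO tp.
have [HB aB] := H1B oO Hu Hphi; split => //; apply: aeX_ipHH.
- exact: sqintX_pr.
- by apply: sqintXB; [exact: sqintX_pr|exact: sqintX_jet tp].
- apply: aeX_trans aB _; apply: aeXB => //; exact: aeX_refl.
Qed.

Lemma H10_V0 O u : open O -> H10 O u -> V0 O (pr O u).
Proof.
move=> oO [Hu Hap]; split; first exact: sqintX_pr.
move=> e e0; have se : 0 < Num.sqrt e by rewrite sqrtr_gt0.
have [phi [tp Hphi]] := Hap _ se; exists phi => //.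
have [HB <-] := ipH_pr_test oO Hu tp; move: Hphi.
by rewrite H1normE// ltr_sqrt// => /ltW.
Qed.

(** Together with [H10_V0], this identifies [H10 O] with [V0 O] up to null sets. *)
Lemma V0_H10 O P : open O -> V0 O P -> H10 O P.1 /\ aeX (pr O P.1) P.
Proof.
move=> oO VP; have [sP HP] := VP; have [sP1 sP2] := sP.
have van := V0_vanish oO VP.
(* [P.1] vanishes outside [O] almost everywhere, whereas [H1_pr] asks for it everywhere. *)
pose P' : X := (P.1 \_ O, P.2).
have P'P : aeX P' P.
  split=> [|i]; last exact: aeW.
  apply: filterS van => x vx _ /=; have [Ox|nO] := pselect (O x).
    by rewrite restrict_in.
  by rewrite restrict_out//; have [->] := vx nO.
have sP' : sqintX P'.
  by split => //; exact: sqint_restrict.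
have [|x /set_mem Ox|i|i phi tp|HP1 aP1] := @H1_pr O P' P.1 oO sP'.
- by move=> x nO; exact: restrict_out.
- by rewrite /= restrict_in.
- by apply: filterS van => x vx /vx[_]; apply.
- rewrite /= ip_restrict_test; last exact: test_partial.
  by apply: (V0_by_parts i VP); apply: test_functionW tp.
have aP : aeX (pr O P.1) P by exact: aeX_trans aP1 P'P.
split => //; split => // e e0.
have e4 : 0 < (e / 2) ^+ 2 by rewrite exprn_gt0// divr_gt0.
have [phi tp Pp] := HP _ e4; exists phi; split => //.
have [HB E] := ipH_pr_test oO HP1 tp.
rewrite H1normE// E.
rewrite (@aeX_ipHH _ (P - jet phi)).
- apply: (@le_lt_trans _ _ (Num.sqrt ((e / 2) ^+ 2))); first by rewrite ler_wsqrtr.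
  by rewrite sqrtr_sqr ger0_norm ?divr_ge0 ?ltW//; lra.
- by apply: sqintXB; [exact: sqintX_pr|exact: sqintX_jet tp].
- by apply: sqintXB => //; exact: sqintX_jet tp.
- by apply: aeXB => //; exact: aeX_refl.
Qed.

End sobolev_pairs.

(** * The Navier problem as a cascade of two Dirichlet problems *)

Section navier.
Context (R : realType) (N : nat).
Local Notation T := 'rV[R]_N.
Local Notation mu := (leb R N).
Local Notation X := ((T -> R) * ('I_N -> T -> R))%type.
Implicit Types (P Q G Z U K : X) (f g u v phi psi : T -> R) (O : set T) (i : 'I_N).

Lemma ip_lapr O f phi : sqint mu f -> test_function O phi ->
  ip mu f (laplacian phi) = \sum_(i < N) ip mu f (partial i (partial i phi)).
Proof.
move=> sf tp; have H i := integrable_ip sf (test_sqint (test_partial i (test_partial i tp))).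
have [_ <-] := Rintegral_sum (index_enum 'I_N) H.
by apply: eq_Rintegral => x _; rewrite /laplacian mulr_sumr.
Qed.

Lemma V0_orth O K P : sqintX K -> (forall phi, test_function O phi -> ipH (jet phi) K = 0) ->
  V0 O P -> ipH P K = 0.
Proof.
move=> sK HK [sP HP]; apply/eqP; rewrite -sqrf_eq0 eq_le sqr_ge0 andbT.
apply: (@limit_le _ _ _ (ipH K K)) => [|e /HP[phi tp Pp]]; first exact: ipH_ge0.
have sj := sqintX_jet tp; rewrite add0r.
have -> : ipH P K = ipH (P - jet phi) K.
  by rewrite (formBl (@ipHL R N))// HK// subr0.
apply: le_trans (ipH_cs (sqintXB sP sj) sK) _.
by rewrite mulrC ler_wpM2l// ipH_ge0.
Qed.

(** Orthogonality of the pair (g, grad phi) to [V0 O] for [ipH]. By density jets of test functions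
    suffice, and there the weak Laplacian and the weak gradient of phi cancel by definition. *)
Lemma green O P phi g : open O -> V0 O P -> H1 O phi -> L2 O g -> is_wlap O phi g ->
  ip mu P.1 (g \_ O) = - ipG P (pr O phi).
Proof.
move=> oO VP Hphi /(L2_sqint _ oO) sg /is_wlapP Hg.
have sphi := sqintX_pr oO Hphi.
pose K : X := (g \_ O, (pr O phi).2).
have sK : sqintX K by split => // i; exact: (proj2 sphi i).
apply/eqP; rewrite -addr_eq0; apply/eqP; rewrite -[LHS]/(ipH P K).
apply: (V0_orth sK) VP => psi tp; rewrite /ipH /= ipC -Hg//.
rewrite (ip_lapr (proj1 sphi) tp) /ipG -big_split big1// => i _ /=.
rewrite pr_by_parts//; last exact: test_partial.
by rewrite [X in _ + X]ipC addNr.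
Qed.

Lemma ip_ae_on O f f' g : open O -> sqint mu (f \_ O) -> sqint mu f' -> sqint mu (g \_ O) ->
  {ae mu, forall x, O x -> f x = f' x} -> ip mu (f \_ O) (g \_ O) = ip mu f' (g \_ O).
Proof.
move=> oO sf sf' sg ff'; congr fine; apply: ae_eq_integral => //.
- by apply/measurable_EFinP; apply: measurable_funM; [case: sf|case: sg].
- by apply/measurable_EFinP; apply: measurable_funM; [case: sf'|case: sg].
apply: filterS ff' => x H _ /=.
have [Ox|nO] := pselect (O x); first by rewrite !restrict_in// H.
by rewrite [(g \_ O) x]restrict_out// !mulr0.
Qed.

(* The Navier problem with datum G splits into two Dirichlet problems: Z is the
   H^1_0 part of G, so that G.1 - Z.1 is the harmonic function equal to G.1 on
   the boundary, and U.1 in H^1_0 has Laplacian G.1 - Z.1. *)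
Definition nav_data O G Z U :=
  represents (@ipG R N) (V0 O) (ipG G) Z /\
  represents (@ipG R N) (V0 O) (fun P => - ip mu (G.1 - Z.1) P.1) U.

(* (Delta u, grad u): its H^1 pairing with v is <N(f), v>. *)
Definition nav_pair G Z U : X := (G.1 - Z.1, U.2).

Lemma V0_sq O P : V0 O P -> sqintX P. Proof. by case. Qed.

Lemma represents_dir O G : (0 < N)%N -> bounded_set O -> sqintX G ->
  exists Z, represents (@ipG R N) (V0 O) (ipG G) Z.
Proof.
move=> N0 bO sG.
apply: (riesz (@sqintX_lin R N) (@ipGC R N) (@ipGL R N) (@ipG_ge0 R N)
  (V0_subspace O) (V0_complete N0 bO) _ (ipG_ge0 G)).
  move=> a u v /V0_sq su /V0_sq sv.
  by rewrite ipGC ipGL// [ipG u _]ipGC [ipG v _]ipGC.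
by move=> u /V0_sq su; exact: ipG_cs.
Qed.

Lemma represents_src O f : (0 < N)%N -> bounded_set O -> sqint mu f ->
  exists U, represents (@ipG R N) (V0 O) (fun P => - ip mu f P.1) U.
Proof.
move=> N0 bO sf; have [C [C0 HC]] := V0_poincare N0 bO.
apply: (riesz (@sqintX_lin R N) (@ipGC R N) (@ipGL R N) (@ipG_ge0 R N)
  (V0_subspace O) (V0_complete N0 bO) _ (_ : 0 <= ip mu f f * C)).
- move=> a u v /V0_sq[su _] /V0_sq[sv _].
  rewrite ipC (ip_linl a su sv sf) [ip mu u.1 _]ipC [ip mu v.1 _]ipC; ring.
- by rewrite mulr_ge0 ?ip_ge0.
move=> u Vu; rewrite sqrrN; have [su _] := V0_sq Vu.
apply: le_trans (ip_cs sf su) _; rewrite -mulrA ler_wpM2l ?ip_ge0//; exact: HC.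
Qed.

Lemma nav_data_exists O G : (0 < N)%N -> bounded_set O -> sqintX G ->
  exists Z U, nav_data O G Z U.
Proof.
move=> N0 bO sG; have [Z HZ] := represents_dir N0 bO sG.
have [sZ _] := V0_sq HZ.1; have [sG1 _] := sG.
have [U HU] := represents_src N0 bO (sqintB sG1 sZ).
by exists Z, U.
Qed.

Lemma nav_data_lin O (a : R) G G' Z Z' U U' : sqintX G -> sqintX G' ->
  nav_data O G Z U -> nav_data O G' Z' U' ->
  nav_data O (a *: G + G') (a *: Z + Z') (a *: U + U').
Proof.
move=> sG sG' [HZ HU] [HZ' HU'].
have [V1 E1] := represents_lin (@ipGL R N) a (V0_subspace O) HZ HZ'.
have [V2 E2] := represents_lin (@ipGL R N) a (V0_subspace O) HU HU'.
split; split => // P VP; have sP := V0_sq VP; first by rewrite E1// ipGL.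
have [[sZ _] [sZ' _]] := (V0_sq HZ.1, V0_sq HZ'.1); have [[s1 _] [s2 _]] := (sG, sG').
rewrite E2// -[(a *: G + G').1]/(a *: G.1 + G'.1) -[(a *: Z + Z').1]/(a *: Z.1 + Z'.1).
have -> : a *: G.1 + G'.1 - (a *: Z.1 + Z'.1) = a *: (G.1 - Z.1) + (G'.1 - Z'.1).
  by rewrite scalerBr opprD addrACA.
rewrite (ip_linl a (sqintB s1 sZ) (sqintB s2 sZ') (proj1 sP)); ring.
Qed.

Lemma nav_data_ae O G G' Z U : sqintX G -> sqintX G' -> aeX G G' ->
  nav_data O G Z U -> nav_data O G' Z U.
Proof.
move=> sG sG' GG [[VZ HZ] [VU HU]]; split; split => // P VP; have sP := V0_sq VP.
  by rewrite HZ//; exact: aeX_ipG.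
have [sZ _] := V0_sq VZ; rewrite HU//; congr (- _); apply: ip_ae.
- by apply: sqintB => //; case: sG.
- by apply: sqintB => //; case: sG'.
- by case: sP.
- by case: sP.
- case: GG => + _; apply: filterS => x /= H xT.
  by rewrite -[LHS]/(G.1 x - Z.1 x) H.
- exact: aeW.
Qed.

Lemma nav_pair_sq O G Z U : sqintX G -> nav_data O G Z U -> sqintX (nav_pair G Z U).
Proof.
move=> [sG _] [[/V0_sq[sZ _] _] [/V0_sq[_ sU] _]].
by split => //=; exact: sqintB.
Qed.

(** With C the Poincare constant, 2 + 2 C bounds the squared norm of G.1 - Z.1, and the factor 1 + C
    adds the gradient of U, whose source is that function. *)
Lemma nav_pair_bound O : (0 < N)%N -> bounded_set O -> exists C : R, 0 <= C /\
  forall G Z U, sqintX G -> nav_data O G Z U ->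
    ipH (nav_pair G Z U) (nav_pair G Z U) <= C * ipH G G.
Proof.
move=> N0 bO; have [C [C0 HC]] := V0_poincare N0 bO.
exists ((1 + C) * (2 + 2 * C)); split; first by nra.
move=> G Z U sG [[VZ HZ] [VU HU]].
have [sZ sU] := (V0_sq VZ, V0_sq VU).
have [[sG1 _] [sZ1 _]] := (sG, sZ).
have bZ : ipG Z Z <= ipG G G.
  apply: le_of_sqr_le; rewrite ?ipG_ge0// {1}HZ//; exact: ipG_cs.
have bZ1 : ip mu Z.1 Z.1 <= C * ipG G G.
  by apply: le_trans (HC _ VZ) _; rewrite ler_wpM2l.
set W := G.1 - Z.1; have sW : sqint mu W by exact: sqintB.
have bW : ip mu W W <= (2 + 2 * C) * ipH G G.
  have : ip mu W W <= 2 * ip mu G.1 G.1 + 2 * ip mu Z.1 Z.1.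
    exact: (form_le2B (@sqint_lin _ _ _ mu) (@ipC _ _ _ mu) (@ip_linl _ _ _ mu) (@ip_ge0 _ _ _ mu)).
  rewrite /ipH; have := ip_ge0 mu G.1; have := ipG_ge0 G; move: bZ1 C0.
  move: (ip mu W W) (ip mu G.1 _) (ip mu Z.1 _) (ipG G G) => w p q r; clear; nra.
have bU : ipG U U <= ip mu W W * C.
  apply: le_of_sqr_le; rewrite ?ipG_ge0 ?mulr_ge0 ?ip_ge0//.
  rewrite {1}HU// sqrrN; apply: le_trans (ip_cs sW (proj1 sU)) _.
  by rewrite -mulrA ler_wpM2l ?ip_ge0//; exact: HC.
rewrite -[X in X <= _]/(ip mu W W + ipG U U).
move: bW bU C0; move: (ip mu W W) (ipG U U) (ipH G G) => w p q; clear; nra.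
Qed.

(** As Delta u = f - Z in [O], the weak equation reduces to the equality of - ip Z.1 (Delta phi)
    with [ipG] of f and phi: Green's formula turns the former into [ipG] of Z and phi, and Z is the
    projection of f. *)
Lemma nav_solution O f Z U : open O -> H1 O f -> nav_data O (pr O f) Z U ->
  navier_solution O f U.1 /\ {ae mu, forall x, O x -> wlap O U.1 x = f x - Z.1 x}.
Proof.
move=> oO Hf [[VZ HZ] [VU HU]].
have [HU10 aU] := V0_H10 oO VU; have sf := sqintX_pr oO Hf.
have [[sZ1 _] sU] := (V0_sq VZ, V0_sq VU); have sU' := sqintX_pr oO HU10.1.
have [sf1 _] := sf.
pose W := (pr O f).1 - Z.1; have sW : sqint mu W by exact: sqintB.
have lapU phi : test_function O phi -> ip mu (U.1 \_ O) (laplacian phi) = ip mu W phi.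
  move=> tp; rewrite (ip_lapr (proj1 sU') tp).
  have := HU _ (V0_jet tp); rewrite /= -/W => /(congr1 -%R); rewrite opprK => <-.
  rewrite -sumrN; apply: eq_bigr => i _.
  rewrite (ip_restrict_test _ (test_partial i (test_partial i tp))).
  by apply: (V0_by_parts i VU); apply: test_functionW (test_partial i tp).
have LW : L2 O W by apply/L2_sqint => //; exact: sqint_restrict.
have wlU : is_wlap O U.1 W.
  by apply/is_wlapP => phi tp; rewrite lapU// ip_restrict_test.
have HLU : HLap O U.1 by split; [case: HU10 => -[]|exists W].
have [Ll /is_wlapP Hl] := wlapP HLU.
have sl : sqint mu (wlap O U.1 \_ O) by apply/L2_sqint.
have aew : {ae mu, forall x, O x -> wlap O U.1 x = f x - Z.1 x}.
  have := ip_test_ae oO sl sW => /(_ (fun phi tp => etrans (esym (Hl phi tp)) (lapU phi tp))).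
  apply: filterS => x H Ox; move: (H Ox); rewrite restrict_in// => ->.
  by rewrite -[LHS]/((f \_ O) x - Z.1 x) restrict_in.
split => //; split => // phi HLphi H10phi.
have [Lphi wphi] := wlapP HLphi; have Hphi := H10phi.1.
have sphi := sqintX_pr oO Hphi.
have slphi : sqint mu (wlap O phi \_ O) by apply/L2_sqint.
rewrite Rintegral_ip integral_ipH//; last by case: Hf.
have aew' : {ae mu, forall x, O x -> wlap O U.1 x = W x}.
  apply: filterS aew => x H Ox; rewrite H//.
  by rewrite -[RHS]/((f \_ O) x - Z.1 x) restrict_in.
rewrite (ip_ae_on oO sl sW slphi aew') ipBl// (green oO VZ Hphi Lphi wphi) opprK HZ//.
exact: H10_V0.
Qed.

(** [navier_to_neumann] uses an unspecified solution, which has to be compared with U. Their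
    difference d is itself an admissible test function; hence Delta d = 0, and Green's formula
    applied to d gives grad d = 0. *)
Lemma nav_unique O f Z U u : open O -> H1 O f -> nav_data O (pr O f) Z U ->
  navier_solution O f u ->
  {ae mu, forall x, O x -> wlap O u x = f x - Z.1 x} /\ ipG (pr O u - U) (pr O u - U) = 0.
Proof.
move=> oO Hf HD [[HLu H10u] Equ].
have [[[HLU H10U] EqU] aew] := nav_solution oO Hf HD.
have [[VZ HZ] [VU HU]] := HD.
have Vu := H10_V0 oO H10u; have VUu := H10_V0 oO H10U.
have [_ aU] := V0_H10 oO VU.
have [su sU] := (V0_sq Vu, V0_sq VUu).
have VD := subspaceB (V0_subspace O) Vu VUu; have sD := V0_sq VD.
have [H10d ad] := V0_H10 oO VD; pose d := (pr O u - pr O U.1).1.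
have [Lu /is_wlapP wu] := wlapP HLu; have [LU /is_wlapP wU] := wlapP HLU.
have [slu slU] : sqint mu (wlap O u \_ O) /\ sqint mu (wlap O U.1 \_ O).
  by split; apply/L2_sqint.
pose g := wlap O u \_ O - wlap O U.1 \_ O; have sg : sqint mu g by exact: sqintB.
have Lg : L2 O g by apply/L2_sqint => //; exact: sqint_restrict.
have wd : is_wlap O d g.
  apply/is_wlapP => phi tp; have sp := test_sqint tp.
  have slp := test_sqint (test_laplacian tp).
  rewrite ip_restrict_test; last exact: test_laplacian.
  rewrite ip_restrict_test// /d /g.
  by rewrite [LHS](ipBl (proj1 su) (proj1 sU) slp) ipBl// wu// wU.
have HLd : HLap O d by split; [case: H10d => -[]|exists g].
have [Ld /is_wlapP wd'] := wlapP HLd.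
have sld : sqint mu (wlap O d \_ O) by apply/L2_sqint.
have ipg0 : ip mu g (wlap O d \_ O) = 0.
  have := Equ _ HLd H10d; rewrite -(EqU _ HLd H10d) !Rintegral_ip => E.
  by rewrite (ipBl slu slU sld) E subrr.
have aeg : {ae mu, forall x, O x -> wlap O d x = g x}.
  have H := ip_test_ae oO sld sg; move/is_wlapP : wd => wd.
  have {}H := H (fun phi tp => etrans (esym (wd' phi tp))
    (etrans (wd phi tp) (ip_restrict_test g tp))).
  by apply: filterS H => x Hx Ox; rewrite -Hx// restrict_in.
have g0 : ip mu g g = 0.
  rewrite -ipg0; congr fine; apply: ae_eq_integral => //.
  - by apply/measurable_EFinP; apply: measurable_funM; case: sg.
  - by apply/measurable_EFinP; apply: measurable_funM; [exact: (proj1 sg)|exact: (proj1 sld)].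
  apply: filterS aeg => x H _ /=; have [Ox|nO] := pselect (O x).
    by rewrite restrict_in// H.
  rewrite -[g x]/((wlap O u \_ O) x - (wlap O U.1 \_ O) x).
  by rewrite !restrict_out// subrr !mul0r.
have gae := ip_eq0 sg g0; split.
  apply: filterS2 gae aew => x gx ax Ox; rewrite -ax//.
  move: (gx I); rewrite -[g x]/((wlap O u \_ O) x - (wlap O U.1 \_ O) x) !restrict_in//.
  by move=> /eqP; rewrite subr_eq0 => /eqP.
have sd := sqintX_pr oO H10d.1.
have := green oO (H10_V0 oO H10d) H10d.1 Lg wd.
have -> : ip mu (pr O (pr O u - pr O U.1).1).1 (g \_ O) = 0.
  have z0 : sqint mu (cst 0 : T -> R) by exact: sqint0.
  rewrite (@ip_ae _ _ _ _ _ (pr O (pr O u - pr O U.1).1).1 _ (cst 0)).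
  - by rewrite /ip; under eq_Rintegral do rewrite mulr0; rewrite Rintegral_cst// mul0r.
  - by case: sd.
  - by case: sd.
  - exact: sqint_restrict.
  - by [].
  - exact: aeW.
  - apply: filterS gae => x gx _; rewrite patchE; case: ifP => // _; exact: gx.
move=> /esym/eqP; rewrite oppr_eq0 => /eqP G0.
have aUX : aeX (pr O u - U) (pr O (pr O u - pr O U.1).1).
  apply: (@aeX_trans _ _ (pr O u - pr O U.1)); last exact: aeX_sym.
  by apply: aeXB; [exact: aeX_refl|exact: aeX_sym].
have s1 : sqintX (pr O u - U) := sqintXB su (V0_sq VU).
by rewrite (aeX_ipG s1 sd s1 aUX) ipGC (aeX_ipG s1 sd sd aUX).
Qed.

(** Here the choice made by [get] disappears: any [nav_data] computes the map. *)
Lemma navier_formula O f Z U : open O -> H1 O f -> nav_data O (pr O f) Z U ->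
  forall v, H1 O v -> navier_to_neumann O f v = ipH (nav_pair (pr O f) Z U) (pr O v).
Proof.
move=> oO Hf HD v Hv; rewrite /navier_to_neumann; set u := get _.
have Su : navier_solution O f u.
  by apply: getPex; exists U.1; have [] := nav_solution oO Hf HD.
have [aew G0] := nav_unique oO Hf HD Su; have [[HLu H10u] _] := Su.
have [[VZ HZ] [VU HU]] := HD.
have [sf sv] := (sqintX_pr oO Hf, sqintX_pr oO Hv).
have su := sqintX_pr oO H10u.1; have sU := V0_sq VU.
have [Ll _] := wlapP HLu; have sl : sqint mu (wlap O u \_ O) by apply/L2_sqint.
rewrite integral_ipH//; [|by case: Hv|by case: H10u].
rewrite /ipH; congr (_ + _).
  apply: ip_ae_on => //; [|by case: sv|].
    by apply: sqintB; [case: sf|case: (V0_sq VZ)].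
  apply: filterS aew => x H Ox; rewrite H//.
  by rewrite -[RHS]/((f \_ O) x - Z.1 x) restrict_in.
rewrite -[RHS]/(ipG U (pr O v)); apply/eqP; rewrite -subr_eq0; apply/eqP.
rewrite -(formBl (@ipGL R N))//; apply/eqP; rewrite -sqrf_eq0 eq_le sqr_ge0 andbT.
by apply: le_trans (ipG_cs (sqintXB su sU) sv) _; rewrite G0 mul0r.
Qed.

End navier.

(** * Lipschitz domains: local translations and negligible boundary *)

Section lipschitz_domains.
Context (R : realType) (N : nat).
Local Notation T := 'rV[R]_N.
Local Notation mu := (leb R N).
Implicit Types (O Om : set T) (x y p a : T) (i j k : 'I_N).

Definition nbd O (d : R) : set T := [set x | exists2 y, O y & `|x - y| < d].

Lemma open_nbd O d : open (nbd O d).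
Proof.
rewrite (_ : nbd O d = \bigcup_(y in O) ball y d).
  by apply: bigcup_open => y _; exact: ball_open.
apply/seteqP; split => [x [y Oy xy]|x [y Oy]].
  by exists y => //; rewrite -ball_normE /= distrC.
by rewrite -ball_normE /= distrC => xy; exists y.
Qed.

Lemma nbd_sub O d : 0 < d -> O `<=` nbd O d.
Proof. by move=> d0 x Ox; exists x => //; rewrite subrr normr0. Qed.

Lemma nbd_mono O d d' : d <= d' -> nbd O d `<=` nbd O d'.
Proof. by move=> dd x [y Oy xy]; exists y => //; exact: lt_le_trans dd. Qed.

Lemma nbd_bounded O d : bounded_set O -> bounded_set (nbd O d).
Proof.
move=> [M [_ HM]]; exists (`|M| + 1 + d); split; first exact: num_real.
  move=> r Mr x [y Oy xy].
have yM : `|y| <= `|M| + 1.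
  by apply: HM => //; rewrite (le_lt_trans (ler_norm _))// ltrDl.
rewrite /= -(subrK y x) (le_trans (ler_normD _ _))//.
by move: yM xy Mr; move: (`|y|) (`|x - y|) (`|M|) => u v w; lra.
Qed.

Lemma mulmx_norm_le (Q : 'M[R]_N) : exists2 c : R, 0 <= c & forall x i,
  `|(x *m Q) ord0 i| <= c * `|x|.
Proof.
exists (\sum_(i < N) \sum_(j < N) `|Q j i|).
  by apply: sumr_ge0 => i _; exact: sumr_ge0.
move=> x i; rewrite mxE (le_trans (ler_norm_sum _ _ _))//.
apply: (@le_trans _ _ ((\sum_(j < N) `|Q j i|) * `|x|)); last first.
  rewrite ler_wpM2r// [leRHS](bigD1 i)//= lerDl.
  by apply: sumr_ge0 => j _; exact: sumr_ge0.
rewrite mulr_suml; apply: ler_sum => j _.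
by rewrite normrM mulrC ler_wpM2l// coord_le_norm.
Qed.

(** h is the height above the graph in the rotated coordinates and a points vertically downwards.
    The constant c + M c adds the Lipschitz constant of the k-th rotated coordinate to that of g
    composed with the other ones. *)
Lemma graph_chart Om p : class_C01 Om -> closure Om p -> ~ interior Om p ->
  exists (rho c : R) a (h : T -> R), [/\ 0 < rho, 0 <= c,
    forall x, `|x - p| < rho -> (Om x <-> h x < 0),
    forall x y, h x <= h y + c * `|x - y| &
    forall x (t : R), h (x + t *: a) = h x - t].
Proof.
move=> HC cp ip_; have [Q [k [g [QQ lg nearp]]]] := HC p cp ip_.
have [c c0 Hc] := mulmx_norm_le Q.
have [M [M0 HM]] : exists M : R, 0 <= M /\ forall u v, `|g u - g v| <= M * `|u - v|.
  have [M [_ H]] := lg; exists (`|M| + 1); split; first by rewrite addr_ge0.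
  move=> u v; have := H (`|M| + 1); rewrite (le_lt_trans (ler_norm _)) ?ltrDl//.
  by move=> /(_ isT (u, v)) /=; apply.
have /nbhs_ballP[rho /= rho0 Hrho] := nearp.
pose h x := (x *m Q) ord0 k - g (col' k (x *m Q)).
have Qe : (- delta_mx ord0 k *m Q^T) *m Q = - delta_mx ord0 k :> T.
  by rewrite -mulmxA (mulmx1C QQ) mulmx1.
exists rho, (c + M * c), (- delta_mx ord0 k *m Q^T), h; split => //.
- by rewrite addr_ge0// mulr_ge0.
- move=> x xp; rewrite /h subr_lt0; apply: Hrho.
  by rewrite -ball_normE /= distrC.
- move=> x y; have H1 := Hc (x - y) k.
  have H2 : `|col' k (x *m Q) - col' k (y *m Q)| <= c * `|x - y|.
    rewrite -(linearB (col' k)) -mulmxBl; apply: norm_le_coord => [|i].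
      by rewrite mulr_ge0.
    by rewrite mxE.
  have H3 := le_trans (HM _ _) (ler_wpM2l M0 H2).
  move: H1 H3; rewrite mulmxBl mxE [X in _ + X]mxE !ler_norml /h mulrA mulrDl.
  move: (c * `|x - y|) (M * c * `|x - y|) ((x *m Q) ord0 k) ((y *m Q) ord0 k) => *; lra.
- move=> x t; rewrite /h mulmxDl -scalemxAl Qe scalerN.
  have -> : col' k (x *m Q - t *: delta_mx ord0 k) = col' k (x *m Q).
    apply/rowP => i; rewrite !mxE [_ == k]eq_sym (negbTE (neq_lift _ _)) andbF.
    by rewrite mulr0 subr0.
  by rewrite mxE addrAC; congr (_ + _); rewrite !mxE !eqxx mulr1.
Qed.

(** The width d may depend on the step t: a longer translation compensates a larger thickening of
    [Om]. *)
Definition pushes Om p (r : R) a (t0 : R) := forall t : R, 0 < t < t0 ->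
  exists2 d : R, 0 < d & forall x, nbd Om d x -> `|x - p| <= r -> Om (x + t *: a).

Lemma local_push Om p : open Om -> class_C01 Om -> closure Om p ->
  exists (r : R) a (t0 : R), [/\ 0 < r, 0 < t0 & pushes Om p r a t0].
Proof.
move=> oOm HC cp; have [Omp|nOmp] := pselect (Om p).
  (* At a point of the open set [Om] itself the zero translation works. *)
  have /nbhs_ballP[rho /= rho0 Hrho] : nbhs p Om by exact: open_nbhs_nbhs.
  exists (rho / 2), 0, 1; split => //; first by rewrite divr_gt0.
  move=> t _; exists 1 => // x _ xp; rewrite scaler0 addr0; apply: Hrho.
  by rewrite -ball_normE /= distrC; lra.
have ni : ~ interior Om p by move=> /interior_subset.
have [rho [c [a [h [rho0 c0 Hh hl ha]]]]] := graph_chart HC cp ni.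
(* These radii keep x, its translate and the neighbouring point y of [Om] in the ball of radius rho
   where the chart is valid. The bound t / (c + 1) on d below keeps the rise of h from y to x under
   t, the descent along t a. *)
exists (rho / 4), a, (rho / (4 * (`|a| + 1))).
have a1 : 0 < `|a| + 1 by rewrite ltr_wpDl.
split; [by rewrite divr_gt0|by rewrite divr_gt0// mulr_gt0|].
move=> t /andP[t0]; rewrite ltr_pdivlMr ?mulr_gt0// => tr.
pose d := Num.min (rho / 4) (t / (c + 1)).
have d0 : 0 < d by rewrite lt_min !divr_gt0// ltr_wpDl.
exists d => // x [y Oy xy] xp; move: xy; rewrite lt_min => /andP[xy1 xy2].
apply/Hh.
  rewrite (_ : x + t *: a - p = (x - p) + t *: a); last by rewrite addrAC.
  rewrite (le_lt_trans (ler_normD _ _))// normrZ gtr0_norm//.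
  move: tr xp; move: (`|a|) (`|x - p|) => u v; nra.
have : h y < 0.
  apply/Hh => //; rewrite (_ : y - p = (x - p) - (x - y)); last first.
    by rewrite opprB [RHS]addrC addrA subrK.
  rewrite (le_lt_trans (ler_normB _ _))//; lra.
rewrite ha; have := hl x y; move: xy2; rewrite ltr_pdivlMr ?ltr_wpDl// => xy2.
have := normr_ge0 (x - y); move: (h x) (h y) (`|x - y|) xy2 => u v w; nra.
Qed.

(* Infinitely many disjoint translates of A fit into a bounded set. *)
Lemma disjoint_shifts_null (A : set T) a : bounded_set A -> measurable A ->
  (forall (s t : R) x, A (x + s *: a) -> A (x + t *: a) -> s = t) ->
  mu A = 0%E.
Proof.
move=> bA mA Aa.
pose s (n : nat) : R := n.+1%:R^-1.
pose F n := (fun x => x + s n *: a) @^-1` A.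
have mF n : measurable (F n).
  by rewrite -[F n]setTI; exact: measurable_shift.
have FA n : mu (F n) = mu A by rewrite -(leb_shiftE (s n *: a) mA).
have tF : trivIset setT F.
  apply/trivIsetP => i j _ _ ij; rewrite -subset0 => x [/= Fi Fj].
  move/eqP: ij; apply; have /eqP := Aa _ _ _ Fi Fj.
  by rewrite /s (inj_eq invr_inj) eqr_nat eqSS => /eqP.
have bF : bounded_set (\bigcup_n F n).
  have [M [_ HM]] := bA; exists (`|M| + 1 + `|a|); split; first exact: num_real.
  move=> r Mr x [n _ Fx].
  have yM : `|x + s n *: a| <= `|M| + 1.
    by apply: HM => //; rewrite (le_lt_trans (ler_norm _))// ltrDl.
  rewrite /=; move: Mr (norm_shift_le yM); move: (`|x|) (`|a|) (`|M|) => u v w; lra.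
have mU : measurable (\bigcup_n F n) by exact: bigcup_measurable.
have fin : (mu (\bigcup_n F n) < +oo)%E by exact: leb_bounded.
have muA : mu A \is a fin_num.
  by rewrite ge0_fin_numE//; exact: leb_bounded.
have sumE : mu (\bigcup_n F n) = (\sum_(0 <= n <oo) mu (F n))%E.
  by apply: measure_semi_bigcup.
have bnd n : (n%:R * fine (mu A) <= fine (mu (\bigcup_n F n)))%R.
  have sumc m : (\sum_(0 <= i < m) mu A = (m%:R * fine (mu A))%:E)%E.
    elim: m => [|m IH]; first by rewrite big_geq// mul0r.
    by rewrite big_nat_recr//= IH -{2}(fineK muA) -EFinD -natr1 mulrDl mul1r.
  rewrite -lee_fin fineK ?ge0_fin_numE// sumE -sumc.
  apply: le_trans (nneseries_lim_ge n _); last by [].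
  by rewrite [leRHS](eq_bigr (fun=> mu A))// => i _; rewrite FA.
apply/eqP; rewrite -(fineK muA) eqe; apply/eqP.
apply: contrapT => /eqP m0.
have mp : 0 < fine (mu A) by rewrite lt_neqAle eq_sym m0 fine_ge0.
have := bnd (Num.truncn (fine (mu (\bigcup_n F n)) / fine (mu A))).+1.
by rewrite -ler_pdivlMr// leNgt truncnS_gt.
Qed.

(** Near a boundary point the boundary lies in the zero set of h. As h decreases strictly along a, a
    line in this direction meets that set at most once, and the translates of the local boundary are
    disjoint. *)
Lemma boundary_null Om : open Om -> bounded_set Om -> class_C01 Om ->
  {ae mu, forall x, closure Om x -> Om x}.
Proof.
move=> oOm bOm HC.
pose cb (q : 'rV[rat]_N * 'rV[rat]_N) : set T := cbox (map_mx ratr q.1) (map_mx ratr q.2).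
(* The boxes in which the boundary is negligible; every boundary point will turn out to lie in one
   of them. *)
pose bad q := mu (closure Om `&` ~` Om `&` cb q) = 0%E.
have mB q : measurable (closure Om `&` ~` Om `&` cb q).
  apply: measurableI; last exact: measurable_cbox.
  apply: measurableI; last by apply: measurableC; exact: open_measurable_rV.
  rewrite -[closure _]setCK; apply: measurableC; apply: open_measurable_rV.
  by apply: closed_openC; exact: closed_closure.
have aeq n : {ae mu, forall x,
    if @unpickle ('rV[rat]_N * 'rV[rat]_N)%type n is Some q then
    bad q -> ~ (closure Om `&` ~` Om `&` cb q) x else True}.
  case: unpickle => [q|]; last exact: aeW.
  have [bq|nbq] := pselect (bad q); last by apply: aeW => x /nbq.
  exists (closure Om `&` ~` Om `&` cb q); split => // x /= H.
  by apply: contrapT => H'; apply: H.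
have := ae_foralln aeq; apply: filterS => p Hp cp; apply: contrapT => nOp.
have ni : ~ interior Om p by move=> /interior_subset.
have [rho [c [a [h [rho0 c0 Hh hl ha]]]]] := graph_chart HC cp ni.
have [||q [pq qb]] := @rational_cbox R N (ball p rho) p.
- exact: ball_open.
- exact: ballxx.
have inb x : cb q x -> `|x - p| < rho.
  by move=> /qb; rewrite -ball_normE /= distrC.
have bq : bad q.
  have h0 x : (closure Om `&` ~` Om `&` cb q) x -> h x = 0.
    move=> [[cx nx] /inb qx]; apply/eqP; rewrite eq_le; apply/andP; split; last first.
      by rewrite leNgt; apply/negP => /(Hh _ qx).
    apply: (@limit_le _ _ _ c) => // e e0; rewrite add0r.
    have eP : 0 < Num.min e (rho - `|x - p|) by rewrite lt_min e0 subr_gt0.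
    have [y [Oy]] := cx _ (nbhsx_ballx x _ eP).
    rewrite -ball_normE /= lt_min => /andP[xy1 xy2].
    have yr : `|y - p| < rho.
      rewrite (_ : y - p = (x - p) - (x - y)); last by rewrite opprB [RHS]addrC addrA subrK.
      by rewrite (le_lt_trans (ler_normB _ _))//; lra.
    have := hl x y; have := (Hh _ yr).1 Oy.
    have : c * `|x - y| <= c * e by rewrite ler_wpM2l// ltW.
    lra.
  apply: (@disjoint_shifts_null _ a) => //.
    have [M [_ HM]] := nbd_bounded rho bOm; exists M; split; first exact: num_real.
  move=> r Mr x [[cx _] _].
    apply: (HM r Mr); have [y [Oy xy]] := cx _ (nbhsx_ballx x _ rho0).
    by exists y => //; move: xy; rewrite -ball_normE.
  by move=> s t x /h0 + /h0; rewrite !ha => H1 H2; lra.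
have := Hp (pickle q); rewrite pickleK => /(_ bq); apply; split => // i.
by have /andP[/ltW ? /ltW ?] := pq i; rewrite !mxE; apply/andP.
Qed.

End lipschitz_domains.

(** * The intersection of the H^1_0 spaces of the neighbourhoods of a Lipschitz domain *)

Section intersection.
Context (R : realType) (N : nat).
Local Notation T := 'rV[R]_N.
Local Notation mu := (leb R N).
Local Notation X := ((T -> R) * ('I_N -> T -> R))%type.
Implicit Types (P Q : X) (phi psi chi : T -> R) (O Om : set T) (i : 'I_N) (a p t : T).

Definition shiftX t P : X := (fun x => P.1 (x + t), fun i x => P.2 i (x + t)).

Lemma sqint_shift t (f : T -> R) : sqint mu f -> sqint mu (fun x => f (x + t)).
Proof.
move=> [mf if2]; split; last exact: (integrable_shift t if2).
by apply: (measurableT_comp (f := f)) => //; exact: measurable_shift.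
Qed.

Lemma sqintX_shift t P : sqintX P -> sqintX (shiftX t P).
Proof. by move=> [s1 s2]; split => [|i]; exact: sqint_shift. Qed.

Lemma ipH_shift t P : sqintX P -> ipH (shiftX t P) (shiftX t P) = ipH P P.
Proof.
move=> [s1 s2]; congr (_ + _).
  exact: (Rintegral_shift t (integrable_ip s1 s1)).
by apply: eq_bigr => i _; exact: (Rintegral_shift t (integrable_ip (s2 i) (s2 i))).
Qed.

Lemma shiftX_jet t phi : shiftX t (jet phi) = jet (fun x => phi (x + t)).
Proof. by congr pair; apply/funext => i; rewrite partial_shift. Qed.

Lemma jet_shift_small O phi a (e : R) : test_function O phi -> 0 < e ->
  exists n0, forall n, (n0 <= n)%N ->
    ipH (shiftX (n.+1%:R^-1 *: a) (jet phi) - jet phi)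
        (shiftX (n.+1%:R^-1 *: a) (jet phi) - jet phi) <= e.
Proof.
move=> tp e0; have eN : 0 < e / N.+1%:R by rewrite divr_gt0.
have small f : ccont f -> exists n0, forall n, (n0 <= n)%N ->
    ip mu ((fun x => f (x + n.+1%:R^-1 *: a)) - f)
          ((fun x => f (x + n.+1%:R^-1 *: a)) - f) <= e / N.+1%:R.
  move=> /(shift_cvg a) /cvgrPdist_le /(_ _ eN) [n0 _ H]; exists n0 => n hn.
  by have := H n hn; rewrite sub0r normrN ger0_norm ?ip_ge0.
have [n1 H1] := small _ (test_ccont tp).
have [n2 H2] := choice (fun i => small _ (test_ccont (test_partial i tp))).
exists (maxn n1 (\max_i n2 i)%N) => n hn.
have -> : e = e / N.+1%:R + \sum_(i < N) e / N.+1%:R.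
  rewrite sumr_const card_ord -[_ *+ N]mulr_natr -[X in X + _]mulr1 -mulrDr addrC natr1.
  by rewrite divfK// pnatr_eq0.
apply: lerD; first by apply: H1; apply: leq_trans hn; exact: leq_maxl.
apply: ler_sum => i _; apply: H2; apply: leq_trans hn.
by apply: leq_trans (leq_maxr _ _); exact: leq_bigmax.
Qed.

(** The second component is the Leibniz formula: jets go to jets, but the operation makes sense for
    every pair. *)
Definition mulX chi P : X := (chi * P.1, fun i => chi * P.2 i + partial i chi * P.1).

Lemma mulX_jet chi phi : smooth chi -> smooth phi -> mulX chi (jet phi) = jet (chi * phi).
Proof.
move=> sc sp; congr pair; apply/funext => i /=.
by rewrite partialM 1?addrC// => x; exact: smooth_diff.
Qed.

Lemma mulXB chi P Q : mulX chi (P - Q) = mulX chi P - mulX chi Q.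
Proof.
congr pair; first exact: mulrBr.
apply/funext => i; rewrite -[RHS]/(chi * P.2 i + partial i chi * P.1 -
  (chi * Q.2 i + partial i chi * Q.1)).
rewrite -[(P - Q).2 i]/(P.2 i - Q.2 i) -[(P - Q).1]/(P.1 - Q.1).
by rewrite !mulrBr opprD addrACA.
Qed.

Lemma sqint_mul_bounded (f h : T -> R) (M : R) : measurable_fun setT h ->
  (forall x, `|h x| <= M) -> sqint mu f ->
  sqint mu (h * f) /\ ip mu (h * f) (h * f) <= M ^+ 2 * ip mu f f.
Proof.
move=> mh hM sf; have [mf if2] := sf.
have le2 x : (h * f) x ^+ 2 <= M ^+ 2 * f x ^+ 2.
  rewrite -[(h * f) x]/(h x * f x) exprMn ler_wpM2r ?sqr_ge0//.
  rewrite -real_normK ?num_real// ler_sqr ?nnegrE//.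
  exact: le_trans (hM x).
have ig : mu.-integrable setT (EFin \o (fun x => M ^+ 2 * f x ^+ 2)).
  exact: integrable_EFinZ.
have shf : sqint mu (h * f).
  apply: sqintP; first exact: (measurable_funM mh mf).
  by exists (fun x => M ^+ 2 * f x ^+ 2).
split => //; rewrite /ip -RintegralZl//.
apply: le_Rintegral => //; first exact: integrable_ip.
by move=> x _; rewrite -!expr2.
Qed.

Lemma mulX_bound chi : test_function setT chi -> exists2 C : R, 0 <= C &
  forall P, sqintX P -> sqintX (mulX chi P) /\ ipH (mulX chi P) (mulX chi P) <= C * ipH P P.
Proof.
move=> tc; have cc := test_ccont tc.
have [M0 M00 HM0] := ccont_bounded cc.
have bi i : exists M : R, 0 < M /\ forall x, `|partial i chi x| <= M.
  by have [M] := ccont_bounded (test_ccont (test_partial i tc)); exists M.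
have [m Hm] := choice bi; pose M := M0 + \sum_(i < N) m i.
have mM i : m i <= M.
  rewrite /M (bigD1 i)//= addrCA lerDl; apply: addr_ge0; first exact: ltW.
  by apply: sumr_ge0 => j _; case: (Hm j) => /ltW.
have M0M : M0 <= M by rewrite lerDl; apply: sumr_ge0 => j _; case: (Hm j) => /ltW.
have sq0 : 0 <= M ^+ 2 by exact: sqr_ge0.
exists (M ^+ 2 + 2 * M ^+ 2 + N%:R * (2 * M ^+ 2)).
  apply: addr_ge0; first by apply: addr_ge0 => //; exact: mulr_ge0.
  by apply: mulr_ge0 => //; exact: mulr_ge0.
move=> P [s1 s2].
have [sa1 b1] := sqint_mul_bounded (ccont_measurable cc) (fun x => le_trans (HM0 x) M0M) s1.
have H2 i := sqint_mul_bounded (ccont_measurable cc) (fun x => le_trans (HM0 x) M0M) (s2 i).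
have H3 i := sqint_mul_bounded (ccont_measurable (test_ccont (test_partial i tc)))
  (fun x => le_trans ((Hm i).2 x) (mM i)) s1.
split; first by split => // i; apply: sqintD; [case: (H2 i)|case: (H3 i)].
rewrite /ipH /=.
have bG : ipG (mulX chi P) (mulX chi P) <=
    2 * M ^+ 2 * ipG P P + N%:R * (2 * M ^+ 2) * ip mu P.1 P.1.
  rewrite /ipG mulr_sumr.
  have -> : N%:R * (2 * M ^+ 2) * ip mu P.1 P.1 =
      \sum_(i < N) (2 * M ^+ 2 * ip mu P.1 P.1).
    by rewrite sumr_const card_ord -[RHS]mulr_natl !mulrA.
  rewrite -big_split; apply: ler_sum => i _ /=.
  apply: le_trans (ip_le2 (H2 i).1 (H3 i).1) _.
  have := (H2 i).2; have := (H3 i).2; lra.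
have g0 := ipG_ge0 P; have p0 := ip_ge0 mu P.1; have n0 : 0 <= N%:R :> R by [].
have n1 : 0 <= N%:R * (2 * M ^+ 2) * ipG P P.
  by apply: mulr_ge0 => //; apply: mulr_ge0 => //; exact: mulr_ge0.
have n2 : 0 <= M ^+ 2 * ipG P P by exact: mulr_ge0.
have n3 : 0 <= M ^+ 2 * ip mu P.1 P.1 by exact: mulr_ge0.
move: b1 bG n1 n2 n3; rewrite !mulrDl !mulrDr.
move: (ip mu (chi * _) _) (ipG (mulX _ _) _) (ip mu P.1 P.1) (ipG P P) => u v w z.
move: (N%:R : R) (M ^+ 2) => n k; clear; lra.
Qed.

Lemma V0_mulX O chi P : test_function setT chi -> V0 O P -> V0 O (mulX chi P).
Proof.
move=> tc [sP HP]; have [C C0 HC] := mulX_bound tc.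
split; first by case: (HC P sP).
move=> e e0; have [phi tp Pp] := HP _ (divr_gt0 e0 (ltr_wpDl C0 ltr01)).
have sc := test_smooth tc; have sp := test_smooth tp.
exists (chi * phi); first exact: test_mull.
rewrite -mulX_jet// -mulXB.
have [_] := HC _ (sqintXB sP (sqintX_jet tp)); move/le_trans; apply.
move: Pp; rewrite ler_pdivlMr ?ltr_wpDl//; have := ipH_ge0 (P - jet phi).
move: (ipH _ _) => z; clear -C0; nra.
Qed.

Definition nearby Om P := forall d : R, 0 < d -> V0 (nbd Om d) P.

Lemma nearby_subspaceB Om P Q : nearby Om P -> nearby Om Q -> nearby Om (P - Q).
Proof.
by move=> HP HQ d d0; apply: subspaceB (HP d d0) (HQ d d0); exact: V0_subspace.
Qed.

(* Test functions of a thin neighbourhood of Om, cut off near p, become test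
   functions of Om after a small translation by - t a. *)
Lemma local_V0 Om chi p (r : R) a (t0 : R) P : 0 < t0 -> pushes Om p r a t0 ->
  test_function setT chi -> (forall x, chi x != 0 -> `|x - p| <= r) ->
  nearby Om P -> V0 Om (mulX chi P).
Proof.
move=> t00 push tc chir HP; have [C C0 HC] := mulX_bound tc.
have [sP _] := HP 1 ltr01; have sc := test_smooth tc.
split; first by case: (HC P sP).
(* 18 C + 4 is the sum of the final errors: 2 C from replacing P by phi0 before the cutoff, 4 from
   translating, 16 C from replacing phi0 by phid after the translation. *)
move=> e e0; pose e1 := e / (18 * C + 4).
have D0 : 0 < 18 * C + 4 by lra.
have e10 : 0 < e1 by rewrite divr_gt0.
(* Two approximations of P are needed. The translation that moves little depends on the function
   translated, so phi0 is fixed before t; the thickening d depends on t, so phid is chosen after it.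
   Translations being isometries, their difference is estimated before translating. *)
have [phi0 tp0 Pp0] := (HP 1 ltr01).2 _ e10.
have tF := test_mull sc tp0.
have [n1 Hn1] := jet_shift_small (- a) tF e10.
pose n := maxn n1 (Num.truncn t0^-1); pose t : R := n.+1%:R^-1.
have tt0 : 0 < t < t0.
  rewrite invr_gt0 ltr0Sn /= -[ltRHS]invrK ltf_pV2 ?posrE ?invr_gt0//.
  apply: lt_le_trans (truncnS_gt _) _; rewrite ler_nat ltnS; exact: leq_maxr.
have [d d0 Hd] := push t tt0.
have [phid tpd Ppd] := (HP d d0).2 _ e10.
have tFd := test_mull sc tpd.
have tpsi : test_function Om (fun x => (chi * phid) (x + t *: (- a))).
  apply: (test_shift tFd) => x sx.
  rewrite -(subrK (t *: a) x) -scalerN; apply: Hd.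
    by case: tFd => _ _; apply.
  rewrite leNgt; apply/negP => rx.
  have rp : 0 < `|x + t *: (- a) - p| - r by rewrite subr_gt0.
  have [z [/= cz]] := sx _ (nbhsx_ballx (x + t *: (- a)) _ rp).
  have zr : `|z - p| <= r.
    by apply: chir; move: cz; rewrite -[(chi * phid) z]/(chi z * phid z) mulf_eq0 => /norP[].
  rewrite -ball_normE /= => xz.
  have tri := ler_normD (x + t *: (- a) - z) (z - p).
  rewrite [_ + (z - p)]addrA subrK in tri; move: tri xz zr; clear.
  by move: (`|_ - z|) (`|z - p|) (`|_ - p|) => u v w; lra.
exists (fun x => (chi * phid) (x + t *: (- a))) => //.
rewrite -shiftX_jet; set tau := shiftX _.
have [sp0 spd] := (test_smooth tp0, test_smooth tpd).
have [sj0 sjd] := (sqintX_jet tp0, sqintX_jet tpd).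
have [sjF sjFd] := (sqintX_jet tF, sqintX_jet tFd).
have [smP bmP] := HC P sP.
have stF : sqintX (tau (jet (chi * phi0))) by exact: sqintX_shift.
have stFd : sqintX (tau (jet (chi * phid))) by exact: sqintX_shift.
rewrite (_ : mulX chi P - _ = (mulX chi P - jet (chi * phi0)) +
  ((jet (chi * phi0) - tau (jet (chi * phi0))) +
   (tau (jet (chi * phi0)) - tau (jet (chi * phid))))); last by rewrite addrA !subrKA.
apply: le_trans (ipH_le2 (sqintXB smP sjF) _) _.
  apply: (subspaceD (V := @sqintX R N) (S := @sqintX R N)).
  - split => //; [exact: sqintX0|by move=> *; exact: sqintX_lin].
  - exact: sqintXB.
  - exact: sqintXB.
have b2 := ipH_le2 (sqintXB sjF stF) (sqintXB stF stFd).
have b1 : ipH (mulX chi P - jet (chi * phi0)) (mulX chi P - jet (chi * phi0)) <= C * e1.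
  rewrite -mulX_jet// -mulXB.
  exact: le_trans (HC _ (sqintXB sP sj0)).2 (ler_wpM2l C0 Pp0).
have b3 : ipH (jet (chi * phi0) - tau (jet (chi * phi0)))
    (jet (chi * phi0) - tau (jet (chi * phi0))) <= e1.
  by rewrite (ipH_symB sjF stF) /tau; exact: (Hn1 n (leq_maxl n1 _)).
have b4 : ipH (tau (jet (chi * phi0)) - tau (jet (chi * phid)))
    (tau (jet (chi * phi0)) - tau (jet (chi * phid))) <= C * (4 * e1).
  rewrite (_ : tau _ - tau _ = tau (mulX chi (jet phi0 - jet phid))); last first.
    by rewrite mulXB !mulX_jet.
  have sjj := sqintXB sj0 sjd.
  rewrite ipH_shift; last exact: (HC _ sjj).1.
  apply: le_trans (HC _ sjj).2 _; apply: (ler_wpM2l C0).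
  rewrite (_ : jet phi0 - jet phid = (P - jet phid) - (P - jet phi0)); last first.
    by rewrite opprB [RHS]addrC addrA subrK.
  apply: le_trans (ipH_le2B (sqintXB sP sjd) (sqintXB sP sj0)) _.
  move: Ppd Pp0; clear; move: (ipH _ _) (ipH _ _) => u v; lra.
have ee : e = (18 * C + 4) * e1 by rewrite /e1 mulrC divfK// gt_eqF.
rewrite ee; move: b1 b2 b3 b4; move: (ipH _ _) (ipH _ _) (ipH _ _) (ipH _ _) => u v w z.
have : 0 <= C * e1 by rewrite mulr_ge0// ltW.
clear -e10; lra.
Qed.

(** P multiplied by the product of the 1 - chi p. Successive subtraction exhibits each removed piece
    as some [mulX (chi p) Q], to which [local_V0] applies. *)
Fixpoint cutoff (chi : T -> T -> R) (s : seq T) P : X :=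
  if s is p :: s' then cutoff chi s' (P - mulX (chi p) P) else P.

Lemma cutoff_bound (chi : T -> T -> R) (s : seq T) :
  (forall p, p \in s -> test_function setT (chi p)) ->
  exists2 C : R, 0 <= C & forall P, sqintX P ->
    sqintX (cutoff chi s P) /\ ipH (cutoff chi s P) (cutoff chi s P) <= C * ipH P P.
Proof.
elim: s => [|p s IH] Hs; first by exists 1 => // P sP; rewrite mul1r.
have [|C C0 HC] := IH; first by move=> q qs; apply: Hs; rewrite inE qs orbT.
have [D D0 HD] := mulX_bound (Hs p (mem_head _ _)).
exists (C * (2 + 2 * D)); first by rewrite mulr_ge0// addr_ge0// mulr_ge0.
move=> P sP; have [sm bm] := HD P sP; have [sc bc] := HC _ (sqintXB sP sm).
split => //; apply: le_trans bc _; rewrite -mulrA ler_wpM2l//.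
by apply: le_trans (ipH_le2B sP sm) _; lra.
Qed.

Lemma cutoffB (chi : T -> T -> R) s P Q :
  cutoff chi s (P - Q) = cutoff chi s P - cutoff chi s Q.
Proof.
elim: s P Q => //= p s IH P Q; rewrite -IH; congr cutoff.
by rewrite mulXB !opprB addrACA [RHS]addrACA [- Q + _]addrC.
Qed.

Lemma cutoff_jet (chi : T -> T -> R) (s : seq T) phi :
  (forall p, p \in s -> smooth (chi p)) -> smooth phi ->
  cutoff chi s (jet phi) = jet (fun x => phi x * \prod_(p <- s) (1 - chi p x)).
Proof.
elim: s phi => [|p s IH] phi Hs sp /=.
  by congr jet; apply/funext => x; rewrite big_nil mulr1.
have sc := Hs p (mem_head _ _).
rewrite mulX_jet// -jetB//; last exact: smoothM.
rewrite IH; [|by move=> q qs; apply: Hs; rewrite inE qs orbT|].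
  congr jet; apply/funext => x; rewrite big_cons.
  by rewrite -[(phi - chi p * phi) x]/(phi x - chi p x * phi x); ring.
by have := smoothD sp (smoothZ (-1) (smoothM sc sp)); rewrite scaleN1r.
Qed.

(** What is left after removing a piece is still [nearby], so the next piece is treated in the same
    way. *)
Lemma cutoff_V0 Om (chi : T -> T -> R) (s : seq T) P :
  (forall p, p \in s -> test_function setT (chi p) /\
    forall Q, nearby Om Q -> V0 Om (mulX (chi p) Q)) ->
  nearby Om P -> V0 Om (P - cutoff chi s P).
Proof.
elim: s P => [|p s IH] P Hs HP /=.
  by rewrite subrr; have [_ V00 _] := V0_subspace Om.
have [tc lc] := Hs p (mem_head _ _).
have VmP := lc P HP.
have HP' : nearby Om (P - mulX (chi p) P).
  by apply: nearby_subspaceB => // d d0; apply: V0_mulX => //; exact: HP.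
have V1 : V0 Om (P - mulX (chi p) P - cutoff chi s (P - mulX (chi p) P)).
  by refine (IH (P - mulX (chi p) P) _ HP') => q qs; apply: Hs; rewrite inE qs orbT.
have := subspaceD (V0_subspace Om) VmP V1.
by rewrite addrA (addrC (mulX (chi p) P) (P - _)) subrK.
Qed.

Lemma seq_min (s : seq T) (f : T -> R) : (forall p, p \in s -> 0 < f p) ->
  exists2 d : R, 0 < d & forall p, p \in s -> d <= f p.
Proof.
elim: s => [|p s IH] Hs; first by exists 1.
have [|d d0 Hd] := IH; first by move=> q qs; apply: Hs; rewrite inE qs orbT.
exists (Num.min d (f p)); first by rewrite lt_min d0 Hs// mem_head.
move=> q; rewrite inE => /predU1P[->|/Hd]; first by rewrite ge_min lexx orbT.
by rewrite ge_min => ->.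
Qed.

(* Finitely many chi p equal to 1 near p cover closure Om; the part of P
   multiplied by the product of the 1 - chi p has to vanish. *)
Lemma nearby_V0 Om P : open Om -> bounded_set Om -> class_C01 Om -> nearby Om P -> V0 Om P.
Proof.
move=> oOm bOm HC HP.
(* c p collects a radius, a direction and a maximal step. Translations have to work up to twice the
   radius, where the plateau function equal to 1 within the radius has its support. *)
have data p : exists c : R * (T * R), closure Om p ->
    [/\ 0 < c.1, 0 < c.2.2 & pushes Om p (2 * c.1) c.2.1 c.2.2].
  have [cp|ncp] := pselect (closure Om p); last by exists (1, (0, 1)).
  have [r [a [t0 [r0 t00 H]]]] := local_push oOm HC cp.
  exists (r / 2, (a, t0)) => _; split => //=; first by rewrite divr_gt0.
  by rewrite mulrC divfK.
have [c Hc] := choice data.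
have bcl : bounded_set (closure Om).
  have [M [_ HM]] := nbd_bounded 1 bOm; exists M; split; first exact: num_real.
  move=> r Mr x cx; apply: (HM r Mr); have [y [Oy xy]] := cx _ (nbhsx_ballx x _ ltr01).
  by exists y => //; move: xy; rewrite -ball_normE.
have ccl : compact (closure Om).
  by apply: bounded_closed_compact => //; exact: closed_closure.
have Hchi p : exists chi : T -> R, closure Om p ->
    [/\ test_function setT chi, forall x, `|x - p| <= (c p).1 -> chi x = 1 &
      forall x, chi x != 0 -> `|x - p| <= 2 * (c p).1].
  have [cp|ncp] := pselect (closure Om p); last by exists 0.
  by have [c0 _ _] := Hc p cp; have [chi H] := plateau p c0; exists chi.
have [chi Hchi'] := choice Hchi.
(* The cover uses half the radii: a point at distance less than d of such a ball, d being at most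
   every half radius, is still where chi p = 1. *)
move: ccl; rewrite compact_cover => /(_ T (closure Om) (fun p => ball p ((c p).1 / 2))).
move=> [|x cx|D Dcl Dcov].
- by move=> p _; exact: ball_open.
- exists x => //; apply: ballxx; have [c0 _ _] := Hc x cx; exact: divr_gt0.
pose s : seq T := finmap.enum_fset D.
have Ds p : p \in s -> closure Om p by move=> ps; apply/set_mem/Dcl.
have [|d d0 Hd] := @seq_min s (fun p => (c p).1 / 2).
  by move=> p /Ds /Hc [c0 _ _]; exact: divr_gt0.
have VPc : V0 Om (P - cutoff chi s P).
  apply: cutoff_V0 HP => p pD; have cp := Ds p pD.
  have [t1 t2 t3] := Hchi' p cp; have [c0 c1 c2] := Hc p cp.
  by split => // Q HQ; exact: (local_V0 c1 c2 t1 t3 HQ).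
have [|C C0 HCut] := @cutoff_bound chi s.
  by move=> p pD; have [] := Hchi' p (Ds p pD).
have [sP HPd] := HP d d0.
(* P is approximated by jets of test functions of [nbd Om d]. At each point where such a function is
   nonzero some 1 - chi p vanishes, so [cutoff] kills it and 0 approximates the remaining part of
   P. *)
have Vc : V0 Om (cutoff chi s P).
  apply: V0_closed; first by case: (HCut P sP).
  move=> e e0; have [phi tp Pp] := HPd _ (divr_gt0 e0 (ltr_wpDl C0 ltr01)).
  exists (jet 0); first exact: V0_jet (test0 Om).
  have -> : jet 0 = cutoff chi s (jet phi).
    rewrite cutoff_jet; last exact: test_smooth tp.
      congr jet; apply/funext => x; have [->|px] := eqVneq (phi x) 0; first by rewrite mul0r.
      have [y Oy xy] : nbd Om d x.
        by case: tp => _ _; apply; exact: subset_closure.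
      have [p pD'] := Dcov y (subset_closure Oy).
      have pD : p \in s by exact: pD'.
      rewrite -ball_normE /= => py; rewrite (big_rem p)//=.
      have [_ chi1 _] := Hchi' p (Ds p pD).
      suff -> : chi p x = 1 by rewrite subrr mul0r mulr0.
      apply: chi1.
      have := Hd p pD; have := ler_normD (x - y) (y - p); rewrite addrA subrK.
      by rewrite [`|y - p|]distrC; lra.
    by move=> p pD; have [/test_smooth] := Hchi' p (Ds p pD).
  rewrite -cutoffB.
  have [_] := HCut _ (sqintXB sP (sqintX_jet tp)); move/le_trans; apply.
  move: Pp; rewrite ler_pdivlMr ?ltr_wpDl//; have := ipH_ge0 (P - jet phi).
  move: (ipH _ _) => z; clear -C0; nra.
by have := subspaceD (V0_subspace Om) VPc Vc; rewrite subrK.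
Qed.

End intersection.

(** * Projections on shrinking domains and vanishing shells *)

Section convergence.
Context (R : realType) (N : nat).
Local Notation T := 'rV[R]_N.
Local Notation mu := (leb R N).
Local Notation X := ((T -> R) * ('I_N -> T -> R))%type.
Implicit Types (P Q G Z U K : X) (f g h u v : T -> R) (O Om : set T) (i : 'I_N).

Lemma ipH_abs P Q : sqintX P -> sqintX Q ->
  `|ipH P Q| <= Num.sqrt (ipH P P) * Num.sqrt (ipH Q Q).
Proof.
move=> sP sQ; rewrite -sqrtrM ?ipH_ge0// -sqrtr_sqr ler_wsqrtr//; exact: ipH_cs.
Qed.

Lemma ip_vanish O f h : open O -> sqint mu f -> sqint mu h ->
  {ae mu, forall x, ~ O x -> h x = 0} -> ip mu (f \_ O) h = ip mu f h.
Proof.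
move=> oO sf sh h0; have sfO := sqint_restrict oO sf; congr fine.
apply: ae_eq_integral => //.
- by apply/measurable_EFinP; apply: measurable_funM; [case: sfO|case: sh].
- by apply/measurable_EFinP; apply: measurable_funM; [case: sf|case: sh].
apply: filterS h0 => x hx _ /=; have [Ox|nO] := pselect (O x).
  by rewrite restrict_in.
by rewrite hx// !mulr0.
Qed.

Definition restrictX O P : X := (P.1 \_ O, fun i => P.2 i \_ O).

Lemma sqintX_restrict O P : open O -> sqintX P -> sqintX (restrictX O P).
Proof. by move=> oO [s1 s2]; split => [|i]; exact: sqint_restrict. Qed.

Lemma ipG_restrict O P Q : open O -> sqintX P -> V0 O Q -> ipG (restrictX O P) Q = ipG P Q.
Proof.
move=> oO [_ sP] VQ; have [_ sQ] := V0_sq VQ; apply: eq_bigr => i _.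
by apply: ip_vanish => //; apply: filterS (V0_vanish oO VQ) => x H /H[_]; apply.
Qed.

(** Both components of the pair vanish almost everywhere outside [O]. This lets [Estar] of the limit
    functional be evaluated by a pairing over the larger domain. *)
Lemma nav_pair_restrict O f Z U P : open O -> H1 O f -> nav_data O (pr O f) Z U ->
  sqintX P -> ipH (nav_pair (pr O f) Z U) (restrictX O P) = ipH (nav_pair (pr O f) Z U) P.
Proof.
move=> oO Hf HD sP; have sK := nav_pair_sq (sqintX_pr oO Hf) HD.
have [[VZ _] [VU _]] := HD; have [[sK1 sK2] [sP1 sP2]] := (sK, sP).
rewrite ipHC [RHS]ipHC; congr (_ + _).
  apply: ip_vanish => //; apply: filterS (V0_vanish oO VZ) => x Hx nO.
  rewrite -[LHS]/((f \_ O) x - Z.1 x) restrict_out//.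
  by have [->] := Hx nO; rewrite subrr.
apply: eq_bigr => i _; apply: ip_vanish => //.
by apply: filterS (V0_vanish oO VU) => x Hx /Hx[_]; apply.
Qed.

Lemma invS_small (e : R) : 0 < e -> exists n : nat, n.+1%:R^-1 <= e.
Proof.
move=> e0; exists (Num.truncn e^-1).
rewrite -[leRHS]invrK lef_pV2 ?posrE ?invr_gt0//; exact/ltW/truncnS_gt.
Qed.

Lemma closed_nbd_cap Om x : (forall d : R, 0 < d -> nbd Om d x) -> closure Om x.
Proof.
move=> H A /nbhs_ballP[d /= d0 HA]; have [y Oy xy] := H d d0.
by exists y; split => //; apply: HA; rewrite -ball_normE.
Qed.

(* The minimisers on V0 O lie, in energy, between those on V0 Om and on
   V0 (nbd Om d), and the latter converge as d -> 0 by nearby_V0. *)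
Lemma V0_limit Om (l : X -> R) (C e : R) Z : (0 < N)%N -> open Om -> bounded_set Om ->
  class_C01 Om ->
  (forall (a : R) P Q, V0 (nbd Om 1) P -> V0 (nbd Om 1) Q -> l (a *: P + Q) = a * l P + l Q) ->
  0 <= C -> (forall P, V0 (nbd Om 1) P -> l P ^+ 2 <= C * ipG P P) ->
  represents (@ipG R N) (V0 Om) l Z -> 0 < e ->
  exists2 d : R, 0 < d <= 1 & forall O Z', Om `<=` O -> O `<=` nbd Om d ->
    represents (@ipG R N) (V0 O) l Z' -> ipG (Z' - Z) (Z' - Z) <= e.
Proof.
move=> N0 oOm bOm cOm lL C0 lC HZ e0.
(* [W 0] is the neighbourhood of width 1, on which l is linear and bounded by hypothesis. *)
pose W n := nbd Om (n.+1%:R^-1 : R).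
have bW n : bounded_set (W n) by exact: nbd_bounded.
have n1 n : (n.+1%:R^-1 : R) <= 1 by rewrite invf_le1 ?ler1n.
have sV n : V0 (W n) `<=` V0 (nbd Om 1) by apply: V0_mono; exact: nbd_mono.
have WOm n : Om `<=` W n by apply: nbd_sub; rewrite invr_gt0.
have rep n : exists Zn, represents (@ipG R N) (V0 (W n)) l Zn.
  apply: (riesz (@sqintX_lin R N) (@ipGC R N) (@ipGL R N) (@ipG_ge0 R N)
    (V0_subspace _) (V0_complete N0 (bW n)) _ C0) => [a u v Vu Vv|u Vu].
    by apply: lL; exact: (sV n).
  by apply: lC; exact: (sV n).
have [z Hz] := choice rep.
have [||||n0 Hn0] := represents_decreasing (@sqintX_lin R N) (@ipGC R N) (@ipGL R N)
  (@ipG_ge0 R N) (fun n => V0_subspace (W n)) (V0_subspace Om) _ _ _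
  (fun n => V0_complete N0 (bW n)) _ Hz HZ e0.
- move=> n m nm; apply: V0_mono; apply: nbd_mono.
  by rewrite lef_pV2 ?posrE ?ltr0Sn// ler_nat ltnS.
- by move=> n; apply: V0_mono.
- move=> u Vu; apply: nearby_V0 => // d d0; have [n nd] := invS_small d0.
  by apply: V0_mono (Vu n); exact: nbd_mono.
- move=> n u w V0u Vw uw0; apply: (V0_separated N0 (bW 0%N) _ V0u Vw uw0).
  by apply: nbd_mono; rewrite lef_pV2 ?posrE ?ltr0Sn// ler_nat.
exists (n0.+1%:R^-1); first by rewrite invr_gt0 ltr0Sn n1.
move=> O Z' OmO OW HZ'; apply: le_trans (Hn0 n0 (leqnn _)).
exact: (represents_nested (@sqintX_lin R N) (@ipGC R N) (@ipGL R N) (@ipG_ge0 R N)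
  (V0_subspace Om) (V0_subspace O) (V0_subspace (W n0)) (V0_mono OmO) (V0_mono OW) HZ HZ' (Hz n0)).
Qed.

Lemma sqint_patch (A : set T) f : measurable A -> sqint mu f -> sqint mu (f \_ A).
Proof.
move=> mA [mf if2]; apply: sqintP.
  by apply/(measurable_restrictT _ mA); exact: measurable_funTS.
exists (fun x => f x ^+ 2) => // x.
by rewrite patchE; case: ifP => // _; rewrite expr0n sqr_ge0.
Qed.

Lemma ip_patch_le (A B : set T) f : measurable A -> measurable B -> A `<=` B ->
  sqint mu f -> ip mu (f \_ A) (f \_ A) <= ip mu (f \_ B) (f \_ B).
Proof.
move=> mA mB AB sf; have [sA sB] := (sqint_patch mA sf, sqint_patch mB sf).
apply: le_Rintegral => //; try exact: integrable_ip.
move=> x _; rewrite !patchE; case: ifPn => [/set_mem/AB/mem_set -> //|_].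
by rewrite mulr0 -expr2 sqr_ge0.
Qed.

(** The sets [nbd Om d] minus [closure Om] shrink to the empty set as d tends to 0, and dominated
    convergence applies. *)
Lemma shell_small Om f (e : R) : sqint mu f -> 0 < e ->
  exists2 d : R, 0 < d & forall O, open O -> O `<=` nbd Om d ->
    ip mu (f \_ (O `\` closure Om)) (f \_ (O `\` closure Om)) <= e.
Proof.
move=> sf e0; pose A n := nbd Om (n.+1%:R^-1 : R) `\` closure Om.
have mcl : measurable (closure Om).
  rewrite -[closure Om]setCK; apply: measurableC; apply: open_measurable_rV.
  rewrite openC; exact: closed_closure.
have mA n : measurable (A n).
  by apply: measurableD => //; apply: open_measurable_rV; exact: open_nbd.
have [mf if2] := sf.
have H : \int[mu]_x ((f \_ (A n)) x * (f \_ (A n)) x) @[n --> \oo] --> \int[mu]_x (cst 0 x : R).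
  apply: (@dominated_cvg_Rintegral _ _ _ mu _ _ (fun x => f x ^+ 2)).
  - by move=> n; apply: measurable_funM; case: (sqint_patch (mA n) sf).
  - move=> x; have [cx|ncx] := pselect (closure Om x).
      have E n : (f \_ (A n)) x * (f \_ (A n)) x = 0 by rewrite restrict_out ?mulr0// => -[].
      by under eq_fun do rewrite E; exact: cvg_cst.
    have [d d0 Hd] : exists2 d : R, 0 < d & ~ nbd Om d x.
      apply/not_exists2P => Hx; apply: ncx; apply: closed_nbd_cap => d d0.
      by have [//|/contrapT] := Hx d.
    have [n0 Hn0] := invS_small d0.
    apply/cvgrPdist_le => e1 e10; exists n0 => //= n /= nn.
    rewrite restrict_out; first by rewrite mulr0 subrr normr0 ltW.
    move=> -[nx _]; apply: Hd; apply: nbd_mono nx.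
    by apply: le_trans Hn0; rewrite lef_pV2 ?posrE ?ltr0Sn// ler_nat ltnS.
  - exact: if2.
  - move=> n x; rewrite patchE; case: ifP => _; last by rewrite mulr0 normr0 sqr_ge0.
    by rewrite -expr2 ger0_norm ?sqr_ge0.
move: H; rewrite Rintegral_cst// mul0r => /cvgrPdist_le /(_ _ e0) [n0 _ Hn0].
exists (n0.+1%:R^-1); first by rewrite invr_gt0.
move=> O oO OW; have := Hn0 n0 (leqnn _); rewrite sub0r normrN.
move=> /(le_trans (ler_norm _)); apply: le_trans.
apply: ip_patch_le => //; last by move=> x [/OW].
by apply: measurableD => //; exact: open_measurable_rV.
Qed.

End convergence.

(** * Stability of the Navier cascade under changes of domain and datum *)

Section stability.
Context (R : realType) (N : nat).
Local Notation T := 'rV[R]_N.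
Local Notation mu := (leb R N).
Local Notation X := ((T -> R) * ('I_N -> T -> R))%type.
Implicit Types (P Q G Z U K : X) (f g h u v F : T -> R) (O Om : set T) (i : 'I_N).

Lemma pr_agree Om f F : open Om -> H1 Om f -> H1 setT F ->
  {ae mu, forall x, Om x -> F x = f x} -> aeX (pr Om f) (restrictX Om (pr setT F)).
Proof.
move=> oOm Hf HF fF; have [HFO aF] := H1_restrict oOm openT (@subsetT _ Om) HF.
have sF := sqintX_pr oOm HFO; have sf := sqintX_pr oOm Hf.
have fF' : ae_eq mu setT (f \_ Om) (F \_ Om).
  by apply: filterS fF => x H _; rewrite !patchE; case: ifPn => // /set_mem /H.
have [|_ Hw] := H1_intro oOm (proj1 Hf) (proj2 sF).
  move=> i phi tp; have sd := test_sqint (test_partial i tp).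
  rewrite (ip_ae (proj1 sf) (proj1 sF) sd sd fF'); last exact: aeW.
  exact: pr_by_parts.
apply: aeX_trans aF; split => // i; apply: filterS (Hw i) => x H _ /=.
have [Ox|nO] := pselect (Om x); last by rewrite !restrict_out.
by rewrite [LHS]restrict_in// H// restrict_in.
Qed.

Lemma represents_eq Om (l l' : X -> R) Z : (forall P, V0 Om P -> l P = l' P) ->
  represents (@ipG R N) (V0 Om) l Z -> represents (@ipG R N) (V0 Om) l' Z.
Proof. by move=> H [VZ HZ]; split => // P VP; rewrite HZ// H. Qed.

Lemma ip_le2B f g : sqint mu f -> sqint mu g ->
  ip mu (f - g) (f - g) <= 2 * ip mu f f + 2 * ip mu g g.
Proof.
exact: (form_le2B (@sqint_lin _ _ _ mu) (@ipC _ _ _ mu) (@ip_linl _ _ _ mu) (@ip_ge0 _ _ _ mu)).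
Qed.

Lemma nav_stability Om f F Z U (e : R) : (0 < N)%N -> open Om -> bounded_set Om ->
  class_C01 Om -> H1 Om f -> H1 setT F -> {ae mu, forall x, Om x -> F x = f x} ->
  nav_data Om (pr Om f) Z U -> 0 < e ->
  exists d : R, [/\ 0 < d, d <= 1 & forall O g Z' U', open O -> Om `<=` O -> O `<=` nbd Om d ->
    H1 O g -> H1norm O (g - F) <= d -> nav_data O (pr O g) Z' U' ->
    ipH (nav_pair (pr O g) Z' U' - nav_pair (pr Om f) Z U)
        (nav_pair (pr O g) Z' U' - nav_pair (pr Om f) Z U) <= e].
Proof.
move=> N0 oOm bOm cOm Hf HF fF [HZ HU] e0.
have b1 : bounded_set (nbd Om 1) by exact: nbd_bounded.
(* One Poincare constant for all domains [O] between [Om] and [nbd Om 1]. *)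
have [C [C0 HC]] := V0_poincare N0 b1.
pose G := pr setT F; have sG : sqintX G by exact: sqintX_pr openT HF.
have sf := sqintX_pr oOm Hf; have aG := pr_agree oOm Hf HF fF.
have srG := sqintX_restrict oOm sG.
(* Replacing f by its extension F does not change Z, and the resulting functional [ipG G] makes
   sense on larger domains, as the squeeze requires. *)
have HZG : represents (@ipG R N) (V0 Om) (ipG G) Z.
  apply: represents_eq HZ => P VP; rewrite (aeX_ipG sf srG (V0_sq VP) aG).
  exact: ipG_restrict.
have sZ := V0_sq HZ.1; have sU := V0_sq HU.1.
pose W := (pr Om f).1 - Z.1.
have sW : sqint mu W by apply: sqintB; [case: sf|case: sZ].
(* s is the size of each elementary error and k their total: (8 + 8 C) s for W' - W, then 2 C (8 + 8
   C) s + 2 s for U' - U. *)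
pose k := (1 + 2 * C) * (8 + 8 * C) + 2; have k0 : 0 < k by rewrite /k; nra.
pose s := e / k; have s0 : 0 < s by exact: divr_gt0.
have [|u Vu|d1 /andP[d10 d11] H1] := V0_limit N0 oOm bOm cOm _ (ipG_ge0 G) _ HZG s0.
- by move=> a P Q /V0_sq sP /V0_sq sQ; rewrite ipGC ipGL// [ipG P _]ipGC [ipG Q _]ipGC.
- by have := V0_sq Vu; exact: ipG_cs.
have W0 : 0 <= ip mu W W * C by rewrite mulr_ge0// ip_ge0.
have [a P Q /V0_sq[sP _] /V0_sq[sQ _]|u Vu|d2 /andP[d20 d21] H2] :=
  V0_limit N0 oOm bOm cOm _ W0 _ HU s0.
- rewrite ipC (ip_linl a sP sQ sW) [ip mu P.1 _]ipC [ip mu Q.1 _]ipC.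
  by rewrite opprD mulrN.
- rewrite sqrrN; have [su _] := V0_sq Vu; apply: le_trans (ip_cs sW su) _.
  by rewrite -mulrA ler_wpM2l ?ip_ge0//; exact: HC.
have [d3 d30 H3] := shell_small Om (proj1 sG) s0.
pose d := Num.min (Num.min d1 d2) (Num.min d3 (Num.sqrt s)).
have dP : [/\ 0 < d, d <= d1, d <= d2, d <= d3 & d <= Num.sqrt s].
  by split; rewrite ?lt_min ?ge_min ?lexx ?d10 ?d20 ?d30 ?sqrtr_gt0 ?s0 ?orbT.
move: dP => [d0 dd1 dd2 dd3 ds]; exists d; split => //; first exact: le_trans dd1 d11.
move=> O g Z' U' oO OmO Od Hg gF [HZ' HU'].
have bO : bounded_set O.
  have [M [Mr HM]] := nbd_bounded d bOm; exists M; split => // r Mr' x Ox.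
  by apply: (HM r Mr'); exact: Od.
have On1 : O `<=` nbd Om 1.
  by apply: subset_trans Od _; apply: nbd_mono; exact: le_trans dd1 d11.
have sg := sqintX_pr oO Hg.
have [sZ' sU'] := (V0_sq HZ'.1, V0_sq HU'.1).
have [HFO aFO] := H1_restrict oO openT (@subsetT _ O) HF.
have sFO := sqintX_pr oO HFO; have srO := sqintX_restrict oO sG.
have [HgF agF] := H1B oO Hg HFO.
have gFs : ipH (pr O g - restrictX O G) (pr O g - restrictX O G) <= s.
  have ag := aeX_trans agF (aeXB (aeX_refl _) aFO).
  rewrite -(aeX_ipHH (sqintX_pr oO HgF) (sqintXB sg srO) ag).
  rewrite -[leRHS]sqr_sqrtr ?(ltW s0)// -[leLHS]sqr_sqrtr ?ipH_ge0//.
  by rewrite ler_sqr ?nnegrE ?sqrtr_ge0// -H1normE//; exact: le_trans ds.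
(* Y solves the first problem on [O] with datum F: it differs from Z' only by the datum, and from Z
   only by the domain. *)
have [Y HY] := represents_dir N0 bO sG.
have sY := V0_sq HY.1.
have ZY : ipG (Z' - Y) (Z' - Y) <= s.
  apply: (represents_stable (@ipGL R N) (@ipG_ge0 R N)
    (V0_subspace O) (ltW s0) HZ' HY) => P VP.
  rewrite -(ipG_restrict oO sG VP) -(formBl (@ipGL R N))//; last exact: V0_sq VP.
  apply: le_trans (ipG_cs (sqintXB sg srO) (V0_sq VP)) _.
  by rewrite ler_wpM2r ?ipG_ge0//; apply: le_trans (ipG_le _) gFs.
have YZ : ipG (Y - Z) (Y - Z) <= s.
  by apply: H1 HY => //; apply: subset_trans Od _; exact: nbd_mono.
have ZZ : ipG (Z' - Z) (Z' - Z) <= 4 * s.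
  rewrite (_ : Z' - Z = (Z' - Y) + (Y - Z)); last by rewrite addrA subrK.
  apply: le_trans (ipG_le2 (sqintXB sZ' sY) (sqintXB sY sZ)) _; lra.
have sub := subspaceB (V0_subspace (nbd Om 1)).
have VZZ : V0 (nbd Om 1) (Z' - Z).
  by apply: sub; [exact: V0_mono On1 _ HZ'.1|exact: V0_mono (subset_trans OmO On1) _ HZ.1].
have ZZ1 : ip mu (Z'.1 - Z.1) (Z'.1 - Z.1) <= C * (4 * s).
  by apply: le_trans (HC _ VZZ) _; rewrite ler_wpM2l.
have mA : measurable (O `\` closure Om).
  apply: measurableD; first exact: open_measurable_rV.
  rewrite -[closure Om]setCK; apply: measurableC; apply: open_measurable_rV.
  by rewrite openC; exact: closed_closure.
have sA := sqint_patch mA (proj1 sG).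
(* The boundary being null, F restricted to [O] and f restricted to [Om] differ only on [O] minus
   [closure Om], the shell where F is small. *)
have ff : ip mu ((restrictX O G).1 - (pr Om f).1) ((restrictX O G).1 - (pr Om f).1) <= s.
  have sD := sqintB (proj1 srO) (proj1 sf).
  have DA : ae_eq mu setT ((restrictX O G).1 - (pr Om f).1) (G.1 \_ (O `\` closure Om)).
    apply: filterS2 fF (boundary_null oOm bOm cOm) => x Fx bx _.
    rewrite -[LHS]/((G.1 \_ O) x - (f \_ Om) x).
    have [Omx|nOm] := pselect (Om x).
      rewrite restrict_in; last exact: OmO.
      rewrite restrict_in// [RHS]restrict_out; last by move=> [_]; apply; exact: subset_closure.
      by rewrite /G /= restrict_in// Fx// subrr.
    rewrite [(f \_ Om) x]restrict_out// subr0; have [Ox|nO] := pselect (O x).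
      by rewrite !restrict_in//; split => // /bx.
    by rewrite !restrict_out// => -[].
  rewrite (ip_ae sD sA sD sA DA DA).
  by apply: H3 => //; apply: subset_trans Od _; exact: nbd_mono.
pose W' := (pr O g).1 - Z'.1.
have sW' : sqint mu W' by apply: sqintB; [case: sg|case: sZ'].
have WW : ip mu (W' - W) (W' - W) <= (8 + 8 * C) * s.
  rewrite (_ : W' - W = ((pr O g).1 - (restrictX O G).1 + ((restrictX O G).1 - (pr Om f).1))
    - (Z'.1 - Z.1)); last first.
    by rewrite addrA subrK /W /W' !opprD !opprK addrACA.
  have s1 := sqintB (proj1 sg) (proj1 srO); have s2 := sqintB (proj1 srO) (proj1 sf).
  have s3 := sqintB (proj1 sZ') (proj1 sZ); have s12 := sqintD s1 s2.
  apply: le_trans (ip_le2B s12 s3) _; have := ip_le2 s1 s2.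
  have := le_trans (ip1_le _) gFs; move: ff ZZ1; clear.
  rewrite -[(pr O g - _).1]/((pr O g).1 - (restrictX O G).1).
  move: (ip _ _ _) (ip _ _ _) (ip _ _ _) (ip _ _ _) => x y z w; lra.
(* The same device for the second problem: domain [O] with the source W of the limit problem. *)
have [Y' HY'] := represents_src N0 bO sW.
have sY' := V0_sq HY'.1.
have UY : ipG (U' - Y') (U' - Y') <= (8 + 8 * C) * s * C.
  have k1 : 0 <= (8 + 8 * C) * s * C.
    by rewrite mulr_ge0// mulr_ge0 ?ltW//; lra.
  apply: (represents_stable (@ipGL R N) (@ipG_ge0 R N)
    (V0_subspace O) k1 HU' HY') => P VP; have [sP _] := V0_sq VP.
  rewrite -/W' -opprD sqrrN -ipBl//; apply: le_trans (ip_cs (sqintB sW' sW) sP) _.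
  rewrite -mulrA; apply: ler_pM => //; [exact: ip_ge0|exact: ip_ge0|].
  by apply: HC; exact: V0_mono On1 _ VP.
have YU : ipG (Y' - U) (Y' - U) <= s.
  by apply: H2 HY' => //; apply: subset_trans Od _; exact: nbd_mono.
have UU : ipG (U' - U) (U' - U) <= 2 * ((8 + 8 * C) * s * C) + 2 * s.
  rewrite (_ : U' - U = (U' - Y') + (Y' - U)); last by rewrite addrA subrK.
  apply: le_trans (ipG_le2 (sqintXB sU' sY') (sqintXB sY' sU)) _; lra.
have -> : e = k * s by rewrite /s mulrC divfK// gt_eqF.
rewrite -[leLHS]/(ip mu (W' - W) (W' - W) + ipG (U' - U) (U' - U)).
apply: le_trans (lerD WW UU) _; rewrite /k; lra.
Qed.

End stability.

(** * Operator bounds, restriction of functionals, and compact convergence *)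

Section operators.
Context (R : realType) (N : nat).
Local Notation T := 'rV[R]_N.
Local Notation mu := (leb R N).
Local Notation X := ((T -> R) * ('I_N -> T -> R))%type.
Implicit Types (P Q G Z U K : X) (f g h u v F : T -> R) (O Om : set T) (i : 'I_N).

Lemma H1dual_norm_le O (L : (T -> R) -> R) (M : R) :
  (forall v, H1 O v -> H1norm O v <= 1 -> `|L v| <= M) -> (H1dual_norm O L <= M%:E)%E.
Proof. by move=> H; apply: ge_ereal_sup => _ [v [Hv v1] <-]; rewrite lee_fin H. Qed.

(** The supremum is not over an empty set: v = 0 is a competitor. *)
Lemma H1dual_norm_ge0 O (L : (T -> R) -> R) : open O -> (0 <= H1dual_norm O L)%E.
Proof.
move=> oO; have t0 := test0 O; have [H0 a0] := H1_test oO t0.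
apply: (@le_trans _ _ (`|L 0|%:E)); first by rewrite lee_fin.
apply: ereal_sup_ubound; exists 0 => //; split => //.
rewrite H1normE// (aeX_ipHH (sqintX_pr oO H0) (sqintX_jet t0) a0).
have -> : jet (0 : T -> R) = jet 0 - jet 0.
  by rewrite -jetB ?subrr//; exact: test_smooth t0.
by rewrite ae_ipH ?sqrtr0//; try exact: sqintX_jet t0; move=> *; exact: aeW.
Qed.

Lemma ipH_H1norm O K v : open O -> sqintX K -> H1 O v ->
  `|ipH K (pr O v)| <= Num.sqrt (ipH K K) * H1norm O v.
Proof. by move=> oO sK Hv; rewrite H1normE//; apply: ipH_abs => //; exact: sqintX_pr. Qed.

Lemma navier_bounded O : (0 < N)%N -> open O -> bounded_set O ->
  bounded_operator O (navier_to_neumann O).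
Proof.
move=> N0 oO bO; have [C [C0 HC]] := nav_pair_bound N0 bO.
have data f : H1 O f -> exists Z U, nav_data O (pr O f) Z U.
  by move=> Hf; apply: nav_data_exists => //; exact: sqintX_pr.
split.
- move=> f Hf; have sf := sqintX_pr oO Hf; have [Z [U HD]] := data f Hf.
  have sK := nav_pair_sq sf HD; have E := navier_formula oO Hf HD; split.
    move=> a u v Hu Hv; have [Huv auv] := H1_lin a oO Hu Hv.
    have [su sv] := (sqintX_pr oO Hu, sqintX_pr oO Hv).
    rewrite !E// ipHC (aeX_ipH (sqintX_pr oO Huv) (sqintX_lin a su sv) sK auv).
    by rewrite ipHL// ![ipH _ (nav_pair _ _ _)]ipHC.
  exists (Num.sqrt (ipH (nav_pair (pr O f) Z U) (nav_pair (pr O f) Z U))) => v Hv.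
  by rewrite E//; exact: ipH_H1norm.
- move=> a f g v Hf Hg Hv; have [Hfg afg] := H1_lin a oO Hf Hg.
  have [sf sg] := (sqintX_pr oO Hf, sqintX_pr oO Hg).
  have [Z [U HD]] := data f Hf; have [Z' [U' HD']] := data g Hg.
  have sfg := sqintX_pr oO Hfg; have slin := sqintX_lin a sf sg.
  have HD2 := nav_data_ae slin sfg (aeX_sym afg) (nav_data_lin a sf sg HD HD').
  rewrite (navier_formula oO Hfg HD2)// (navier_formula oO Hf HD)//.
  rewrite (navier_formula oO Hg HD')//.
  have sK := nav_pair_sq sf HD; have sK' := nav_pair_sq sg HD'.
  rewrite (_ : nav_pair (pr O (a *: f + g)) _ _ =
      a *: nav_pair (pr O f) Z U + nav_pair (pr O g) Z' U'); last first.
    by congr pair; rewrite /= restrict_lin scalerBr opprD addrACA.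
  exact: (ipHL a sK sK' (sqintX_pr oO Hv)).
- exists (Num.sqrt C) => f Hf; have sf := sqintX_pr oO Hf; have [Z [U HD]] := data f Hf.
  have sK := nav_pair_sq sf HD; apply: H1dual_norm_le => v Hv v1.
  rewrite (navier_formula oO Hf HD)//; apply: le_trans (ipH_H1norm oO sK Hv) _.
  apply: (@le_trans _ _ (Num.sqrt (ipH (nav_pair (pr O f) Z U) (nav_pair (pr O f) Z U)) * 1)).
    by rewrite ler_wpM2l ?sqrtr_ge0.
  by rewrite mulr1 [leRHS](congr1 _ (H1normE oO Hf)) -sqrtrM// ler_wsqrtr//; exact: HC.
Qed.

Lemma navier_restrict O Om f Z U v : open O -> open Om -> Om `<=` O -> H1 Om f ->
  nav_data Om (pr Om f) Z U -> H1 O v ->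
  navier_to_neumann Om f (v \_ Om) = ipH (nav_pair (pr Om f) Z U) (pr O v).
Proof.
move=> oO oOm OmO Hf HD Hv; have [HvO avO] := H1_restrict oOm oO OmO Hv.
have svO := sqintX_pr oOm HvO; have sv := sqintX_pr oO Hv.
have [||i|i phi tp|HvOm avOm] := @H1_pr _ _ Om (pr Om v) (v \_ Om) oOm svO.
- by move=> x nO; exact: restrict_out.
- by [].
- by apply: aeW => x nO; exact: restrict_out.
- exact: pr_by_parts.
have sf := sqintX_pr oOm Hf; have sK := nav_pair_sq sf HD.
rewrite (navier_formula oOm Hf HD)// -(nav_pair_restrict oOm Hf HD sv) ipHC [RHS]ipHC.
apply: aeX_ipH => //; first exact: sqintX_pr; first exact: sqintX_restrict.
exact: aeX_trans avOm avO.
Qed.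

(** Compact convergence is applied to the part of [closure D] outside [nbd Om d]: it is compact and
    misses [closure Om], so the domains eventually avoid it. *)
Lemma eventually_nbd (Om_ : R -> set T) Om (D : set T) (d : R) : bounded_set D ->
  (forall e, 0 < e -> Om_ e `<=` D) -> compactly_converges Om_ Om -> 0 < d ->
  exists2 e0 : R, 0 < e0 & forall e, 0 < e < e0 -> Om_ e `<=` nbd Om d.
Proof.
move=> bD OmD Hc d0; pose K := closure D `&` ~` nbd Om d.
have cK : compact K.
  apply: bounded_closed_compact.
    have [M [_ HM]] := nbd_bounded 1 bD; exists M; split; first exact: num_real.
    move=> r Mr x [cx _]; apply: (HM r Mr).
    have [y [Dy xy]] := cx _ (nbhsx_ballx x _ ltr01).
    by exists y => //; move: xy; rewrite -ball_normE.
  apply: closedI; first exact: closed_closure.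
  by apply: open_closedC; exact: open_nbd.
have KOm : K `<=` ~` closure Om.
  move=> x [_ nx] cx; apply: nx; have [y [Oy xy]] := cx _ (nbhsx_ballx x _ d0).
  by exists y => //; move: xy; rewrite -ball_normE.
have [|e0 e00 He] := Hc K cK; first by move=> x /KOm; right.
exists e0 => // e ee0; have [_ _ /(_ KOm) H] := He e ee0.
move=> x Ox; apply: contrapT => nx; have /andP[ep _] := ee0.
have : K x by split => //; apply: subset_closure; exact: OmD ep _ Ox.
by move=> /H; apply; exact: subset_closure.
Qed.

End operators.

Theorem theorem5p6 (R : realType) (N : nat) (hN : (0 < N)%N)
  (D : set 'rV[R]_N) (hD : bounded_set D)
  (Om_ : R -> set 'rV[R]_N) (Om : set 'rV[R]_N)
  (dom_ : forall e : R, 0 < e -> domain (Om_ e)) (dom : domain Om)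
  (Om_D : forall e : R, 0 < e -> Om_ e `<=` D) (OmD : Om `<=` D)
  (Om_C01 : class_C01 Om)
  (Om_sub : forall e : R, 0 < e -> Om `<=` Om_ e)
  (Om_cvg : compactly_converges Om_ Om)
  (E : ('rV[R]_N -> R) -> 'rV[R]_N -> R) (hE : extension_operator Om E) :
  EEstar_converges Om_ Om E
    (fun e => navier_to_neumann (Om_ e)) (navier_to_neumann Om).
Proof.
have oOm : open Om by case: dom.
have bdd O : O `<=` D -> bounded_set O.
  move=> OD; have [M [Mr HM]] := hD; exists M; split => // r Mr' x Ox.
  by apply: (HM r Mr'); exact: OD.
have bOm := bdd _ OmD.
split; first by move=> e e0; apply: navier_bounded => //; [case: (dom_ e e0)|exact: bdd (Om_D e e0)].
  exact: navier_bounded.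
move=> f_ f Hf_ Hf cf; have [E1 E2 _ _] := hE; have HF := E1 f Hf.
have sf := sqintX_pr oOm Hf.
have [Z [U HD]] := nav_data_exists hN bOm sf; have sK := nav_pair_sq sf HD.
pose L (e : R) v := navier_to_neumann (Om_ e) (f_ e) v - Estar Om (navier_to_neumann Om f) v.
change (H1dual_norm (Om_ e) (L e) @[e --> 0^'+] --> 0%E).
have small (s : R) : 0 < s -> \forall e \near 0^'+, (0 <= H1dual_norm (Om_ e) (L e) <= s%:E)%E.
  (* The stability lemma bounds a squared norm, hence s^2. The same d then serves as thickness for
     [Om_ e] and as tolerance for [f_ e]. *)
  move=> s0; have s20 : 0 < s ^+ 2 by rewrite exprn_gt0.
  have [d [d0 d1 Hd]] := nav_stability hN oOm bOm Om_C01 Hf HF (E2 f Hf) HD s20.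
  have [e0 e00 He0] := eventually_nbd hD Om_D Om_cvg d0.
  have near1 : \forall e \near 0^'+, 0 < e < e0.
    near=> e; apply/andP; split; near: e; [exact: nbhs_right_gt|exact: nbhs_right_lt].
  move/cvgrPdist_le : cf => /(_ _ d0) near2.
  apply: filterS2 near1 near2 => e ee0; have /andP[ep _] := ee0.
  have [oO _] := dom_ e ep; have OmO := Om_sub e ep.
  rewrite sub0r normrN ger0_norm ?sqrtr_ge0// => fd.
  apply/andP; split; first exact: H1dual_norm_ge0.
  have sfe := sqintX_pr oO (Hf_ e ep).
  have [Ze [Ue HDe]] := nav_data_exists hN (bdd _ (Om_D e ep)) sfe.
  have sKe := nav_pair_sq sfe HDe.
  have Ks := Hd _ _ _ _ oO OmO (He0 e ee0) (Hf_ e ep) fd HDe.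
  apply: H1dual_norm_le => v Hv v1; have sv := sqintX_pr oO Hv.
  rewrite /L /Estar /= (navier_formula oO (Hf_ e ep) HDe)// (navier_restrict oO oOm OmO Hf HD)//.
  rewrite -(formBl (@ipHL R N) sKe sK sv).
  apply: le_trans (ipH_H1norm oO (sqintXB sKe sK) Hv) _.
  rewrite -[leRHS]mulr1; apply: ler_pM => //; rewrite ?sqrtr_ge0//.
  by rewrite -[leRHS]ger0_norm ?(ltW s0)// -sqrtr_sqr ler_wsqrtr.
(* The dual norm is an extended real, so it has to be finite eventually before real convergence
   makes sense; the estimate with s = 1 gives this. *)
apply/fine_cvgP; split.
  apply: filterS (small 1 ltr01) => e /andP[h0 h1].
  by rewrite fin_numE; apply/andP; split; apply/eqP => h; rewrite h in h0 h1.
apply/cvgrPdist_le => s s0; apply: filterS (small s s0) => e /andP[h0 h1].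
rewrite sub0r normrN /=; move: h0 h1; case: (H1dual_norm _ _) => //= r.
by rewrite !lee_fin => r0 rs; rewrite ger0_norm.
Unshelve. all: by end_near.
Qed.
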